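(* Let $\varphi\in L^2(\mathbb{R})$ be such that $\Phi_\varphi$ has singularities only at finitely many points $X=\{x_1,\dots,x_s\}\subset\mathbb{T}$ (distinct points), the order of the singularity at $x_j$ being $\lambda_j\in\mathbb{N}$, $1\le j\le s$. Put $|\Lambda|=\sum_{j=1}^s\lambda_j$ and assume $|\Lambda|\ge 1$. Let $\Omega\subset\mathbb{Z}$ be a set of $|\Lambda|$ consecutive integers and $\Omega^c=\mathbb{Z}\setminus\Omega$. Then the system $\{\varphi(\cdot+k)\}_{k\in\Omega^c}$ is an $M$-basis in $S(\varphi)$.
   Context: $\mathbb{T}=\mathbb{R}/\mathbb{Z}$, $\mathbb{N}=\{1,2,\dots\}$. The Fourier transform on $L^2(\mathbb{R})$ is the isometry given for $f\in L^1(\mathbb{R})\cap L^2(\mathbb{R})$ by $\widehat f(y)=\int_{\mathbb{R}}f(x)e^{-2\pi ixy}\,dx$. For $\varphi\in L^2(\mathbb{R})$, $\Phi_\varphi(t)=\sum_{k\in\mathbb{Z}}|\widehat\varphi(t+k)|^2$, a $1$-periodic nonnegative function in $L^1(\mathbb{T})$. $S(\varphi)$ is the closed linear span in $L^2(\mathbb{R})$ of $\{\varphi(\cdot+k):k\in\mathbb{Z}\}$. Singularities: a nonnegative measurable function $w$ on $\mathbb{R}$ has a singularity of order $k\in\mathbb{N}$ at $x_0\in\mathbb{R}$ if there is a (bounded open) interval $I$ centered at $x_0$ such that $\frac{(x-x_0)^{2(k-1)}}{w(x)}\notin L^1(I)$ but $\frac{(x-x_0)^{2k}}{w(x)}\in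 L^1(I)$. For the periodic function $\Phi_\varphi$, points of $\mathbb{T}$ are identified with their representatives in $\mathbb{R}$. ''Singularities only at the points of $X$'' means that $1/\Phi_\varphi$ is integrable in a neighbourhood of every point of $\mathbb{T}\setminus X$. A system $\{y_k\}$ in a Banach space $B$ is an $M$-basis if it is complete (its linear span is dense in $B$) and minimal (no $y_k$ lies in the closed linear span of the others), and its dual (biorthogonal) system $\{y_k^*\}\subset B^*$, $y_k^*(y_j)=\delta_{jk}$, is total with respect to $B$, i.e. $y_k^*(x)=0$ for all $k$ implies $x=0$. *)

(* Defs.v *)
From HB Require Import structures.
From mathcomp Require Import all_boot all_order all_algebra.
From mathcomp Require Import complex.
From mathcomp Require Import all_classical all_reals all_analysis.

Set Implicit Arguments.
Unset Strict Implicit.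
Unset Printing Implicit Defensive.

Import Order.TTheory GRing.Theory Num.Theory.
Import numFieldNormedType.Exports.
Import ComplexField.Normc.

Local Open Scope classical_set_scope.
Local Open Scope ring_scope.

(* Elements of L^2(R) are represented by complex-valued functions on the line;
   two functions represent the same element when they agree almost everywhere,
   i.e. when the L^2-norm of their difference vanishes.  The predicates below
   do not distinguish between such representatives. *)
Section complex_L2.
Context {R : realType}.
Local Notation mu := (@lebesgue_measure R).
Implicit Types f g : R -> R[i].

Definition cmeasurable f : Prop :=
  measurable_fun [set: R] (fun x => complex.Re (f x)) /\
  measurable_fun [set: R] (fun x => complex.Im (f x)).

Definition cLnorm (p : \bar R) f : \bar R :=
  Lnorm mu p (fun x => (normc (f x))%:E).

Definition cLp (p : \bar R) : set (R -> R[i]) :=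
  [set f | cmeasurable f /\ (cLnorm p f < +oo)%E].

Definition cintegral f : R[i] :=
  Complex (\int[mu]_x complex.Re (f x)) (\int[mu]_x complex.Im (f x)).

Definition expi (t : R) : R[i] := Complex (cos t) (sin t).

Definition fourier_integral f : R -> R[i] :=
  fun y => cintegral (fun x => f x * expi (- (2 * pi * x * y))).

(* [g] represents the Fourier transform of [f] in L^2(R): the continuous
   extension to L^2 of the integral formula on the dense subspace of functions
   both in L^1 and in L^2. *)
Definition is_fourier_transform f g : Prop :=
  [/\ cLp 2%:E f, cLp 2%:E g &
    exists u : nat -> R -> R[i],
      [/\ forall n, cLp 1%:E (u n) /\ cLp 2%:E (u n),
          cLnorm 2%:E (u n \- f) @[n --> \oo] --> 0%E &
          cLnorm 2%:E (fourier_integral (u n) \- g) @[n --> \oo] --> 0%E]].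

Definition translate f (k : int) : R -> R[i] := fun x => f (x + k%:~R).

(* [periodization phihat] is the function Phi_phi when phihat represents the
   Fourier transform of phi; it may take the value +oo. *)
Definition periodization (phihat : R -> R[i]) (t : R) : \bar R :=
  (\esum_(k in [set: int]) (normc (phihat (t + k%:~R)) ^+ 2)%:E)%E.

Definition span_of (I : eqType) (J : set I) (y : I -> R -> R[i]) :
    set (R -> R[i]) :=
  [set f | exists (s : seq I) (c : I -> R[i]),
    (forall k, k \in s -> J k) /\ f = (fun x => \sum_(k <- s) c k * y k x)].

Definition closed_span (I : eqType) (J : set I) (y : I -> R -> R[i]) :
    set (R -> R[i]) :=
  [set f | cLp 2%:E f /\
    forall e : R, 0 < e ->
      exists2 g, span_of J y g & (cLnorm 2%:E (f \- g)%R < e%:E)%E].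

Definition shift_space (phi : R -> R[i]) : set (R -> R[i]) :=
  closed_span [set: int] (translate phi).

(* The bound forces [l] to take the same value on two representatives of the
   same element of L^2. *)
Definition bounded_functional (B : set (R -> R[i])) (l : (R -> R[i]) -> R[i]) :
    Prop :=
  (forall (a : R[i]) f g, B f -> B g ->
     l (fun x => a * f x + g x) = a * l f + l g) /\
  (exists M : R, forall f, B f -> ((normc (l f))%:E <= M%:E * cLnorm 2%:E f)%E).

(* Here [B] is a closed linear subspace of L^2(R), seen as a Banach space, and
   the system is the restriction to [J] of the family [y]. *)
Definition complete_in (I : eqType) (J : set I) (y : I -> R -> R[i])
    (B : set (R -> R[i])) : Prop :=
  (forall k, J k -> B (y k)) /\ B `<=` closed_span J y.

Definition minimal_system (I : eqType) (J : set I) (y : I -> R -> R[i]) : Prop :=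
  forall k, J k -> ~ closed_span (J `\ k) y (y k).

Definition dual_system (I : eqType) (J : set I) (y : I -> R -> R[i])
    (B : set (R -> R[i])) (ystar : I -> (R -> R[i]) -> R[i]) : Prop :=
  (forall k, J k -> bounded_functional B (ystar k)) /\
  (forall j k, J j -> J k -> ystar k (y j) = (j == k)%:R).

Definition total_system (I : eqType) (J : set I) (B : set (R -> R[i]))
    (ystar : I -> (R -> R[i]) -> R[i]) : Prop :=
  forall f, B f -> (forall k, J k -> ystar k f = 0) ->
    {ae mu, forall x, f x = 0}.

(* The dual system of a complete minimal system exists and is unique. *)
Definition M_basis (I : eqType) (J : set I) (y : I -> R -> R[i])
    (B : set (R -> R[i])) : Prop :=
  [/\ complete_in J y B, minimal_system J y &
      exists2 ystar, dual_system J y B ystar & total_system J B ystar].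

(* In [\bar R], the inverse of 0 is +oo and the inverse of +oo is 0, so that
   the zeros of [w] do contribute to non-integrability. *)
Definition weighted_inverse (w : R -> \bar R) (m : nat) (x0 : R) : R -> \bar R :=
  fun x => (((x - x0) ^+ (2 * m))%:E * (w x)^-1)%E.

Definition has_singularity (w : R -> \bar R) (k : nat) (x0 : R) : Prop :=
  (0 < k)%N /\
  exists2 r : R, 0 < r &
    ~ mu.-integrable `]x0 - r, x0 + r[ (weighted_inverse w k.-1 x0) /\
    mu.-integrable `]x0 - r, x0 + r[ (weighted_inverse w k x0).

Definition inverse_integrable_near (w : R -> \bar R) (x0 : R) : Prop :=
  exists2 r : R, 0 < r &
    mu.-integrable `]x0 - r, x0 + r[ (fun x => (w x)^-1%E).

Definition eq_mod1 (x y : R) : Prop := exists m : int, x - y = m%:~R.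

Definition singularities_exactly (w : R -> \bar R) (s : nat) (x : 'I_s -> R)
    (lambda : 'I_s -> nat) : Prop :=
  [/\ forall i j, eq_mod1 (x i) (x j) -> i = j,
      forall j, has_singularity w (lambda j) (x j) &
      forall t, (forall j, ~ eq_mod1 t (x j)) -> inverse_integrable_near w t].

End complex_L2.

Definition consecutive_integers (Omega : set int) (m : nat) : Prop :=
  exists n : int, Omega = [set k : int | n <= k < n + m%:Z].

(* Main.v *)
Require Import Defs.
From mathcomp Require Import all_boot all_order all_algebra.
From mathcomp Require Import complex.
From mathcomp Require Import all_classical all_reals all_analysis.
From mathcomp Require Import measurable_realfun.
From mathcomp Require Import ring lra.

(* By Plancherel, [sum_k c_k phi(. + k)] has a norm equivalent to that of
   [(sum_k c_k e_k) sqrt Phi] in L^2(0, 1), with [e_k t = exp (2 i pi k t)].  Let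
   [W = prod_j (X - e_1(x_j))^lambda_j]: it has degree |Lambda|, |W|^2 / Phi is
   integrable, and a polynomial [q] with |q|^2 / Phi integrable is divisible by [W].
   - Complete: a function orthogonal to the system is [P / sqrt Phi] with [P] a
     trigonometric polynomial with spectrum in Omega, so W | P and P = 0 by degree.
   - Minimal: for [k] outside Omega, subtracting from [e_k] a combination of the
     exponentials of Omega yields a multiple [D] of [W]; then [D / sqrt Phi] is
     orthogonal to the other elements of the system.
   - Total: if the dual functionals vanish on [f], the coefficients of finite sums
     approximating [f] tend to 0, so the limit [F] on the Fourier side is
     orthogonal to all [e_m W / sqrt Phi]; then F conj(W) / sqrt Phi has vanishing
     Fourier coefficients, whence F = 0. *)

Set Implicit Arguments.
Unset Strict Implicit.
Unset Printing Implicit Defensive.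

Import Order.TTheory GRing.Theory Num.Theory.
Import numFieldNormedType.Exports.
Import ComplexField.Normc.

Local Open Scope classical_set_scope.
Local Open Scope ring_scope.

(** * Complex arithmetic and the unit circle *)

Section complex_numbers.
Context {R : realType}.
Implicit Types z w : R[i].

(** The two halves of the definition of the order have opposite uses. Non-integrability with
    exponent [2 (lambda_j - 1)] forces the zeros of [q], hence completeness; integrability with
    exponent [2 lambda_j] puts [W / sqrt Phi] in L^2, hence minimality and totality. The window has
    exactly [deg W] elements: too few to carry a nonzero multiple of [W], enough to carry a
    representative of every class modulo [W]. The model and the shift space are compared only on
    finite sums, through squared norms, and limits are taken separately on each side. For this an
    equivalence of norms suffices: the exact Plancherel identity is established for functions
    supported in a bounded interval, and the general case is deduced up to constant factors. Two
    tools carry the orthogonality arguments: a nearest-point argument in L^2, and the vanishing of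
    an integrable function on an interval whose Fourier coefficients are all zero. The latter is
    needed in L^1, because it is applied to products of two L^2 functions. *)

Lemma ReD z w : complex.Re (z + w) = complex.Re z + complex.Re w.
Proof. by case: z w => [a b] [c d]. Qed.

Lemma ImD z w : complex.Im (z + w) = complex.Im z + complex.Im w.
Proof. by case: z w => [a b] [c d]. Qed.

Lemma ReN z : complex.Re (- z) = - complex.Re z.
Proof. by case: z. Qed.

Lemma ImN z : complex.Im (- z) = - complex.Im z.
Proof. by case: z. Qed.

Lemma ReM z w : complex.Re (z * w) =
  complex.Re z * complex.Re w - complex.Im z * complex.Im w.
Proof. by case: z w => [a b] [c d]. Qed.

Lemma ImM z w : complex.Im (z * w) =
  complex.Re z * complex.Im w + complex.Im z * complex.Re w.
Proof. by case: z w => [a b] [c d]. Qed.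

Lemma complex_ext z w :
  complex.Re z = complex.Re w -> complex.Im z = complex.Im w -> z = w.
Proof. by case: z w => [a b] [c d] /= -> ->. Qed.

Lemma sqr_normcE z : normc z ^+ 2 = complex.Re z ^+ 2 + complex.Im z ^+ 2.
Proof. by case: z => a b /=; rewrite sqr_sqrtr// addr_ge0// sqr_ge0. Qed.

Lemma normc_ge0' z : 0 <= normc z.
Proof. by case: z => a b /=; exact: sqrtr_ge0. Qed.

Lemma Re_conjc z : complex.Re (conjc z) = complex.Re z.
Proof. by case: z. Qed.

Lemma Im_conjc z : complex.Im (conjc z) = - complex.Im z.
Proof. by case: z. Qed.

Lemma conjcM z w : conjc (z * w) = conjc z * conjc w.
Proof. exact: rmorphM. Qed.

Lemma real_complexM (a b : R) : ((a * b)%:C)%C = ((a%:C)%C * (b%:C)%C : R[i]).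
Proof. exact: (rmorphM (real_complex R)). Qed.

Lemma conjcX z n : conjc (z ^+ n) = conjc z ^+ n.
Proof. exact: rmorphXn. Qed.

Lemma normc_conjc z : normc (conjc z) = normc z.
Proof. by case: z => a b /=; rewrite sqrrN. Qed.

Lemma normc_real (a : R) : normc (a%:C)%C = `|a|.
Proof. by rewrite /= expr0n/= addr0 sqrtr_sqr. Qed.

Lemma mulcJ z : z * conjc z = ((normc z ^+ 2)%:C)%C.
Proof.
by apply: complex_ext; rewrite (ReM, ImM) ?sqr_normcE; case: z => a b /=; ring.
Qed.

Lemma expiD (s t : R) : expi (s + t) = expi s * expi t.
Proof.
apply: complex_ext; rewrite (ReM, ImM)/= ?cosD ?sinD //.
by rewrite addrC.
Qed.

Lemma expi0 : expi (0 : R) = 1.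
Proof. by rewrite /expi cos0 sin0. Qed.

Lemma conj_expi (t : R) : conjc (expi t) = expi (- t).
Proof. by rewrite /expi/= cosN sinN. Qed.

Lemma normc_expi (t : R) : normc (expi t) = 1.
Proof. by rewrite /= cos2Dsin2 sqrtr1. Qed.

Lemma expiX (t : R) n : expi (t * n%:R) = expi t ^+ n.
Proof.
elim: n => [|n IHn]; first by rewrite mulr0 expi0 expr0.
by rewrite -natr1 mulrDr mulr1 expiD IHn exprSr.
Qed.

End complex_numbers.

(** * Measurability of complex-valued functions *)

Section complex_measurable.
Context {R : realType}.
Implicit Types f g : R -> R[i].

Lemma cmeasurable_cst (z : R[i]) : cmeasurable (fun _ : R => z).
Proof. by split; exact: measurable_cst. Qed.

Lemma cmeasurableD f g : cmeasurable f -> cmeasurable g ->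
  cmeasurable (fun x => f x + g x).
Proof.
move=> [rf jf] [rg ig]; split.
  by under eq_fun do rewrite ReD; exact: measurable_funD.
by under eq_fun do rewrite ImD; exact: measurable_funD.
Qed.

Lemma cmeasurableN f : cmeasurable f -> cmeasurable (fun x => - f x).
Proof.
move=> [rf jf]; split.
  by under eq_fun do rewrite ReN; exact: measurable_funN.
by under eq_fun do rewrite ImN; exact: measurable_funN.
Qed.

Lemma cmeasurableB f g : cmeasurable f -> cmeasurable g ->
  cmeasurable (fun x => f x - g x).
Proof. by move=> mf mg; apply: cmeasurableD => //; exact: cmeasurableN. Qed.

Lemma cmeasurableM f g : cmeasurable f -> cmeasurable g ->
  cmeasurable (fun x => f x * g x).
Proof.
move=> [rf jf] [rg ig]; split.
  by under eq_fun do rewrite ReM; apply: measurable_funB; exact: measurable_funM.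
by under eq_fun do rewrite ImM; apply: measurable_funD; exact: measurable_funM.
Qed.

Lemma cmeasurable_conj f : cmeasurable f -> cmeasurable (fun x => conjc (f x)).
Proof.
move=> [rf jf]; split.
  by under eq_fun do rewrite Re_conjc.
under eq_fun do rewrite Im_conjc.
exact: measurable_funN.
Qed.

Lemma cmeasurable_real (r : R -> R) : measurable_fun setT r ->
  cmeasurable (fun x => ((r x)%:C)%C).
Proof. by move=> mr; split => //=; exact: measurable_cst. Qed.

Lemma cmeasurable_sum (I : Type) (s : seq I) (F : I -> R -> R[i]) :
  (forall i, cmeasurable (F i)) -> cmeasurable (fun x => \sum_(i <- s) F i x).
Proof.
move=> mF; elim: s => [|i s IHs].
  by under eq_fun do rewrite big_nil; exact: cmeasurable_cst.
by under eq_fun do rewrite big_cons; exact: cmeasurableD.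
Qed.

Lemma cmeasurable_expi (r : R -> R) : measurable_fun setT r ->
  cmeasurable (fun x => expi (r x)).
Proof.
by move=> mr; split => /=; apply: measurableT_comp => //;
  apply: continuous_measurable_fun; [exact: continuous_cos|exact: continuous_sin].
Qed.

Lemma cmeasurable_shift f (c : R) : cmeasurable f ->
  cmeasurable (fun x => f (x + c)).
Proof.
have mc : measurable_fun [set: R] (fun x : R => x + c).
  by apply: measurable_funD => //; exact: measurable_cst.
move=> [rf jf]; split.
  exact: (measurableT_comp rf).
exact: (measurableT_comp jf).
Qed.

Lemma measurable_sqr_normc f : cmeasurable f ->
  measurable_fun setT (fun x => normc (f x) ^+ 2).
Proof.
move=> [rf jf]; under eq_fun do rewrite sqr_normcE.
by apply: measurable_funD; exact: measurable_funX.
Qed.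

Lemma measurable_normc f : cmeasurable f ->
  measurable_fun setT (fun x => normc (f x)).
Proof.
move=> /measurable_sqr_normc mf.
have -> : (fun x => normc (f x)) = Num.sqrt \o (fun x => normc (f x) ^+ 2).
  by apply/funext => x /=; rewrite sqrtr_sqr ger0_norm// normc_ge0'.
apply: measurableT_comp => //; apply: continuous_measurable_fun.
exact: sqrt_continuous.
Qed.

End complex_measurable.

(** * Integrals of complex-valued functions *)

Section complex_integral.
Context {R : realType}.
Local Notation mu := (@lebesgue_measure R).
Implicit Types f g h : R -> R[i].

Lemma ae_imp (P Q : R -> Prop) : (forall x, P x -> Q x) ->
  {ae mu, forall x, P x} -> {ae mu, forall x, Q x}.
Proof.
move=> PQ [N [mN N0 PN]]; exists N; split => //.
by apply: subset_trans PN => x /= nQ Px; exact/nQ/PQ.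
Qed.

Lemma ae_imp2 (P Q S : R -> Prop) : (forall x, P x -> Q x -> S x) ->
  {ae mu, forall x, P x} -> {ae mu, forall x, Q x} -> {ae mu, forall x, S x}.
Proof.
move=> PQS nP nQ; apply: (negligibleS _ (negligibleU nP nQ)) => x /= nS.
by have [Px|] := pselect (P x); [right => Qx; exact/nS/PQS|left].
Qed.

Lemma integral_abs_ge0 (u : R -> R) : (forall x, 0 <= u x) ->
  (\int[mu]_x `|(EFin \o u) x| = \int[mu]_x (u x)%:E)%E.
Proof. by move=> u0; apply: eq_integral => x _; rewrite /= ger0_norm. Qed.

Lemma integrableZlR (k : R) (u : R -> R) : mu.-integrable setT (EFin \o u) ->
  mu.-integrable setT (EFin \o (fun x => k * u x)).
Proof. by move=> iu; exact: (integrableZl measurableT k iu). Qed.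

Lemma integrableDR (u v : R -> R) : mu.-integrable setT (EFin \o u) ->
  mu.-integrable setT (EFin \o v) ->
  mu.-integrable setT (EFin \o (fun x => u x + v x)).
Proof. by move=> iu iv; exact: (integrableD measurableT iu iv). Qed.

Definition cintegrable f : Prop :=
  mu.-integrable setT (EFin \o (fun x => complex.Re (f x))) /\
  mu.-integrable setT (EFin \o (fun x => complex.Im (f x))).

Lemma cintegrable_measurable f : cintegrable f -> cmeasurable f.
Proof.
by move=> [rf jf]; split; apply/measurable_EFinP; exact: (measurable_int mu).
Qed.

Lemma ler_Re_normc (z : R[i]) : `|complex.Re z| <= normc z.
Proof.
rewrite -(@ler_pXn2r _ 2)// ?nnegrE ?normc_ge0'// sqr_normcE real_normK ?num_real//.
by rewrite lerDl sqr_ge0.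
Qed.

Lemma ler_Im_normc (z : R[i]) : `|complex.Im z| <= normc z.
Proof.
rewrite -(@ler_pXn2r _ 2)// ?nnegrE ?normc_ge0'// sqr_normcE real_normK ?num_real//.
by rewrite lerDr sqr_ge0.
Qed.

Lemma normc_le_ReIm (z : R[i]) : normc z <= `|complex.Re z| + `|complex.Im z|.
Proof.
rewrite -(@ler_pXn2r _ 2)// ?nnegrE ?normc_ge0' ?addr_ge0// sqr_normcE sqrrD.
rewrite !real_normK ?num_real// -addrA (addrC (_ *+ 2)) addrA lerDl.
by rewrite mulrn_wge0// mulr_ge0.
Qed.

Lemma le_cintegrable f (g : R -> R) : cmeasurable f ->
  mu.-integrable setT (EFin \o g) -> (forall x, normc (f x) <= g x) ->
  cintegrable f.
Proof.
move=> [mr mi] ig fg.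
have g0 x : `|g x| = g x by rewrite ger0_norm// (le_trans (normc_ge0' _) (fg x)).
split; apply: le_integrable ig => //; try exact/measurable_EFinP;
  move=> x _; rewrite /= lee_fin g0 (le_trans _ (fg x))//.
- exact: ler_Re_normc.
- exact: ler_Im_normc.
Qed.

Lemma cintegrable_normc f : cintegrable f ->
  mu.-integrable setT (EFin \o (fun x => normc (f x))).
Proof.
move=> cf; have [rf jf] := cf.
apply: (@le_integrable _ _ _ mu setT measurableT _
  (EFin \o (fun x => `|complex.Re (f x)| + `|complex.Im (f x)|))).
- by apply/measurable_EFinP; apply: measurable_normc; exact: cintegrable_measurable.
- move=> x _; rewrite /= lee_fin (ger0_norm (normc_ge0' _)).
  rewrite ger0_norm ?addr_ge0//; exact: normc_le_ReIm.
- by apply: integrableDR; [exact: (integrable_norm rf)|exact: (integrable_norm jf)].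
Qed.

Lemma cintegrableP f : cintegrable f <->
  cmeasurable f /\ (\int[mu]_x (normc (f x))%:E < +oo)%E.
Proof.
split=> [cf|[mf ff]].
  split; first exact: cintegrable_measurable.
  have /integrableP[_] := cintegrable_normc cf.
  by rewrite integral_abs_ge0// => x; exact: normc_ge0'.
apply: (le_cintegrable (g := fun x => normc (f x))) => //.
apply/integrableP; split; first by apply/measurable_EFinP; exact: measurable_normc.
by rewrite integral_abs_ge0// => x; exact: normc_ge0'.
Qed.

Lemma cintegrableD f g : cintegrable f -> cintegrable g ->
  cintegrable (fun x => f x + g x).
Proof.
move=> [rf jf] [rg ig]; split.
  by under eq_fun do rewrite ReD; exact: integrableDR.
by under eq_fun do rewrite ImD; exact: integrableDR.
Qed.

Lemma cintegrableM_bounded f g (C : R) : cintegrable f -> cmeasurable g ->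
  (forall x, normc (g x) <= C) -> cintegrable (fun x => f x * g x).
Proof.
move=> cf mg gC.
apply: (le_cintegrable (g := fun x => C * normc (f x))).
- by apply: cmeasurableM => //; exact: cintegrable_measurable.
- by apply: integrableZlR; exact: cintegrable_normc.
- by move=> x; rewrite normcM mulrC ler_wpM2r// normc_ge0'.
Qed.

Lemma cintegrableZ (z : R[i]) f : cintegrable f -> cintegrable (fun x => z * f x).
Proof.
move=> cf; under eq_fun do rewrite mulrC.
by apply: (cintegrableM_bounded (C := normc z)) => //; exact: cmeasurable_cst.
Qed.

Lemma cintegrable0 : cintegrable (fun _ => 0).
Proof. by split; exact: integrable0. Qed.

Lemma cintegrable_sum (I : Type) (s : seq I) (F : I -> R -> R[i]) :
  (forall i, cintegrable (F i)) -> cintegrable (fun x => \sum_(i <- s) F i x).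
Proof.
move=> mF; elim: s => [|i s IHs].
  by under eq_fun do rewrite big_nil; exact: cintegrable0.
by under eq_fun do rewrite big_cons; exact: cintegrableD.
Qed.

Lemma cintegralD f g : cintegrable f -> cintegrable g ->
  cintegral (fun x => f x + g x) = cintegral f + cintegral g.
Proof.
move=> [rf jf] [rg ig]; apply: complex_ext; rewrite ?ReD ?ImD /=.
  by under eq_Rintegral do rewrite ReD; rewrite RintegralD.
by under eq_Rintegral do rewrite ImD; rewrite RintegralD.
Qed.

Lemma cintegralZ (z : R[i]) f : cintegrable f ->
  cintegral (fun x => z * f x) = z * cintegral f.
Proof.
move=> [rf jf]; apply: complex_ext; rewrite ?ReM ?ImM /=.
  under eq_Rintegral do rewrite ReM.
  by rewrite RintegralB ?RintegralZl//; exact: integrableZlR.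
under eq_Rintegral do rewrite ImM.
by rewrite RintegralD ?RintegralZl//; exact: integrableZlR.
Qed.

Lemma cintegral0 : cintegral (fun _ : R => 0) = 0 :> R[i].
Proof. by rewrite /cintegral /Rintegral integral0. Qed.

Lemma cintegral_sum (I : Type) (s : seq I) (F : I -> R -> R[i]) :
  (forall i, cintegrable (F i)) ->
  cintegral (fun x => \sum_(i <- s) F i x) = \sum_(i <- s) cintegral (F i).
Proof.
move=> mF; elim: s => [|i s IHs].
  by under eq_fun do rewrite big_nil; rewrite big_nil cintegral0.
under eq_fun do rewrite big_cons; rewrite cintegralD// ?IHs ?big_cons//.
exact: cintegrable_sum.
Qed.

Lemma cintegral_conj f : cintegrable f ->
  cintegral (fun x => conjc (f x)) = conjc (cintegral f).
Proof.
move=> [rf jf]; apply: complex_ext; rewrite ?Re_conjc ?Im_conjc /=.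
  by under eq_Rintegral do rewrite Re_conjc.
under eq_Rintegral do rewrite Im_conjc -mulN1r.
by rewrite RintegralZl// mulN1r.
Qed.

Lemma ae_eq_cintegral f g : cmeasurable f -> cmeasurable g ->
  {ae mu, forall x, f x = g x} -> cintegral f = cintegral g.
Proof.
move=> [rf jf] [rg ig] fg; apply: complex_ext; rewrite /= /Rintegral; congr fine;
  apply: ae_eq_integral => //; try exact/measurable_EFinP;
  by apply: ae_imp fg => x fgx _; rewrite fgx.
Qed.

End complex_integral.

(** * Squared norms and the inner product of L^2(R) *)

Section L2.
Context {R : realType}.
Local Notation mu := (@lebesgue_measure R).
Implicit Types f g h : R -> R[i].

Definition sqn f : \bar R := (\int[mu]_x (normc (f x) ^+ 2)%:E)%E.

Definition L2 f : Prop := cmeasurable f /\ (sqn f < +oo)%E.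

(** [fine] sends [+oo] to 0, so this is the squared norm only under [L2 f]. Squares are kept
    throughout to avoid square roots. *)
Definition n2 f : R := fine (sqn f).

Definition dot f g : R[i] := cintegral (fun x => f x * conjc (g x)).

Lemma sqn_ge0 f : (0 <= sqn f)%E.
Proof. by apply: integral_ge0 => x _; rewrite lee_fin sqr_ge0. Qed.

Lemma n2_ge0 f : 0 <= n2 f.
Proof. exact/fine_ge0/sqn_ge0. Qed.

Lemma n2K f : L2 f -> (n2 f)%:E = sqn f.
Proof. by move=> [_ sf]; rewrite fineK// ge0_fin_numE// sqn_ge0. Qed.

Lemma L2_integrable f : L2 f ->
  mu.-integrable setT (EFin \o (fun x => normc (f x) ^+ 2)).
Proof.
move=> [mf sf]; apply/integrableP; split.
  by apply/measurable_EFinP; exact: measurable_sqr_normc.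
by rewrite integral_abs_ge0// => x; exact: sqr_ge0.
Qed.

Lemma L2_dom f (g : R -> R) : cmeasurable f ->
  mu.-integrable setT (EFin \o g) -> (forall x, normc (f x) ^+ 2 <= g x) -> L2 f.
Proof.
move=> mf /integrableP[mg ig] fg; split => //.
apply: le_lt_trans ig; apply: ge0_le_integral => //.
- by move=> x _; rewrite lee_fin sqr_ge0.
- by apply/measurable_EFinP; exact: measurable_sqr_normc.
- by apply: measurableT_comp.
- by move=> x _; rewrite lee_fin (le_trans (fg x))// ler_norm.
Qed.

Lemma le_sqn f g (C : R) : 0 <= C -> cmeasurable f -> cmeasurable g ->
  (forall x, normc (f x) ^+ 2 <= C * normc (g x) ^+ 2) ->
  (sqn f <= C%:E * sqn g)%E.
Proof.
move=> C0 mf mg fg; rewrite /sqn -ge0_integralZl//; first last.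
- by move=> x _; rewrite lee_fin sqr_ge0.
- by apply/measurable_EFinP; exact: measurable_sqr_normc.
apply: ge0_le_integral => //.
- by move=> x _; rewrite lee_fin sqr_ge0.
- by apply/measurable_EFinP; exact: measurable_sqr_normc.
- by apply/measurable_EFinP/measurable_funM => //; exact: measurable_sqr_normc.
- by move=> x _; rewrite -EFinM lee_fin.
Qed.

Lemma L2M_bounded f g (C : R) : L2 f -> cmeasurable g ->
  (forall x, normc (g x) <= C) -> L2 (fun x => f x * g x).
Proof.
move=> lf mg gC.
apply: (L2_dom (g := fun x => C ^+ 2 * normc (f x) ^+ 2)).
- by apply: cmeasurableM => //; case: lf.
- exact/integrableZlR/L2_integrable.
- move=> x; rewrite normcM exprMn mulrC ler_wpM2r ?sqr_ge0//.
  by rewrite ler_pXn2r// ?nnegrE ?normc_ge0'// (le_trans (normc_ge0' (g x))).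
Qed.

Lemma L2Z (z : R[i]) f : L2 f -> L2 (fun x => z * f x).
Proof.
move=> cf; under eq_fun do rewrite mulrC.
by apply: (L2M_bounded (C := normc z)) => //; exact: cmeasurable_cst.
Qed.

(** The difference of the two sides is [normc (z - w) ^+ 2]. This stands in for the triangle
    inequality and keeps estimates in squared norms, at the cost of factors 2. *)
Lemma sqr_normcD_le (z w : R[i]) :
  normc (z + w) ^+ 2 <= 2 * normc z ^+ 2 + 2 * normc w ^+ 2.
Proof.
rewrite !sqr_normcE ReD ImD.
set a := complex.Re z; set b := complex.Re w.
set c := complex.Im z; set d := complex.Im w.
rewrite -subr_ge0 [leRHS](_ : _ = (a - b) ^+ 2 + (c - d) ^+ 2); last by ring.
by rewrite addr_ge0 ?sqr_ge0.
Qed.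

Lemma L2D f g : L2 f -> L2 g -> L2 (fun x => f x + g x).
Proof.
move=> lf lg.
apply: (L2_dom (g := fun x => 2 * normc (f x) ^+ 2 + 2 * normc (g x) ^+ 2)).
- by apply: cmeasurableD; [case: lf|case: lg].
- by apply: integrableDR; apply: integrableZlR; exact: L2_integrable.
- by move=> x; exact: sqr_normcD_le.
Qed.

Lemma L2N f : L2 f -> L2 (fun x => - f x).
Proof. by move=> lf; under eq_fun do rewrite -mulN1r; exact: L2Z. Qed.

Lemma L2B f g : L2 f -> L2 g -> L2 (fun x => f x - g x).
Proof. by move=> lf lg; apply: L2D => //; exact: L2N. Qed.

Lemma L20 : L2 (fun _ : R => 0).
Proof.
split; first exact: cmeasurable_cst.
rewrite /sqn; under eq_integral do rewrite normc0 expr0n/=.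
by rewrite integral0.
Qed.

Lemma L2_sum (I : Type) (s : seq I) (F : I -> R -> R[i]) :
  (forall i, L2 (F i)) -> L2 (fun x => \sum_(i <- s) F i x).
Proof.
move=> mF; elim: s => [|i s IHs].
  by under eq_fun do rewrite big_nil; exact: L20.
by under eq_fun do rewrite big_cons; exact: L2D.
Qed.

Lemma L2_mul_conj f g : L2 f -> L2 g -> cintegrable (fun x => f x * conjc (g x)).
Proof.
move=> lf lg.
apply: (le_cintegrable (g := fun x => normc (f x) ^+ 2 + normc (g x) ^+ 2)).
- by apply: cmeasurableM; [case: lf|apply: cmeasurable_conj; case: lg].
- by apply: integrableDR; exact: L2_integrable.
- move=> x; rewrite normcM normc_conjc.
  set a := normc (f x); set b := normc (g x).
  have := sqr_ge0 (a - b); have := sqr_ge0 a; have := sqr_ge0 b.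
  rewrite !expr2; nra.
Qed.

Lemma dotZl (z : R[i]) f g : L2 f -> L2 g ->
  dot (fun x => z * f x) g = z * dot f g.
Proof.
move=> lf lg; rewrite /dot -cintegralZ; last exact: L2_mul_conj.
by congr cintegral; apply/funext => x; rewrite mulrA.
Qed.

Lemma dotDl f g h : L2 f -> L2 g -> L2 h ->
  dot (fun x => f x + g x) h = dot f h + dot g h.
Proof.
move=> lf lg lh; rewrite /dot -cintegralD; try exact: L2_mul_conj.
by congr cintegral; apply/funext => x; rewrite mulrDl.
Qed.

Lemma dotC f g : L2 f -> L2 g -> dot g f = conjc (dot f g).
Proof.
move=> lf lg; rewrite /dot -cintegral_conj; last exact: L2_mul_conj.
by congr cintegral; apply/funext => x; rewrite rmorphM/= conjcK mulrC.
Qed.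

Lemma dotNl f h : L2 f -> L2 h -> dot (fun x => - f x) h = - dot f h.
Proof.
by move=> lf lh; under eq_fun do rewrite -mulN1r; rewrite dotZl// mulN1r.
Qed.

Lemma dotBl f g h : L2 f -> L2 g -> L2 h ->
  dot (fun x => f x - g x) h = dot f h - dot g h.
Proof. by move=> lf lg lh; rewrite dotDl ?dotNl//; exact: L2N. Qed.

Lemma dot_suml (I : Type) (s : seq I) (F : I -> R -> R[i]) h :
  (forall i, L2 (F i)) -> L2 h ->
  dot (fun x => \sum_(i <- s) F i x) h = \sum_(i <- s) dot (F i) h.
Proof.
move=> mF lh; rewrite /dot -cintegral_sum; last by move=> i; exact: L2_mul_conj.
by congr cintegral; apply/funext => x; rewrite mulr_suml.
Qed.

Lemma dot_id f : L2 f -> dot f f = ((n2 f)%:C)%C.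
Proof.
move=> lf; rewrite /dot /cintegral; apply: complex_ext; rewrite /=.
  rewrite /n2 /sqn /Rintegral; congr fine; apply: eq_integral => x _.
  by rewrite mulcJ.
by under eq_Rintegral do rewrite mulcJ /=; rewrite Rintegral_cst// mul0r.
Qed.

Lemma n2D f g : L2 f -> L2 g ->
  n2 (fun x => f x + g x) = n2 f + n2 g + 2 * complex.Re (dot f g).
Proof.
move=> lf lg; have lfg := L2D lf lg.
have := dot_id lfg; rewrite dotDl// (dotC lfg lf) (dotC lfg lg) !dotDl//.
rewrite (dotC lf lg) !dot_id// => /(congr1 (@complex.Re R)) /= <-.
by case: (dot f g) => a b /=; ring.
Qed.

Lemma n2Z (z : R[i]) f : L2 f -> n2 (fun x => z * f x) = normc z ^+ 2 * n2 f.
Proof.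
move=> lf; have lz := L2Z z lf.
have := dot_id lz; rewrite dotZl// (dotC lz lf) dotZl// dot_id//.
move=> /(congr1 (@complex.Re R)) /= <-; rewrite sqr_normcE.
by case: z {lz} => a b /=; ring.
Qed.

Lemma n2B f g : L2 f -> L2 g ->
  n2 (fun x => f x - g x) = n2 f + n2 g - 2 * complex.Re (dot f g).
Proof.
move=> lf lg; rewrite n2D//; last exact: L2N.
have -> : n2 (fun x => - g x) = n2 g.
  under eq_fun do rewrite -mulN1r; rewrite n2Z// normcN normc1 expr1n mul1r//.
rewrite (dotC (L2N lg) lf) dotNl// (dotC lf lg).
by case: (dot f g) => a b /=; ring.
Qed.

Lemma n2BC f g : n2 (fun x => f x - g x) = n2 (fun x => g x - f x).
Proof.
rewrite /n2 /sqn; congr fine; apply: eq_integral => x _.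
by rewrite -opprB normcN.
Qed.

Lemma n2D_le f g : L2 f -> L2 g -> n2 (fun x => f x + g x) <= 2 * n2 f + 2 * n2 g.
Proof.
move=> lf lg; rewrite n2D//; have := n2_ge0 (fun x => f x - g x).
rewrite n2B//; lra.
Qed.

(** Discriminant inequality. For [c > 0] the polynomial is evaluated at its vertex [- b / c]; for
    [c = 0] and [b != 0] it is affine, and the chosen [t] gives it the value -1. *)
Lemma quadratic_ge0 (a b c : R) :
  0 <= c -> (forall t, 0 <= a + 2 * t * b + t ^+ 2 * c) -> b ^+ 2 <= a * c.
Proof.
rewrite le_eqVlt => /orP[/eqP <-|c0] H.
  rewrite mulr0; have [->|b0] := eqVneq b 0; first by rewrite expr0n.
  have := H (- (a + 1) / (2 * b)).
  rewrite mulr0 addr0 (_ : 2 * _ * b = - (a + 1)); first lra.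
  by field.
have := H (- b / c).
rewrite -(pmulr_rge0 _ c0) (_ : c * _ = a * c - b ^+ 2); last first.
  by field; rewrite gt_eqF.
by rewrite subr_ge0.
Qed.

(** The discriminant argument bounds only the real part of the inner product. Applied to
    [conjc d * f], whose inner product with [g] is the real number [|d|^2], it bounds the modulus
    after division by [|d|^2]. *)
Lemma cauchy_schwarz f g : L2 f -> L2 g -> normc (dot f g) ^+ 2 <= n2 f * n2 g.
Proof.
move=> lf lg; set d := dot f g.
have key f' : L2 f' -> complex.Re (dot f' g) ^+ 2 <= n2 f' * n2 g.
  move=> lf'; apply: quadratic_ge0; first exact: n2_ge0.
  move=> t; have lt := L2Z (t%:C)%C lg.
  have := n2_ge0 (fun x => f' x + (t%:C)%C * g x).
  rewrite n2D// n2Z// normc_real real_normK ?num_real//.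
  rewrite (dotC lt lf') dotZl// (dotC lf' lg); case: (dot f' g) => a b /=; lra.
have := key _ (L2Z (conjc d) lf).
rewrite dotZl// n2Z// normc_conjc -/d mulrC mulcJ.
rewrite (_ : complex.Re _ = normc d ^+ 2)//.
have [->|d0] := eqVneq (normc d) 0.
  by move=> _; rewrite expr0n mulr_ge0// n2_ge0.
have dp : 0 < normc d ^+ 2 by rewrite exprn_gt0// lt_neqAle eq_sym d0 normc_ge0'.
move: (normc d ^+ 2) dp => D D0 H.
by rewrite -(ler_pM2l D0) mulrA -expr2.
Qed.

Lemma cLnorm2 f : cLnorm 2%:E f = (sqn f `^ 2^-1)%E.
Proof.
rewrite /cLnorm unlock/= /sqn; congr (_ `^ _)%E; apply: eq_integral => x _.
by rewrite ger0_norm ?normc_ge0'// powR_mulrn// normc_ge0'.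
Qed.

Lemma cLp2E f : cLp 2%:E f <-> L2 f.
Proof.
rewrite /cLp/= cLnorm2; split=> -[mf sf]; split => //.
  by apply: lty_poweRy sf => //; rewrite invr_eq0.
exact: poweR_lty.
Qed.

Lemma cLnorm2_sqrt f : L2 f -> cLnorm 2%:E f = (Num.sqrt (n2 f))%:E.
Proof.
by move=> lf; rewrite cLnorm2 -n2K// poweR_EFin powR12_sqrt// n2_ge0.
Qed.

Lemma cLnorm2_lt f (e : R) : 0 < e -> L2 f ->
  (cLnorm 2%:E f < e%:E)%E = (n2 f < e ^+ 2).
Proof.
move=> e0 lf; rewrite cLnorm2_sqrt// lte_fin -[in RHS](sqr_sqrtr (n2_ge0 f)).
by rewrite ltr_pXn2r// ?nnegrE ?sqrtr_ge0// ltW.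
Qed.

Lemma cLp1E f : cLp 1%:E f <-> cintegrable f.
Proof.
rewrite cintegrableP /cLp/= /cLnorm Lnorm1.
by rewrite integral_abs_ge0// => x; exact: normc_ge0'.
Qed.

Lemma n2_eq0 f : L2 f -> n2 f = 0 -> {ae mu, forall x, f x = 0}.
Proof.
move=> lf n0; have := n2K lf; rewrite n0 => /esym.
rewrite /sqn => sf.
have /(ae_eq_integral_abs mu measurableT) : measurable_fun [set: R]
  (EFin \o (fun x => normc (f x) ^+ 2)).
  by apply/measurable_EFinP; apply: measurable_sqr_normc; case: lf.
move=> [+ _]; rewrite integral_abs_ge0; last by move=> x; exact: sqr_ge0.
move=> /(_ sf); apply: ae_imp => x /(_ I)/= [] /eqP.
by rewrite sqrf_eq0 => /eqP; exact: eq0_normc.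
Qed.

Lemma ae_eq_n2 f g : cmeasurable f -> cmeasurable g ->
  {ae mu, forall x, f x = g x} -> n2 f = n2 g.
Proof.
move=> mf mg fg; rewrite /n2 /sqn; congr fine; apply: ae_eq_integral => //.
- by apply/measurable_EFinP; exact: measurable_sqr_normc.
- by apply/measurable_EFinP; exact: measurable_sqr_normc.
- by apply: ae_imp fg => x fgx _; rewrite fgx.
Qed.

End L2.

(** * Completeness of L^2(R) *)

Section riesz_fischer.
Context {R : realType}.
Local Notation mu := (@lebesgue_measure R).
Implicit Types (f g h : R -> R[i]) (u : nat -> R -> R[i]).

Lemma cvg_sqr_normc u h x :
  complex.Re (u n x) @[n --> \oo] --> complex.Re (h x) ->
  complex.Im (u n x) @[n --> \oo] --> complex.Im (h x) ->
  normc (u n x) ^+ 2 @[n --> \oo] --> normc (h x) ^+ 2.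
Proof.
move=> ur ui; rewrite sqr_normcE.
rewrite (_ : (fun n => _) = (fun n => complex.Re (u n x) ^+ 2 + complex.Im (u n x) ^+ 2)).
  by apply: cvgD; under eq_fun do rewrite expr2; rewrite expr2; exact: cvgM.
by apply/funext => n; rewrite sqr_normcE.
Qed.

Lemma sqn_fatou u h (e : \bar R) : (forall n, cmeasurable (u n)) ->
  (forall x, complex.Re (u n x) @[n --> \oo] --> complex.Re (h x)) ->
  (forall x, complex.Im (u n x) @[n --> \oo] --> complex.Im (h x)) ->
  (forall n, (sqn (u n) <= e)%E) -> (sqn h <= e)%E.
Proof.
move=> mu_ ur ui ue.
have mF n : measurable_fun [set: R] (fun x => (normc (u n x) ^+ 2)%:E).
  by apply/measurable_EFinP; exact: measurable_sqr_normc.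
have F0 n (x : R) : setT x -> (0 <= (normc (u n x) ^+ 2)%:E)%E.
  by move=> _; rewrite lee_fin sqr_ge0.
have := @fatou _ _ _ mu setT measurableT _ mF F0.
have -> : (fun x => limn_einf (fun n => (normc (u n x) ^+ 2)%:E)) =
    (fun x => (normc (h x) ^+ 2)%:E).
  apply/funext => x; apply: (cvg_limn_einf_sup _).1.
  by apply: cvg_EFin; [exact: nearW|exact: cvg_sqr_normc].
move=> /le_trans; apply; rewrite limn_einf_lim; apply: lime_le.
  exact: is_cvg_einfs.
apply: nearW => n; apply: le_trans (ue n).
by apply: ereal_inf_lbound; exists n => //=.
Qed.

Lemma cvg_geometric_increments (v : nat -> R) (C : R) :
  (forall n, `|v n.+1 - v n| <= C * 2^-1 ^+ n) -> cvgn v.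
Proof.
move=> vC.
have -> : v = (fun n => v 0%N + series (telescope v) n).
  by apply/funext => n; exact: eq_sum_telescope.
apply: is_cvgD; first exact: is_cvg_cst.
apply: normed_cvg; apply: (@series_le_cvg _ _ (geometric C 2^-1)).
- by move=> n; exact: normr_ge0.
- by move=> n /=; rewrite (le_trans _ (vC n)).
- by move=> n /=; exact: vC.
- by apply: is_cvg_geometric_series; rewrite ger0_norm ?invr_ge0// invf_lt1// ltr1n.
Qed.

(** A subsequence has squared increments below [8^-j]. Weighted by [4^j], they have a sum of
    integral at most 2, hence finite almost everywhere, so the increments decay pointwise like
    [2^-j] and the subsequence converges. Fatou's lemma then carries the Cauchy estimate to the
    limit. *)
Lemma riesz_fischer u : (forall n, L2 (u n)) ->
  (forall e : R, 0 < e -> exists N, forall n m, (N <= n)%N -> (N <= m)%N ->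
    n2 (fun x => u n x - u m x) < e) ->
  exists2 h, L2 h & forall e : R, 0 < e ->
    exists N, forall n, (N <= n)%N -> n2 (fun x => u n x - h x) < e.
Proof.
move=> lu cu.
have {}cu' j : {N | forall n m, (N <= n)%N -> (N <= m)%N ->
    n2 (fun x => u n x - u m x) < 8^-1 ^+ j}.
  by apply: cid; apply: cu; rewrite exprn_gt0// invr_gt0.
(* [M j] is at least the thresholds of all ranks up to [j], so [M j] and [M j.+1] are both past that
   of rank [j]. The summand [j] sends the subsequence to infinity. *)
pose M j := (j + \sum_(i < j.+1) sval (cu' i))%N.
have MN j i : (i <= j)%N -> (sval (cu' i) <= M j)%N.
  by move=> ij; rewrite /M (bigD1 (Ordinal (ij : (i < j.+1)%N)))//= addnCA leq_addr.
pose g j := u (M j).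
have lg j : L2 (g j) by exact: lu.
have dg j : n2 (fun x => g j.+1 x - g j x) < 8^-1 ^+ j.
  by apply: (svalP (cu' j)); exact: MN.
pose a j x := 4 ^+ j * normc (g j.+1 x - g j x) ^+ 2.
pose S x := (\sum_(j <oo) (a j x)%:E)%E.
have ma j : measurable_fun setT (fun x => (a j x)%:E).
  apply/measurable_EFinP; apply: measurable_funM => //.
  by apply: measurable_sqr_normc; case: (L2B (lg j.+1) (lg j)).
have a0 j (x : R) : setT x -> (0 <= (a j x)%:E)%E.
  by move=> _; rewrite lee_fin mulr_ge0 ?sqr_ge0// exprn_ge0.
have mS : measurable_fun setT S.
  by apply: ge0_emeasurable_sum => [j x _ _|j _]; [exact: a0|exact: ma].
have S0 x : (0 <= S x)%E by apply: nneseries_ge0 => n _ _; exact: a0.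
have intS : (\int[mu]_x S x <= 2%:E)%E.
  rewrite /S integral_nneseries//; apply: lime_le.
    by apply: is_cvg_nneseries => n _ _; apply: integral_ge0 => x _; exact: a0.
  apply: nearW => n.
  apply: (@le_trans _ _ (\sum_(0 <= i < n) (2^-1 ^+ i)%:E)%E).
    apply: lee_sum => i _; rewrite /a.
    under eq_integral do rewrite EFinM.
    rewrite ge0_integralZl//; first last.
    - by move=> x _; rewrite lee_fin sqr_ge0.
    - apply/measurable_EFinP; apply: measurable_sqr_normc.
      by case: (L2B (lg i.+1) (lg i)).
    have := dg i; rewrite -/(sqn _) -n2K; last exact: L2B.
    rewrite -EFinM lee_fin => /ltW dgi.
    rewrite (@le_trans _ _ (4 ^+ i * 8^-1 ^+ i))//.
      by rewrite ler_wpM2l// exprn_ge0.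
    by rewrite -exprMn (_ : 4 * 8^-1 = 2^-1 :> R)//; lra.
  rewrite sumEFin lee_fin.
  have -> : \sum_(0 <= i < n) 2^-1 ^+ i = 2 - 2 * 2^-1 ^+ n :> R.
    elim: n => [|n IHn]; first by rewrite big_nil expr0; lra.
    by rewrite big_nat_recr//= IHn exprS; lra.
  by rewrite gerBl mulr_ge0// exprn_ge0.
have iS : mu.-integrable setT S.
  apply/integrableP; split => //.
  under eq_integral do rewrite gee0_abs//.
  exact: le_lt_trans intS (ltry _).
pose E := [set x | (S x < +oo)%E].
have mE : measurable E.
  by rewrite -[E]setTI; exact: emeasurable_fun_infty_o.
have aeE : {ae mu, forall x, E x}.
  have := integrable_ae measurableT iS; apply: ae_imp => x /(_ I).
  by rewrite ge0_fin_numE.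
(* Replacing the values by 0 where [S] is infinite makes the sequence converge at every point, hence
   to a measurable limit. *)
pose k j x := ((\1_E x)%:C)%C * g j x.
have kE j x : E x -> k j x = g j x.
  by move=> Ex; rewrite /k indicE mem_set// mul1r.
have kNE j x : ~ E x -> k j x = 0.
  by move=> Ex; rewrite /k indicE memNset// mul0r.
have mk j : cmeasurable (k j).
  apply: cmeasurableM; last by case: (lg j).
  by apply: cmeasurable_real; exact: measurable_indic.
(* [a j x <= S x] bounds the increment by [sqrt (S x) * 2^-j]; the square root is avoided by
   [S <= (1 + S)^2]. *)
have incr j x : E x -> normc (g j.+1 x - g j x) <= (1 + fine (S x)) * 2^-1 ^+ j.
  move=> Ex; have Sx0 : 0 <= fine (S x) by exact: fine_ge0.
  rewrite -(@ler_pXn2r _ 2)// ?nnegrE ?normc_ge0'//; last first.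
    by rewrite mulr_ge0 ?exprn_ge0// ?invr_ge0// addr_ge0.
  have : a j x <= fine (S x).
    rewrite -lee_fin fineK ?ge0_fin_numE//.
    apply: le_trans (nneseries_lim_ge (m := 0) j.+1 _); last first.
      by move=> n _ _; exact: a0.
    by rewrite big_nat_recr//= leeDr// sume_ge0// => i _; exact: a0.
  rewrite /a mulrC -ler_pdivlMr ?exprn_gt0// => /le_trans; apply.
  rewrite exprMn -exprM mulnC exprM -exprVn (_ : 2^-1 ^+ 2 = 4^-1 :> R); last first.
    by rewrite exprVn -natrX.
  rewrite ler_wpM2r ?exprn_ge0 ?invr_ge0//.
  rewrite sqrrD expr1n mul1r; have := sqr_ge0 (fine (S x)); lra.
have ck x : cvgn (fun j => complex.Re (k j x)) /\ cvgn (fun j => complex.Im (k j x)).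
  have [Ex|nEx] := pselect (E x); last first.
    by split; under eq_fun do rewrite kNE//; exact: is_cvg_cst.
  split; apply: (cvg_geometric_increments (C := 1 + fine (S x))) => n;
    apply: le_trans (incr n x Ex); rewrite !kE//.
    by rewrite -ReN -ReD; exact: ler_Re_normc.
  by rewrite -ImN -ImD; exact: ler_Im_normc.
pose h x := Complex (limn (fun j => complex.Re (k j x)))
                    (limn (fun j => complex.Im (k j x))).
have kr x : complex.Re (k n x) @[n --> \oo] --> complex.Re (h x) by case: (ck x).
have ki x : complex.Im (k n x) @[n --> \oo] --> complex.Im (h x) by case: (ck x).
have mh : cmeasurable h.
  split.
  - by apply: (measurable_fun_cvg (h := fun j x => complex.Re (k j x))) => // j;
      case: (mk j).
  - by apply: (measurable_fun_cvg (h := fun j x => complex.Im (k j x))) => // j;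
      case: (mk j).
(* Almost everywhere [u n - k (j + N)] equals [u n - u (M (j + N))], of squared norm below [e];
   Fatou's lemma lets [j] go to infinity. *)
have conv (e : R) : 0 < e -> exists N, forall n, (N <= n)%N ->
    (sqn (fun x => u n x - h x)%R <= e%:E)%E.
  move=> e0; have [N NP] := cu e e0; exists N => n Nn.
  apply: (@sqn_fatou (fun j x => u n x - k (j + N)%N x)).
  - by move=> j; apply: cmeasurableB => //; case: (lu n).
  - move=> x; under eq_fun do rewrite ReD ReN; rewrite ReD ReN.
    by apply: cvgB; [exact: cvg_cst|rewrite (cvg_shiftn N (fun j => complex.Re (k j x)))].
  - move=> x; under eq_fun do rewrite ImD ImN; rewrite ImD ImN.
    by apply: cvgB; [exact: cvg_cst|rewrite (cvg_shiftn N (fun j => complex.Im (k j x)))].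
  - move=> j; have lun : L2 (fun x => u n x - u (M (j + N)%N) x) by exact: L2B.
    apply: (@le_trans _ _ (sqn (fun x => u n x - u (M (j + N)%N) x))).
      rewrite le_eqVlt; apply/orP; left; apply/eqP.
      apply: ae_eq_integral => //.
      + apply/measurable_EFinP; apply: measurable_sqr_normc.
        by apply: cmeasurableB => //; case: (lu n).
      + by apply/measurable_EFinP; apply: measurable_sqr_normc; case: lun.
      + by apply: ae_imp aeE => x Ex _; rewrite kE.
    by rewrite -n2K// lee_fin ltW// NP// /M addnAC leq_addl.
have [N1 N1P] := conv 1 ltr01.
have lh : L2 h.
  have l1 : L2 (fun x => u N1 x - h x).
    split; first by apply: cmeasurableB => //; case: (lu N1).
    by rewrite (le_lt_trans (N1P N1 _))// ltry.
  have := L2B (lu N1) l1; rewrite (_ : (fun x => _) = h)//.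
  by apply/funext => x; rewrite opprB addrC subrK.
exists h => // e e0; have [N NP] := conv (e / 2) (divr_gt0 e0 (ltr0Sn _ 1)).
exists N => n Nn; rewrite (@le_lt_trans _ _ (e / 2))//; last by rewrite ltr_pdivrMr//; lra.
by rewrite -lee_fin n2K; [exact: NP|exact: L2B].
Qed.

End riesz_fischer.

(** * Spans, closed spans and nearest points *)

Section spans.
Context {R : realType} {I : eqType}.
Local Notation mu := (@lebesgue_measure R).
Implicit Types (f g h : R -> R[i]) (y : I -> R -> R[i]) (J : set I).

(** The list of a linear combination may repeat indices. Absorbing multiplicities into the
    coefficients puts several combinations over one common duplicate-free list. *)
Lemma sum_count (V : nmodType) (F : I -> V) (s r : seq I) :
  uniq r -> {subset s <= r} ->
  \sum_(k <- s) F k = \sum_(k <- r) F k *+ count_mem k s.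
Proof.
move=> ur; elim: s => [_|a s IHs sr].
  by rewrite big_nil big1.
rewrite big_cons IHs; last by move=> k ks; apply: sr; rewrite inE ks orbT.
rewrite -[F a](_ : \sum_(k <- r) F k *+ (a == k) = _).
  by rewrite -big_split; apply: eq_bigr => k _ /=; rewrite mulrnDr.
rewrite (bigD1_seq a) ?eqxx ?mulr1n ?sr ?inE ?eqxx//= big1 ?addr0// => k.
by rewrite eq_sym => /negbTE ->.
Qed.

Lemma span_uniq J y g : span_of J y g -> exists (r : seq I) (c : I -> R[i]),
  [/\ uniq r, forall k, k \in r -> J k & g = (fun x => \sum_(k <- r) c k * y k x)].
Proof.
move=> [s [c [sJ ->]]]; exists (undup s), (fun k => c k *+ count_mem k s).
split; [exact: undup_uniq|by move=> k; rewrite mem_undup; exact: sJ|].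
apply/funext => x; rewrite (sum_count _ (undup_uniq s)); last first.
  by move=> k; rewrite mem_undup.
by apply: eq_bigr => k _; rewrite mulrnAl.
Qed.

Lemma span_gen J y k : J k -> span_of J y (y k).
Proof.
move=> Jk; exists [:: k], (fun _ => 1); split; first by move=> j; rewrite inE => /eqP ->.
by apply/funext => x; rewrite big_seq1 mul1r.
Qed.

Lemma span0 J y : span_of J y (fun _ => 0).
Proof. by exists [::], (fun _ => 0); split => //; apply/funext => x; rewrite big_nil. Qed.

Lemma span_lin J y (a : R[i]) f g : span_of J y f -> span_of J y g ->
  span_of J y (fun x => a * f x + g x).
Proof.
move=> [s [c [sJ ->]]] [t [d [tJ ->]]].
set r := undup (s ++ t).
exists r, (fun k => a * c k *+ count_mem k s + d k *+ count_mem k t); split.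
  by move=> k; rewrite mem_undup mem_cat => /orP[/sJ|/tJ].
apply/funext => x.
rewrite (sum_count _ (undup_uniq (s ++ t))); last first.
  by move=> k ks; rewrite mem_undup mem_cat ks.
rewrite (sum_count (s := t) _ (undup_uniq (s ++ t))); last first.
  by move=> k ks; rewrite mem_undup mem_cat ks orbT.
rewrite mulr_sumr -big_split; apply: eq_bigr => k _ /=.
by rewrite mulrDl !mulrnAl mulrnAr mulrA.
Qed.

Lemma span_L2 J y g : (forall k, L2 (y k)) -> span_of J y g -> L2 g.
Proof. by move=> ly [s [c [_ ->]]]; apply: L2_sum => k; exact: L2Z. Qed.

Lemma span_ind J y (P : (R -> R[i]) -> Prop) :
  P (fun _ => 0) ->
  (forall k a g, J k -> span_of J y g -> P g -> P (fun x => a * y k x + g x)) ->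
  forall g, span_of J y g -> P g.
Proof.
move=> P0 PS g [s [c [+ ->]]]; elim: s => [_|k s IHs sJ].
  by under eq_fun do rewrite big_nil.
have sJ' j : j \in s -> J j by move=> js; apply: sJ; rewrite inE js orbT.
under eq_fun do rewrite big_cons; apply: PS; [|by exists s, c|exact: IHs].
by apply: sJ; rewrite inE eqxx.
Qed.

Lemma closed_spanP J y f : (forall k, L2 (y k)) ->
  closed_span J y f <-> L2 f /\ forall e : R, 0 < e ->
    exists2 g, span_of J y g & n2 (fun x => f x - g x) < e.
Proof.
move=> ly; split=> [[/cLp2E lf fg]|[lf fg]].
  split=> // e e0.
  have [g sg fge] := fg (Num.sqrt e) (eq_ind_r (is_true) e0 (sqrtr_gt0 e)).
  exists g => //; move: fge; rewrite cLnorm2_lt ?sqrtr_gt0// ?sqr_sqrtr ?ltW//.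
  by apply: L2B => //; exact: span_L2 sg.
split=> [|e e0]; first exact/cLp2E.
have [g sg fge] := fg (e ^+ 2) (exprn_gt0 _ e0).
by exists g => //; rewrite cLnorm2_lt//; apply: L2B => //; exact: span_L2 sg.
Qed.

(** Replaces passages to the limit: errors are stated as fixed multiples of an arbitrary [e]. The
    test value [x / (2 (|C| + 1))] makes [C * e] at most [x / 2]. *)
Lemma small_le0 (x C : R) : (forall e : R, 0 < e -> x <= C * e) -> x <= 0.
Proof.
move=> H; rewrite leNgt; apply/negP => x0.
have C0 : 0 < `|C| + 1 by rewrite ltr_wpDl.
have e0 : 0 < x / (2 * (`|C| + 1)) by rewrite divr_gt0// mulr_gt0.
have := H _ e0; apply/negP; rewrite -ltNge.
rewrite (@le_lt_trans _ _ ((`|C| + 1) * (x / (2 * (`|C| + 1)))))//.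
  by rewrite ler_wpM2r ?(ltW e0)// (le_trans (ler_norm _))// lerDl.
rewrite (_ : (`|C| + 1) * _ = x / 2); first by rewrite ltr_pdivrMr//; lra.
by field; rewrite gt_eqF.
Qed.

(** The residuals [v n = F - g n] of a minimizing sequence are Cauchy. Their limit [h], the
    component of [F] orthogonal to the closed span, is the witness. *)
Lemma orthogonal_witness J y F : (forall k, L2 (y k)) -> L2 F ->
  ~ closed_span J y F ->
  exists h, [/\ L2 h, forall k, J k -> dot (y k) h = 0 & dot F h != 0].
Proof.
move=> ly lF nF; have {nF} nF H := nF ((closed_spanP J F ly).2 H).
have [e e0 eP] : exists2 e : R, 0 < e & forall g, span_of J y g ->
    e <= n2 (fun x => F x - g x).
  apply: contrapT => H; apply: nF; split => // e e0.
  apply: contrapT => H'; apply: H; exists e => // g sg.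
  by rewrite leNgt; apply/negP => ?; apply: H'; exists g.
pose A := [set n2 (fun x => F x - g x) | g in span_of J y].
have infA : has_inf A.
  split; first by exists (n2 (fun x => F x - 0)), (fun _ => 0) => //; exact: span0.
  by exists e => _ [g sg <-]; exact: eP.
pose d := inf A.
have d0 : 0 < d.
  by rewrite (lt_le_trans e0)//; apply: lb_le_inf; [case: infA|move=> _ [g sg <-]; exact: eP].
have dle g : span_of J y g -> d <= n2 (fun x => F x - g x).
  by move=> sg; apply: ge_inf; [case: infA|exists g].
pose eps n : R := n.+1%:R^-1.
have near n : {g | span_of J y g & n2 (fun x => F x - g x) < d + eps n}.
  have n0 : 0 < eps n by rewrite invr_gt0.
  apply: cid2; have [_ [g sg <-] gd] := inf_adherent n0 infA.
  by exists g.
pose g n := s2val (near n).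
have sg n : span_of J y (g n) by exact: (s2valP (near n)).
have gd n : n2 (fun x => F x - g n x) < d + eps n by exact: (s2valP' (near n)).
have lg n : L2 (g n) by exact: span_L2 (sg n).
pose v n x := F x - g n x.
have lv n : L2 (v n) by exact: L2B.
clear e e0 eP.
have small (e : R) : 0 < e -> exists N, forall n, (N <= n)%N -> eps n < e.
  move=> e0; exists (Num.truncn e^-1) => n Nn.
  rewrite /eps invf_plt ?posrE//; apply: lt_le_trans (truncnS_gt _) _.
  by rewrite ler_nat ltnS.
have cv n m : n2 (fun x => v n x - v m x) <= 2 * eps n + 2 * eps m.
  (* Parallelogram law: the midpoint [w] is in the span, so
     [n2 (v n + v m) = 4 * n2 (F - w) >= 4 * d], while [n2 (v n)] and [n2 (v m)] exceed [d] by less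
     than [eps n] and [eps m]. *)
  pose w x := 2^-1 * (g n x + g m x).
  have lw : L2 w by exact: (L2Z (2^-1) (L2D (lg n) (lg m))).
  have sw : span_of J y w.
    have := span_lin (2^-1) (sg n) (span_lin (2^-1) (sg m) (span0 J y)).
    rewrite (_ : (fun x => _) = w)//.
    by apply/funext => x; rewrite addr0 /w mulrDr.
  have vw : n2 (fun x => v n x + v m x) = 4 * n2 (fun x => F x - w x).
    have -> : (fun x => v n x + v m x) = (fun x => 2 * (F x - w x)).
      by apply/funext => x; rewrite /v /w; field.
    apply: etrans (n2Z 2 (L2B lF lw)) _.
    by congr (_ * _); rewrite sqr_normcE /=; lra.
  have dw := dle _ sw; have gn : n2 (v n) < _ := gd n; have gm : n2 (v m) < _ := gd m.
  have Bnm := n2B (lv n) (lv m); have Dnm := n2D (lv n) (lv m).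
  rewrite vw in Dnm; rewrite Bnm.
  lra.
have [h lh vh] : exists2 h, L2 h & forall e : R, 0 < e ->
    exists N, forall n, (N <= n)%N -> n2 (fun x => v n x - h x) < e.
  apply: riesz_fischer => // {}e {}e0.
  have [N NP] := small (e / 4) (divr_gt0 e0 (ltr0Sn _ 3)).
  exists N => n m /NP + /NP; have := cv n m; lra.
have both (e : R) : 0 < e -> exists n, n2 (fun x => v n x - h x) < e /\ eps n < e.
  move=> e0; have [N NP] := small e e0; have [M MP] := vh e e0.
  by exists (maxn N M); split; [apply: MP; exact: leq_maxr|apply: NP; exact: leq_maxl].
have vy n k : J k -> normc (dot (v n) (y k)) ^+ 2 <= eps n * n2 (y k).
  move=> Jk.
  (* [g n + z * y k] stays in the span, so [d <= n2 (v n - z * y k)], whereas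
     [n2 (v n) < d + eps n]. Taking [z] to be a real multiple of [dot (v n) (y k)] leads to a
     discriminant inequality. *)
  have key (z : R[i]) : 0 <= eps n + normc z ^+ 2 * n2 (y k)
      - 2 * complex.Re (conjc z * dot (v n) (y k)).
    have lz := L2Z z (ly k).
    have : d <= n2 (fun x => v n x - z * y k x).
      have := dle _ (span_lin z (span_gen y Jk) (sg n)).
      congr (_ <= n2 _); apply/funext => x; rewrite /v; ring.
    rewrite n2B// n2Z// (dotC lz (lv n)) dotZl// (dotC (lv n) (ly k)) conjcM conjcK.
    have := gd n; rewrite -/(v n); lra.
  set D := dot (v n) (y k) in key *.
  have := @quadratic_ge0 R (eps n) (- normc D ^+ 2) (normc D ^+ 2 * n2 (y k)).
  have H0 : 0 <= normc D ^+ 2 * n2 (y k) by rewrite mulr_ge0 ?sqr_ge0 ?n2_ge0.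
  move=> /(_ H0) H; have {}H := H _.
  have [D0|D0] := eqVneq (normc D) 0.
    by rewrite D0 expr0n/= mulr_ge0 ?n2_ge0// invr_ge0.
  have Dp : 0 < normc D ^+ 2 by rewrite exprn_gt0// lt_neqAle eq_sym D0 normc_ge0'.
  have : (- normc D ^+ 2) ^+ 2 <= eps n * (normc D ^+ 2 * n2 (y k)).
    apply: H => t; have := key ((t%:C)%C * D).
    rewrite normcM normc_real exprMn real_normK ?num_real//.
    rewrite (_ : complex.Re _ = t * normc D ^+ 2); last first.
      by rewrite sqr_normcE; case: (D) => p q /=; ring.
    by move=> /le_trans; apply; rewrite le_eqVlt; apply/orP; left; apply/eqP; ring.
  move: (normc D ^+ 2) Dp => E E0; rewrite sqrrN expr2 mulrCA ler_pM2l//.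
have yh k : J k -> dot (y k) h = 0.
  move=> Jk; apply: eq0_normc; apply/eqP; rewrite -sqrf_eq0 eq_le sqr_ge0 andbT.
  apply: (@small_le0 _ (4 * n2 (y k))) => e e0.
  have [n [n1 n2e]] := both e e0.
  have -> : normc (dot (y k) h) = normc (dot h (y k)).
    by rewrite (dotC lh (ly k)) normc_conjc.
  have -> : dot h (y k) = - dot (fun x => v n x - h x) (y k) + dot (v n) (y k).
    by rewrite dotBl// opprB subrK.
  apply: le_trans (sqr_normcD_le _ _) _; rewrite normcN.
  have := cauchy_schwarz (L2B (lv n) lh) (ly k); have := vy n k Jk.
  have := n2_ge0 (y k); move: (n2 (y k)) => Y Y0 H1 H2.
  have : eps n * Y <= e * Y by rewrite ler_wpM2r// ltW.
  have : n2 (fun x => v n x - h x) * Y <= e * Y by rewrite ler_wpM2r// ltW.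
  lra.
have gh g' : span_of J y g' -> dot g' h = 0.
  move: g'; apply: (span_ind (P := fun g' => dot g' h = 0)) => [|k a g' Jk sg' IH].
    by rewrite -[RHS](mul0r (dot h h)) -dotZl//; congr dot; apply/funext => x; rewrite mul0r.
  rewrite dotDl ?dotZl// ?yh ?mulr0 ?IH ?addr0//; first exact: L2Z.
  exact: span_L2 sg'.
exists h; split => //; apply/eqP => Fh.
(* If [dot F h = 0], every [v n] is orthogonal to its own limit [h]. Hence [h = 0], the [v n] tend
   to 0, and the distance [d] vanishes. *)
have hv n : dot (v n) h = 0 by rewrite dotBl// Fh gh// subr0.
have h0 : n2 h = 0.
  apply/eqP; rewrite eq_le n2_ge0 andbT; apply: (@small_le0 _ 1) => e e0.
  have [n [n1 _]] := both e e0.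
  have := cauchy_schwarz (L2B (lv n) lh) lh.
  rewrite dotBl// hv sub0r normcN dot_id// normc_real real_normK ?num_real//.
  rewrite mul1r => H; have [->|hn0] := eqVneq (n2 h) 0; first exact: ltW.
  have hp : 0 < n2 h by rewrite lt_neqAle eq_sym hn0 n2_ge0.
  by move: H; rewrite expr2 ler_pM2r// => /le_trans; apply; exact: ltW.
have : d <= 0; last by rewrite leNgt d0.
apply: (@small_le0 _ 2) => e e0; have [n [n1 _]] := both e e0.
have := dle _ (sg n); rewrite -/(v n).
have := n2D_le (L2B (lv n) lh) lh; rewrite h0.
rewrite (_ : (fun x => v n x - h x + h x) = v n); last first.
  by apply/funext => x; rewrite subrK.
lra.
Qed.

End spans.

(** * The Fejer kernel on the unit circle *)

Section fejer_kernel.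
Context {R : realType}.
Implicit Types (s t : R) (z u : R[i]) (N : nat).

Lemma sqr_normc_1B_expi s : normc (1 - expi s) ^+ 2 = 2 - 2 * cos s.
Proof.
rewrite sqr_normcE ReD ImD ReN ImN /=.
have := cos2Dsin2 s; rewrite !expr2; lra.
Qed.

Lemma expi_2pi_nat (m : nat) : expi (2 * pi * m%:R) = 1 :> R[i].
Proof.
rewrite expiX (_ : expi _ = 1) ?expr1n//.
by rewrite /expi mulr_natl cos2pi sin2pi.
Qed.

Lemma expi_2pi_int (m : int) : expi (2 * pi * m%:~R) = 1 :> R[i].
Proof.
case: m => m; first exact: expi_2pi_nat.
rewrite NegzE mulrNz mulrN -conj_expi -pmulrn expi_2pi_nat.
exact: conjc1.
Qed.

(** [cos] decreases on [[0, pi]] and is symmetric about [pi]. *)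
Lemma cos_le_cos s t : 0 <= t <= pi -> t <= s <= 2 * pi - t -> cos s <= cos t.
Proof.
have key x y : 0 <= x -> x <= y -> y <= pi -> cos y <= cos x :> R.
  move=> x0 xy ypi.
  have hx : x \in `[0, pi] by rewrite in_itv/= x0 (le_trans xy).
  have hy : y \in `[0, pi] by rewrite in_itv/= ypi (le_trans x0).
  by rewrite leNgt (ltr_cos hy hx) -leNgt.
move=> /andP[t0 tpi] /andP[ts st].
have [spi|/ltW spi] := leP s pi; first exact: key.
have -> : cos s = cos (2 * pi - s).
  by rewrite -[RHS]cosN opprB -[RHS]cosD2pi -(mulr_natl pi 2) subrK.
by apply: key => //; lra.
Qed.

Lemma cos_lt1 s : 0 < `|s| < 2 * pi -> cos s < 1.
Proof.
move=> /andP[s0 s2]; rewrite -cos_norm.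
(* The distance from [|s|] to the nearer end of [[0, 2 pi]]. *)
pose t := Num.min `|s| (2 * pi - `|s|).
have t0 : 0 < t by rewrite lt_min s0 subr_gt0.
have tpi : t <= pi.
  rewrite /t ge_min; apply/orP; have [|spi] := lerP `|s| pi; first by left.
  by right; lra.
apply: (@le_lt_trans _ _ (cos t)).
  apply: cos_le_cos; first by rewrite (ltW t0).
  have t1 : t <= `|s| by rewrite ge_min lexx.
  have t2 : t <= 2 * pi - `|s| by rewrite ge_min lexx orbT.
  by apply/andP; split => //; lra.
have t_itv : t \in `[0, pi] by rewrite in_itv/= tpi (ltW t0).
have o_itv : (0 : R) \in `[0, pi] by rewrite in_itv/= lexx pi_ge0.
by rewrite -[ltRHS]cos0 (ltr_cos o_itv t_itv).
Qed.

Lemma expi_neq1 s : 0 < `|s| < 2 * pi -> expi s != 1.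
Proof.
by move=> /cos_lt1 s1; apply/eqP => /(congr1 (@complex.Re R)) /= cs; rewrite cs ltxx in s1.
Qed.

(** The Fejer kernel in the variable [z], divided once more by [N]: its values at [N] equally spaced
    points of the circle then sum to 1. *)
Definition fejer N z : R := normc (\sum_(k < N) z ^+ k) ^+ 2 / N%:R ^+ 2.

Lemma fejer_ge0 N z : 0 <= fejer N z.
Proof. by rewrite divr_ge0 ?sqr_ge0. Qed.

Lemma normcX z n : normc (z ^+ n) = normc z ^+ n.
Proof.
by elim: n => [|n IHn]; rewrite ?expr0 ?normc1// !exprS normcM IHn.
Qed.

(** [(1 - z)] times the geometric sum is [1 - z ^+ N], of modulus at most 2. *)
Lemma fejer_tail N z : normc z = 1 ->
  fejer N z * normc (1 - z) ^+ 2 <= 4 / N%:R ^+ 2.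
Proof.
move=> z1; rewrite /fejer mulrAC ler_wpM2r ?invr_ge0 ?sqr_ge0//.
rewrite -exprMn -normcM mulrC -[1 - z]opprB mulNr -subrX1 normcN.
rewrite (_ : 4 = 2 ^+ 2); last by rewrite -natrX.
rewrite ler_pXn2r ?nnegrE ?normc_ge0'//.
by rewrite (le_trans (le_normcD _ _))// normcN normcX z1 expr1n normc1.
Qed.

Lemma geometric_root_sum N (s : R) (m : int) : s * N%:R = 2 * pi * m%:~R ->
  0 < `|s| < 2 * pi -> \sum_(j < N) expi s ^+ j = 0.
Proof.
move=> sN s2; have := subrX1 (expi s) N.
rewrite -expiX sN expi_2pi_int subrr => /esym/eqP.
by rewrite mulf_eq0 subr_eq0 (negbTE (expi_neq1 s2)) => /eqP.
Qed.

Lemma sqr_normc_sum N (a : 'I_N -> R[i]) :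
  ((normc (\sum_k a k) ^+ 2)%:C)%C = \sum_k \sum_l a k * conjc (a l).
Proof.
rewrite -mulcJ (rmorph_sum (@conjc R)) mulr_suml.
by apply: eq_bigr => k _; rewrite mulr_sumr.
Qed.

(** Expand the squared modulus into a double sum over [k, l] and sum over [j] inside: only the [N]
    diagonal terms survive, each contributing [N]. *)
Lemma fejer_sum N u : (0 < N)%N -> normc u = 1 ->
  \sum_(j < N) fejer N (u * expi (- (2 * pi / N%:R)) ^+ j) = 1.
Proof.
move=> N0 u1; have Nr : N%:R != 0 :> R by rewrite pnatr_eq0 -lt0n.
set w := expi _; rewrite -mulr_suml.
suff -> : \sum_(j < N) normc (\sum_(k < N) (u * w ^+ j) ^+ k) ^+ 2 = N%:R ^+ 2.
  by rewrite divff// expf_neq0.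
apply: (@complexI R); rewrite rmorph_sum/=.
under eq_bigr do rewrite sqr_normc_sum.
rewrite exchange_big/=.
under eq_bigr => k _ do rewrite exchange_big/=.
transitivity (\sum_(k < N) (N%:R : R[i])); last first.
  by rewrite sumr_const card_ord (rmorphXn (real_complex R)) rmorph_nat expr2 mulr_natr.
(* Off the diagonal the sum over [j] runs through the powers of an [N]-th root of unity, different
   from 1 because [0 < |l - k| < N]. *)
apply: eq_bigr => k _; rewrite (bigD1 k)//= [X in _ + X]big1 ?addr0; last first.
  move=> l lk.
  pose s := 2 * pi / N%:R * (l%:R - k%:R) : R.
  transitivity (u ^+ k * conjc u ^+ l * \sum_(j < N) expi s ^+ j).
    rewrite mulr_sumr; apply: eq_bigr => j _.
    rewrite conjcX conjcM conjcX !exprMn /w conj_expi opprK.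
    rewrite mulrACA; congr (_ * _).
    rewrite -!exprM -!expiX -expiD; congr expi.
    by rewrite /s !natrM; ring.
  rewrite (@geometric_root_sum _ _ (l%:Z - k%:Z)) ?mulr0//.
    by rewrite /s mulrAC divfK// intrD intrN -!pmulrn.
  have Np : 0 < N%:R :> R by rewrite ltr0n.
  have pp := @pi_gt0 R.
  rewrite /s !normrM normfV (ger0_norm (ltW Np)) (ger0_norm (ltW pp)) (@ger0_norm _ 2)//.
  have kl0 : (0 : R) < `|l%:R - k%:R|.
    by rewrite normr_gt0 subr_eq0 eqr_nat (inj_eq val_inj).
  rewrite mulr_gt0 ?divr_gt0 ?mulr_gt0//=.
  rewrite mulrAC ltr_pdivrMr// ltr_pM2l ?mulr_gt0//.
  have lN : (l%:R : R) < N%:R by rewrite ltr_nat.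
  have kN : (k%:R : R) < N%:R by rewrite ltr_nat.
  have l0 : 0 <= (l%:R : R) by []; have k0 : 0 <= (k%:R : R) by [].
  by rewrite ltr_norml; apply/andP; split; lra.
transitivity (\sum_(j < N) (1 : R[i])); last by rewrite sumr_const card_ord.
apply: eq_bigr => j _; rewrite mulcJ !normcX normcM normcX normc_expi u1.
by rewrite !expr1n mulr1 !expr1n.
Qed.

End fejer_kernel.

(** * Exponentials of real frequency *)

Section oscillations.
Context {R : realType}.
Implicit Types (w t s : R).

Definition osc w t : R[i] := expi (2 * pi * w * t).

Lemma oscD w t s : osc w (t + s) = osc w t * osc w s.
Proof. by rewrite /osc mulrDr expiD. Qed.

Lemma oscDl w s t : osc (w + s) t = osc w t * osc s t.
Proof. by rewrite /osc mulrDr mulrDl expiD. Qed.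

Lemma osc0 w : osc w 0 = 1.
Proof. by rewrite /osc mulr0 expi0. Qed.

Lemma osc0l t : osc 0 t = 1.
Proof. by rewrite /osc mulr0 mul0r expi0. Qed.

Lemma conj_osc w t : conjc (osc w t) = osc (- w) t.
Proof. by rewrite /osc conj_expi; congr expi; ring. Qed.

Lemma normc_osc w t : normc (osc w t) = 1.
Proof. exact: normc_expi. Qed.

Lemma cmeasurable_osc w : cmeasurable (osc w).
Proof. by apply: cmeasurable_expi; exact: mulrl_measurable. Qed.

Lemma oscXl w t n : osc (w * n%:R) t = osc w t ^+ n.
Proof. by rewrite /osc -expiX; congr expi; ring. Qed.

Lemma osc_int (k m : int) : osc k%:~R m%:~R = 1 :> R[i].
Proof. by rewrite /osc -mulrA -intrM expi_2pi_int. Qed.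

Lemma osc_periodic (k m : int) t : osc k%:~R (t + m%:~R) = osc k%:~R t.
Proof. by rewrite oscD osc_int mulr1. Qed.

End oscillations.

(** * Trigonometric polynomials approximating indicators *)

Section fejer_sampling.
Context {R : realType}.
Local Notation mu := (@lebesgue_measure R).
Variables a b c d : R.
Hypotheses (ac : a < c) (cd : c < d) (db : d < b).
Let w := (b - a)^-1.

Definition fejer_node (n j : nat) : R := a + (b - a) * (j%:R / n.+1%:R).

(* A discrete Riemann sum of Fejer kernels: a trigonometric polynomial that tends
   boundedly to the indicator of [[c, d]], without any integral of the kernel. *)
Definition fejer_sampling (n : nat) (t : R) : R :=
  \sum_(j < n.+1 | c <= fejer_node n j <= d) fejer n.+1 (osc w (t - fejer_node n j)).

Let ba : 0 < b - a.
Proof. by rewrite subr_gt0 (lt_trans ac)// (lt_trans cd). Qed.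

(** The nodes are equally spaced over the period [b - a], so passing to the next one multiplies by a
    fixed root of unity, the form required by [fejer_sum]. *)
Lemma osc_node n (j : nat) t : osc w (t - fejer_node n j) =
  osc w (t - a) * expi (- (2 * pi / n.+1%:R)) ^+ j.
Proof.
rewrite /osc -expiX -expiD; congr expi; rewrite /fejer_node /w.
have : n.+1%:R != 0 :> R by rewrite pnatr_eq0.
move: (n.+1%:R) => N N0; have := gt_eqF ba.
by move=> ba0; field; rewrite ba0 N0.
Qed.

Lemma fejer_node_sum n t :
  \sum_(j < n.+1) fejer n.+1 (osc w (t - fejer_node n j)) = 1.
Proof.
under eq_bigr do rewrite osc_node.
by rewrite fejer_sum// normc_osc.
Qed.

Lemma fejer_sampling_ge0 n t : 0 <= fejer_sampling n t.
Proof. by apply: sumr_ge0 => j _; exact: fejer_ge0. Qed.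

Lemma fejer_sampling_le1 n t : fejer_sampling n t <= 1.
Proof.
rewrite -(fejer_node_sum n t) [leRHS](bigID (fun j : 'I__ => c <= fejer_node n j <= d)).
by rewrite lerDl; apply: sumr_ge0 => j _; exact: fejer_ge0.
Qed.

Lemma fejer_node_itv n (j : 'I_n.+1) : a <= fejer_node n j < b.
Proof.
rewrite /fejer_node lerDl mulr_ge0 ?divr_ge0 ?(ltW ba)//=.
have jn : (j%:R : R) < n.+1%:R by rewrite ltr_nat.
by rewrite -ltrBrDl -[ltRHS]mulr1 ltr_pM2l// ltr_pdivrMr ?mul1r ?ltr0n.
Qed.

(** Each term is at most [4 / m / N^2] by the tail estimate, and there are at most [N] of them. *)
Lemma fejer_sum_far n t (P : pred 'I_n.+1) (m : R) : 0 < m ->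
  (forall j, P j -> m <= normc (1 - osc w (t - fejer_node n j)) ^+ 2) ->
  \sum_(j < n.+1 | P j) fejer n.+1 (osc w (t - fejer_node n j)) <= 4 / m / n.+1%:R.
Proof.
move=> m0 mP; set N : R := n.+1%:R; have N0 : 0 < N by rewrite ltr0n.
have bnd j : P j -> fejer n.+1 (osc w (t - fejer_node n j)) <= 4 / m / N ^+ 2.
  move=> /mP mj; rewrite mulrAC ler_pdivlMr//.
  apply: le_trans (fejer_tail n.+1 (normc_osc w (t - fejer_node n j))).
  by rewrite ler_wpM2l// fejer_ge0.
apply: (@le_trans _ _ (\sum_(j < n.+1) 4 / m / N ^+ 2)).
  rewrite [leRHS](bigID P)/= -[leLHS]addr0 lerD ?ler_sum//.
  by rewrite sumr_ge0// => j _; rewrite divr_ge0 ?sqr_ge0// divr_ge0// ltW.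
rewrite sumr_const card_ord -mulr_natr -/N le_eqVlt; apply/orP; left; apply/eqP.
by field; rewrite !gt_eqF.
Qed.

(** The kernels at all nodes sum to 1, so the error is the sum over the nodes whose membership in
    [[c, d]] differs from that of [t]. These stay away from [t] modulo the period, and the error is
    of order [1 / n]. *)
Lemma fejer_sampling_cvg t : a <= t < b -> t != c -> t != d ->
  fejer_sampling n t @[n --> \oo] --> ((c <= t <= d)%R%:R : R).
Proof.
move=> /andP[ta tb] tc td; have [ac' cd' db'] := And3 ac cd db.
(* The kernel has period [b - a]; the bounds by [c - a] and [b - d] keep the nodes in question away
   from [t] across the ends of the interval as well. *)
have [r r0 [r1 r2 r3 r4]] : exists2 r : R, 0 < r &
    [/\ r <= `|t - c|, r <= `|t - d|, r <= c - a & r <= b - d].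
  exists (Num.min (Num.min `|t - c| `|t - d|) (Num.min (c - a) (b - d))).
    by rewrite !lt_min !normr_gt0 !subr_eq0 tc td !subr_gt0 ac db.
  by split; rewrite !ge_min lexx ?orbT.
have w0 : 0 < w by rewrite invr_gt0.
have pp := @pi_gt0 R.
pose q := 2 * pi * w * r.
have q0 : 0 < q by rewrite !mulr_gt0.
have wba : w * (b - a) = 1 by rewrite mulVf// gt_eqF.
have qpi : q <= pi.
  rewrite [leRHS](_ : _ = pi * (w * (b - a))); last by rewrite wba mulr1.
  rewrite /q (_ : 2 * pi * w * r = pi * (w * (2 * r))); last by ring.
  have r_half : 2 * r <= b - a by lra.
  by rewrite !ler_pM2l.
(* [q] is the phase of a displacement by [r], and [m] the squared chord it spans. *)
pose m := 2 - 2 * cos q.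
have m0 : 0 < m.
  have : cos q < 1 by apply: cos_lt1; rewrite ger0_norm ?q0 ?(ltW q0)//=; lra.
  by rewrite /m; lra.
have far n (j : 'I_n.+1) : (c <= t <= d) != (c <= fejer_node n j <= d) ->
    m <= normc (1 - osc w (t - fejer_node n j)) ^+ 2.
  move=> bad; have /andP[ja jb] := fejer_node_itv j.
  set x := fejer_node n j in bad ja jb *.
  rewrite /osc sqr_normc_1B_expi /m lerD2l lerN2 ler_pM2l//.
  rewrite -cos_norm; apply: cos_le_cos; first by rewrite qpi (ltW q0).
  have -> : `|2 * pi * w * (t - x)| = 2 * pi * w * `|t - x|.
    by rewrite normrM (@ger0_norm _ (2 * pi * w))// !mulr_ge0// ltW.
  have -> : 2 * pi - q = 2 * pi * w * (b - a - r).
    rewrite /q mulrBr; congr (_ - _).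
    by rewrite -[LHS]mulr1 -wba !mulrA.
  suff [h1 h2] : r <= `|t - x| /\ `|t - x| <= b - a - r.
    by rewrite !ler_pM2l ?mulr_gt0// h1 h2.
  move: bad r1 r2; have [xt|xt] := lerP x t.
  - have [tc1|tc1] := lerP c t; have [td1|td1] := lerP t d => /=;
    have [xc1|xc1] := lerP c x; have [xd1|xd1] := lerP x d => //= _ r1 r2;
    split; lra.
  - have [tc1|tc1] := lerP c t; have [td1|td1] := lerP t d => /=;
    have [xc1|xc1] := lerP c x; have [xd1|xd1] := lerP x d => //= _ r1 r2;
    split; lra.
have bound n : `|(c <= t <= d)%R%:R - fejer_sampling n t| <= 4 / m / n.+1%:R.
  have := far n; case: (c <= t <= d) => far'.
    have E : 1 = fejer_sampling n t + \sum_(j < n.+1 | ~~ (c <= fejer_node n j <= d))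
        fejer n.+1 (osc w (t - fejer_node n j)).
      by rewrite -[LHS](fejer_node_sum n t) (bigID (fun j : 'I__ => c <= fejer_node n j <= d)).
    rewrite ger0_norm ?subr_ge0 ?fejer_sampling_le1// [X in X - _]E addrAC subrr add0r.
    apply: fejer_sum_far => // j jP; apply: far'.
  rewrite sub0r normrN ger0_norm ?fejer_sampling_ge0//.
  by apply: fejer_sum_far => // j jP; apply: far'; rewrite jP.
apply/cvgrPdist_le => e e0.
have [M MP] : exists M : nat, 4 / m / e < M%:R.
  by exists (Num.truncn (4 / m / e)).+1; exact: truncnS_gt.
exists M => // n /= Mn; apply: le_trans (bound n) _.
rewrite ler_pdivrMr ?ltr0n// -ler_pdivrMl// [leLHS]mulrC.
by rewrite (le_trans (ltW MP))// ler_nat leqW.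
Qed.

Lemma measurable_fejer_sampling n : measurable_fun setT (fejer_sampling n).
Proof.
rewrite /fejer_sampling; under eq_fun do rewrite -big_filter.
apply: measurable_sum => j; rewrite /fejer; apply: measurable_funM => //.
apply: measurable_sqr_normc.
apply: cmeasurable_sum => k; under eq_fun do rewrite -oscXl.
exact/cmeasurable_shift/cmeasurable_osc.
Qed.

End fejer_sampling.

(** * Uniqueness of Fourier coefficients in L^1 *)

Section fourier_uniqueness.
Context {R : realType}.
Local Notation mu := (@lebesgue_measure R).

Lemma real_complex_sum (I : Type) (s : seq I) (F : I -> R) :
  ((\sum_(i <- s) F i)%:C)%C = \sum_(i <- s) ((F i)%:C)%C :> R[i].
Proof. exact: (rmorph_sum (real_complex R)). Qed.

Lemma ae_neq (a : R) : {ae mu, forall x, x != a}.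
Proof.
exists [set a]; split; [exact: measurable_set1|exact: lebesgue_measure_set1|].
by move=> x /= /negP; rewrite negbK => /eqP.
Qed.

Lemma nicely_shrinking_harmonic (x : R) :
  nicely_shrinking x (fun n => ball x (harmonic n)).
Proof.
split; first by move=> n; exact: measurable_ball.
have h0 n : 0 < harmonic n :> R by rewrite /harmonic/= invr_gt0.
exists (1, fun n => PosNum (h0 n)); split => //=.
  exact: cvg_harmonic.
  by move=> n; exact: subset_refl.
by move=> n; rewrite mul1e.
Qed.

(** By Lebesgue differentiation, at almost every [x] the value [u x] is the limit of averages over
    small balls, which are eventually closed intervals inside []a, b[]. The endpoint [a], having no
    such ball, is discarded as a null set. *)
Lemma ae_eq0_of_itv_integrals (a b : R) (u : R -> R) :
  mu.-integrable setT (EFin \o u) ->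
  (forall x, ~ (a <= x < b) -> u x = 0) ->
  (forall c d, a < c -> c < d -> d < b -> (\int[mu]_(x in `[c, d]) (u x)%:E = 0)%E) ->
  {ae mu, forall x, u x = 0}.
Proof.
move=> iu u0 uint.
have lu : locally_integrable setT u by exact: (open_integrable_locally openT).
apply: (ae_imp2 _ (lebesgue_differentiation lu) (ae_neq a)) => x lx xa.
have [/andP[ax xb]|] := pselect (a <= x < b); last exact: u0.
have {}ax : a < x by rewrite lt_neqAle eq_sym xa.
have := nice_lebesgue_differentiation nicely_shrinking_harmonic lu lx.
have e0 : 0 < Num.min (x - a) (b - x) by rewrite lt_min !subr_gt0 ax xb.
have near0 : \forall n \near \oo, ((mu (ball x (harmonic n)))^-1 *
    \int[mu]_(y in ball x (harmonic n)) (u y)%:E = 0)%E.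
  have /cvgrPdist_lt/(_ _ e0) := @cvg_harmonic R.
  apply: filterS => n; rewrite sub0r normrN ger0_norm; last first.
    by rewrite /harmonic/= invr_ge0.
  rewrite lt_min => /andP[h1 h2].
  have h0 : 0 < harmonic n :> R by rewrite /harmonic/= invr_gt0.
  rewrite ball_itv -(integral_itv_bndoo true false); last first.
    apply/measurable_EFinP; apply: measurable_funTS.
    by case: lu.
  by rewrite uint ?mule0//; lra.
move=> /(cvg_lim (@ereal_hausdorff R)) ux.
have : (u x)%:E = 0%E.
  rewrite -ux; apply: cvg_lim => //.
  by apply: cvg_near_cst.
by move=> [].
Qed.

(** The integral of [H] against every trigonometric polynomial of period [b - a] vanishes, in
    particular against the Fejer samplings. These tend boundedly to the indicator of [[c, d]], so
    dominated convergence makes all integrals over intervals vanish. *)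
Lemma fourier_uniqueness (a b : R) (H : R -> R[i]) : a < b -> cintegrable H ->
  (forall x, ~ (a <= x < b) -> H x = 0) ->
  (forall k : int, cintegral (fun x => H x * osc (k%:~R / (b - a)) x) = 0) ->
  {ae mu, forall x, H x = 0}.
Proof.
move=> ab cH H0 Hk.
have HT c d n : a < c -> c < d -> d < b ->
    cintegral (fun x => H x * ((fejer_sampling a b c d n x)%:C)%C) = 0.
  move=> ac cd db; rewrite /fejer_sampling.
  set w := (b - a)^-1.
  pose q : R[i] := (((n.+1%:R ^+ 2)^-1)%:C)%C.
  (* One term of the expanded kernel at node [j]: a constant times [H] times the exponential of
     frequency [(k - l) / (b - a)]. *)
  pose F (j : 'I_n.+1) (k l : 'I_n.+1) (x : R) : R[i] :=
    q * osc (w * (k%:R - l%:R)) (- fejer_node a b n j) *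
      (H x * osc ((k%:Z - l%:Z)%:~R / (b - a)) x).
  have cF j k l : cintegrable (F j k l).
    apply: cintegrableZ; apply: (cintegrableM_bounded (C := 1)) => //.
      exact: cmeasurable_osc.
    by move=> x; rewrite normc_osc.
  set s := [seq j : 'I_n.+1 <- index_enum 'I_n.+1 | c <= fejer_node a b n j <= d].
  transitivity (cintegral (fun x => \sum_(j <- s) \sum_k \sum_l F j k l x)).
    congr cintegral; apply/funext => x; rewrite -big_filter.
    rewrite real_complex_sum mulr_sumr; apply: eq_bigr => j _.
    rewrite /fejer real_complexM sqr_normc_sum -/q.
    rewrite mulr_suml mulr_sumr; apply: eq_bigr => k _.
    rewrite mulr_suml mulr_sumr; apply: eq_bigr => l _.
    rewrite /F -!oscXl conj_osc -oscDl oscD.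
    rewrite (_ : w * k%:R - w * l%:R = w * (k%:R - l%:R)); last by rewrite mulrBr.
    rewrite (_ : (k%:Z - l%:Z)%:~R / (b - a) = w * (k%:R - l%:R)); last first.
      by rewrite mulrC intrB -!pmulrn.
    ring.
  rewrite cintegral_sum; last first.
    by move=> j; do 2 apply: cintegrable_sum => ?.
  apply: big1 => j _; rewrite cintegral_sum; last first.
    by move=> k; apply: cintegrable_sum => l.
  apply: big1 => k _; rewrite cintegral_sum//.
  apply: big1 => l _; rewrite /F cintegralZ ?Hk ?mulr0//.
  apply: (cintegrableM_bounded (C := 1)) => //; first exact: cmeasurable_osc.
  by move=> x; rewrite normc_osc.
(* To be used with [p] the real part and the imaginary part, the Fejer samplings being real. *)
have key (p : R[i] -> R) : (p 0 = 0) ->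
    mu.-integrable setT (EFin \o (fun x => p (H x))) ->
    (forall c d n, a < c -> c < d -> d < b ->
       \int[mu]_x (p (H x) * fejer_sampling a b c d n x) = 0) ->
    {ae mu, forall x, p (H x) = 0}.
  move=> p0 iH HT'; apply: (ae_eq0_of_itv_integrals iH).
    by move=> x /H0 ->.
  move=> c d ac cd db.
  rewrite integral_mkcond; pose g x := (p (H x) * (c <= x <= d)%R%:R)%:E.
  have -> : (fun x => (p (H x))%:E) \_ `[c, d] = g.
    apply/funext => x; rewrite patchE /g mem_setE in_itv/=.
    by case: ifPn => _; rewrite ?mulr1 ?mulr0.
  have mH : measurable_fun setT (fun x => p (H x)).
    by apply/measurable_EFinP; exact: (measurable_int mu).
  have mg : measurable_fun setT g.
    apply/measurable_EFinP; apply: measurable_funM => //.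
    have -> : (fun x => (c <= x <= d)%R%:R : R) = \1_`[c, d].
      by apply/funext => x; rewrite indicE mem_setE in_itv.
    exact: measurable_indic.
  pose f n x := (p (H x) * fejer_sampling a b c d n x)%:E.
  have mf n : measurable_fun setT (f n).
    apply/measurable_EFinP; apply: measurable_funM => //.
    exact: measurable_fejer_sampling.
  have fg : {ae mu, forall x, setT x -> f ^~ x @ \oo --> g x}.
    have ncd : {ae mu, forall x, x != c /\ x != d}.
      by apply: (ae_imp2 _ (ae_neq c) (ae_neq d)) => x xc xd; split.
    apply: ae_imp ncd => x [xc xd] _.
    have [xab|/H0 Hx0] := pselect (a <= x < b); last first.
      by rewrite /f /g Hx0 p0; under eq_fun do rewrite mul0r; rewrite mul0r; exact: cvg_cst.
    rewrite /f /g; apply: cvg_EFin; first exact: nearW.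
    by apply: cvgM; [exact: cvg_cst|exact: fejer_sampling_cvg].
  have fle n x : (`|f n x| <= (`|p (H x)|%R)%:E)%E.
    rewrite /f /= lee_fin normrM ler_piMr//.
    by rewrite ger0_norm ?fejer_sampling_le1// fejer_sampling_ge0.
  have intf n : (\int[mu]_x f n x = 0)%E.
    rewrite -[LHS]fineK; first by have := HT' c d n ac cd db; rewrite /Rintegral => ->.
    apply: integrable_fin_num => //.
    apply: (@le_integrable _ _ _ mu setT measurableT _ (EFin \o (fun x => p (H x)))).
    - exact: mf.
    - by move=> x _; exact: fle.
    - exact: iH.
  have fdom : {ae mu, forall x n, setT x ->
      (`|f n x| <= (`|p (H x)|%R)%:E)%E}.
    by apply: aeW => x n _; exact: fle.
  have [_ _] := @dominated_convergence _ _ _ mu setT measurableT f g _ mf mg fg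
    (integrable_norm iH) fdom.
  move=> /(cvg_lim (@ereal_hausdorff R)) <-.
  by apply: cvg_lim => //; under eq_fun do rewrite intf; exact: cvg_cst.
have ReH : {ae mu, forall x, complex.Re (H x) = 0}.
  apply: (key (@complex.Re R)) => //.
  - by case: cH.
  - move=> c d n ac cd db; have /(congr1 (@complex.Re R)) /= := HT c d n ac cd db.
    by under eq_Rintegral do rewrite ReM /= mulr0 subr0.
have ImH : {ae mu, forall x, complex.Im (H x) = 0}.
  apply: (key (@complex.Im R)) => //.
  - by case: cH.
  - move=> c d n ac cd db; have /(congr1 (@complex.Im R)) /= := HT c d n ac cd db.
    by under eq_Rintegral do rewrite ImM /= mulr0 add0r.
by apply: (ae_imp2 _ ReH ImH) => x Rx Ix; apply: complex_ext; rewrite ?Rx ?Ix.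
Qed.

End fourier_uniqueness.

(** * Translation invariance and periodization *)

Section translation.
Context {R : realType}.
Local Notation mu := (@lebesgue_measure R).

Lemma measurable_shift (c : R) :
  measurable_fun [set: measurableTypeR R] ((fun x => x + c) : _ -> measurableTypeR R).
Proof. by apply: measurable_funD => //; exact: measurable_cst. Qed.

(** Lebesgue measure is determined by its values on half-open intervals, whose lengths do not change
    under translation. *)
Lemma lebesgue_measure_shift (c : R) (A : set R) : measurable A ->
  pushforward mu ((fun x => x + c) : measurableTypeR R -> measurableTypeR R) A = mu A.
Proof.
move=> mA.
have mshift := measurable_shift c.
apply/esym/lebesgue_measure_unique => //= _ [[a b]] _ <-.
rewrite /pushforward.
have -> : (fun x => x + c) @^-1` `]a, b] = `]a - c, b - c]%classic.
  by apply/seteqP; split => x /=; rewrite !in_itv/= ltrBlDr lerBrDr.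
rewrite !lebesgue_measure_itv/= !lte_fin ltrD2r.
by case: ifP => // _; rewrite -!EFinB; congr EFin; lra.
Qed.

Lemma ge0_integral_shift (c : R) (D : set R) (f : R -> \bar R) : measurable D ->
  measurable_fun D f -> (forall x, D x -> (0 <= f x)%E) ->
  (\int[mu]_(x in D) f x = \int[mu]_(x in (fun x => x + c)%R @^-1` D) f (x + c)%R)%E.
Proof.
move=> mD mf f0.
have := @ge0_integral_pushforward _ _ _ _ R _ (measurable_shift c) mu D f mD mf.
move=> /(_ _)/= <-; last by move=> x /set_mem; exact: f0.
apply: eq_measure_integral; first exact: measurable_shift.
by move=> ? A mA _; apply/esym; exact: lebesgue_measure_shift.
Qed.

Lemma Rintegral_shift (c : R) (u : R -> R) : measurable_fun setT u ->
  \int[mu]_x u (x + c) = \int[mu]_x u x.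
Proof.
move=> mu_; rewrite /Rintegral; congr fine.
have mE : measurable_fun setT (EFin \o u) by exact/measurable_EFinP.
rewrite integralE [RHS]integralE; congr (_ - _)%E; apply/esym.
  apply: etrans (ge0_integral_shift c measurableT (measurable_funepos mE) _) _ => [x _|].
    exact: funepos_ge0.
  by rewrite preimage_setT; apply: eq_integral => x _; rewrite !funeposE.
apply: etrans (ge0_integral_shift c measurableT (measurable_funeneg mE) _) _ => [x _|].
  exact: funeneg_ge0.
by rewrite preimage_setT; apply: eq_integral => x _; rewrite !funenegE.
Qed.

Lemma cintegral_shift (c : R) (f : R -> R[i]) : cmeasurable f ->
  cintegral (fun x => f (x + c)) = cintegral f.
Proof.
move=> [rf jf]; apply: complex_ext => /=.
  exact: (Rintegral_shift c rf).
exact: (Rintegral_shift c jf).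
Qed.

Lemma sqn_shift (c : R) (f : R -> R[i]) : cmeasurable f ->
  sqn (fun x => f (x + c)) = sqn f.
Proof.
move=> mf; apply/esym; rewrite /sqn (ge0_integral_shift c)//.
  by apply/measurable_EFinP; exact: measurable_sqr_normc.
by move=> x _; rewrite lee_fin sqr_ge0.
Qed.

(** An enumeration of the integers [0, -1, 1, -2, 2, ...], turning sums over [int] into series,
    which can be exchanged with integrals. *)
Definition int_of_nat (n : nat) : int := if odd n then Negz n./2 else Posz n./2.

Lemma int_of_nat_bij : set_bij setT setT int_of_nat.
Proof.
pose g (k : int) : nat := match k with Posz n => n.*2 | Negz n => n.*2.+1 end.
have gK : cancel int_of_nat g.
  move=> n; rewrite /int_of_nat; case: ifP => on /=; rewrite -[RHS]odd_double_half on//.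
have Kg : cancel g int_of_nat.
  by case=> n; rewrite /int_of_nat/= odd_double/= ?uphalf_double ?doubleK.
split => // [n m _ _ /(congr1 g)|k _]; first by rewrite !gK.
by exists (g k) => //; exact: Kg.
Qed.

Lemma floor_itv (p x : R) (k : int) : 0 < p ->
  (k%:~R * p <= x < k%:~R * p + p) = (k == Num.floor (x / p)).
Proof.
move=> p0; have -> : k%:~R * p + p = (k + 1)%:~R * p by rewrite intrD mulrDl mul1r.
rewrite -ler_pdivlMr// -ltr_pdivrMr// eq_sym; apply/idP/idP => [H|/eqP <-].
  by apply/eqP; exact: floor_def.
by rewrite floor_le_tmp floorD1_gt.
Qed.

(** Cut the line into the translates of [[0, p[], shift each piece back and exchange sum and
    integral, all terms being nonnegative. *)
Lemma integral_periodization (p : R) (f : R -> \bar R) : 0 < p ->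
  measurable_fun setT f -> (forall x, (0 <= f x)%E) ->
  (\int[mu]_x f x =
   \int[mu]_(t in `[0%R, p[) \esum_(k in [set: int]) f (t + k%:~R * p)%R)%E.
Proof.
move=> p0 mf f0.
pose F n := `[(int_of_nat n)%:~R * p, (int_of_nat n)%:~R * p + p[%classic.
have Fcover : \bigcup_n F n = setT.
  apply/seteqP; split => // x _.
  have [_ _ /(_ (Num.floor (x / p)) I)[n _ nE]] := int_of_nat_bij.
  by exists n => //; rewrite /F/= in_itv/= floor_itv// nE.
have Ftriv : trivIset setT F.
  apply/trivIsetP => i j _ _ ij; apply/seteqP; split => // x [].
  rewrite /F/= !in_itv/= !floor_itv// => /eqP ix /eqP jx.
  have [_ inj _] := int_of_nat_bij.
  by move/eqP: ij; apply; apply: inj; rewrite ?inE// ix.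
have mshift n : measurable_fun setT (fun t : R => f (t + (int_of_nat n)%:~R * p)).
  exact: (measurableT_comp mf (measurable_shift _)).
rewrite -[in LHS]Fcover ge0_integral_bigcup//; last 2 first.
- by move=> n; exact: measurable_itv.
- by rewrite Fcover.
transitivity (\sum_(i <oo) \int[mu]_(t in `[0%R, p[) f (t + (int_of_nat i)%:~R * p)%R)%E.
  apply: eq_eseriesr => n _.
  have mF : measurable (F n) by exact: measurable_itv.
  have mfF : measurable_fun (F n) f by exact: measurable_funTS.
  rewrite (ge0_integral_shift ((int_of_nat n)%:~R * p) mF mfF)//.
  rewrite (_ : _ @^-1` F n = `[0%R, p[%classic)//.
  by rewrite /F; apply/seteqP; split => t /=; rewrite !in_itv/= [t + _]addrC lerDl ltrD2l.
rewrite -integral_nneseries//; last first.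
  by move=> n; apply: measurable_funTS; exact: mshift.
apply: eq_integral => t _; rewrite nneseries_esumT//.
by rewrite (reindex_esum _ _ _ _ int_of_nat_bij).
Qed.

Lemma measurable_periodization (p : R) (f : R -> \bar R) :
  measurable_fun setT f -> (forall x, (0 <= f x)%E) ->
  measurable_fun setT (fun t : R => \esum_(k in [set: int]) f (t + k%:~R * p)%R)%E.
Proof.
move=> mf f0.
have -> : (fun t : R => \esum_(k in [set: int]) f (t + k%:~R * p)%R)%E =
    (fun t : R => \sum_(i <oo) f (t + (int_of_nat i)%:~R * p)%R)%E.
  apply/funext => t; rewrite nneseries_esumT//.
  by rewrite (reindex_esum _ _ _ _ int_of_nat_bij).
apply: ge0_emeasurable_sum => // n _.
exact: (measurableT_comp mf (measurable_shift _)).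
Qed.

End translation.

(** * Integrals of sine and cosine *)

Section trigonometric_integrals.
Context {R : realType}.
Local Notation mu := (@lebesgue_measure R).

Lemma is_derive_linear_comp (f df : R -> R) (w : R) :
  (forall x : R, is_derive x (1 : R) f (df x)) ->
  forall x : R, is_derive x (1 : R) (fun y => f (w * y)) (w * df (w * x)).
Proof.
move=> fd x.
have dw : is_derive x (1 : R) (fun y : R => w * y) w.
  by apply: is_derive_eq; rewrite !(scaler0, scaler1, addr0, add0r, mulr1)//; exact: mulr1.
apply: is_derive_eq (is_derive1_comp (fd (w * x)) dw) _.
by rewrite mulrC.
Qed.

Lemma integral_derive_itv (f F : R -> R) (a b : R) : a < b -> continuous f ->
  (forall x : R, is_derive x (1 : R) F (f x)) ->
  (\int[mu]_(x in `[a, b[) (f x)%:E = (F b - F a)%:E)%E.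
Proof.
move=> ab cf Ff.
have cF : continuous F.
  by move=> x; apply: differentiable_continuous; apply/derivable1_diffP; case: (Ff x).
rewrite integral_itv_bndo_bndc; last first.
  by apply/measurable_EFinP; apply: measurable_funTS; exact: continuous_measurable_fun.
rewrite (continuous_FTC2 (F := F) ab)//.
- exact: continuous_subspaceT.
- split.
  + by move=> x _; case: (Ff x).
  + by apply: cvg_at_right_filter; exact: cF.
  + by apply: cvg_at_left_filter; exact: cF.
- by move=> x _; rewrite derive1E; case: (Ff x).
Qed.

Lemma integral_cos_itv (w a b : R) : w != 0 -> a < b ->
  (\int[mu]_(x in `[a, b[) (cos (w * x))%:E = ((sin (w * b) - sin (w * a)) / w)%:E)%E.
Proof.
move=> w0 ab.
have cc : continuous (fun x : R => cos (w * x)).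
  move=> x; apply: continuous_comp; last exact: continuous_cos.
  by apply: cvgM; [exact: cvg_cst|exact: cvg_id].
have dF (x : R) : is_derive x (1 : R) (fun y => w^-1 * sin (w * y)) (cos (w * x)).
  have sd := is_derive_linear_comp w (@is_derive_sin R) x.
  by apply: is_derive_eq (is_deriveZ w^-1 sd) _; rewrite /= /GRing.scale/= mulKf.
by rewrite (integral_derive_itv ab cc dF); congr EFin; rewrite [RHS]mulrC mulrBr.
Qed.

Lemma integral_sin_itv (w a b : R) : w != 0 -> a < b ->
  (\int[mu]_(x in `[a, b[) (sin (w * x))%:E = ((cos (w * a) - cos (w * b)) / w)%:E)%E.
Proof.
move=> w0 ab.
have cc : continuous (fun x : R => sin (w * x)).
  move=> x; apply: continuous_comp; last exact: continuous_sin.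
  by apply: cvgM; [exact: cvg_cst|exact: cvg_id].
have dF (x : R) : is_derive x (1 : R) (fun y => - w^-1 * cos (w * y)) (sin (w * x)).
  have sd := is_derive_linear_comp w (@is_derive_cos R) x.
  by apply: is_derive_eq (is_deriveZ (- w^-1) sd) _;
    rewrite /= /GRing.scale/= mulrN mulrNN mulKf.
rewrite (integral_derive_itv ab cc dF); congr EFin.
by rewrite !mulNr opprK [RHS]mulrC addrC mulrBr.
Qed.

End trigonometric_integrals.

(** * Fourier series and Parseval's identity on an interval *)

Section fourier_series.
Context {R : realType}.
Local Notation mu := (@lebesgue_measure R).
Implicit Types (a b : R) (k : int) (f g h H : R -> R[i]).

(** Functions on [[a, b[] are represented by functions on the line vanishing outside, so that a
    single L^2 theory serves everywhere. *)
Definition box a b (x : R) : R[i] := ((\1_(`[a, b[) x)%:C)%C.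

Lemma box_in a b x : a <= x < b -> box a b x = 1.
Proof. by move=> xab; rewrite /box indicE mem_setE in_itv/= xab. Qed.

Lemma box_out a b x : ~ (a <= x < b) -> box a b x = 0.
Proof. by move=> /negP/negbTE xab; rewrite /box indicE mem_setE in_itv/= xab. Qed.

Lemma normc_box_le1 a b x : normc (box a b x) <= 1.
Proof.
by have [/box_in ->|/box_out ->] := pselect (a <= x < b); rewrite ?normc1 ?normc0.
Qed.

Lemma cmeasurable_box a b : cmeasurable (box a b).
Proof. by apply: cmeasurable_real; exact: measurable_indic. Qed.

Lemma Re_cintegral_box a b f : cmeasurable f ->
  complex.Re (cintegral (fun x => box a b x * f x)) =
  \int[mu]_(x in `[a, b[) complex.Re (f x).
Proof.
move=> mf /=; rewrite [RHS]Rintegral_mkcond; apply: eq_Rintegral => x _.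
rewrite patchE mem_setE in_itv/=; have [xab|xab] := boolP (a <= x < b).
  by rewrite box_in// mul1r.
by rewrite box_out ?mul0r//; exact/negP.
Qed.

Lemma Im_cintegral_box a b f : cmeasurable f ->
  complex.Im (cintegral (fun x => box a b x * f x)) =
  \int[mu]_(x in `[a, b[) complex.Im (f x).
Proof.
move=> mf /=; rewrite [RHS]Rintegral_mkcond; apply: eq_Rintegral => x _.
rewrite patchE mem_setE in_itv/=; have [xab|xab] := boolP (a <= x < b).
  by rewrite box_in// mul1r.
by rewrite box_out ?mul0r//; exact/negP.
Qed.

Lemma cintegral_box_osc a b k : a < b ->
  cintegral (fun x => box a b x * osc (k%:~R / (b - a)) x) =
  if k == 0 then ((b - a)%:C)%C else 0.
Proof.
move=> ab; have ba : b - a != 0 by rewrite subr_eq0 gt_eqF.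
have muab : fine (mu `[a, b[) = b - a.
  by rewrite lebesgue_measure_itv/= lte_fin ab -EFinB.
set w := k%:~R / (b - a).
apply: complex_ext; rewrite (Re_cintegral_box, Im_cintegral_box); try exact: cmeasurable_osc;
  have [k0|k0] := eqVneq k 0.
- have -> : w = 0 by rewrite /w k0 mulr0z mul0r.
  under eq_Rintegral do rewrite osc0l.
  by rewrite Rintegral_cst// muab mul1r.
- have w0 : 2 * pi * w != 0.
    by rewrite !mulf_neq0 ?invr_eq0// ?intr_eq0// gt_eqF// pi_gt0.
  rewrite /Rintegral /osc /= (integral_cos_itv w0 ab)/=.
  have -> : 2 * pi * w * b = 2 * pi * w * a + 2 * pi * k%:~R.
    by rewrite /w; field.
  have := expi_2pi_int (R := R) k; rewrite /expi => -[ck sk].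
  by rewrite sinD ck sk mulr1 mulr0 addr0 subrr mul0r.
- have -> : w = 0 by rewrite /w k0 mulr0z mul0r.
  under eq_Rintegral do rewrite osc0l.
  by rewrite Rintegral_cst// mul0r.
- have w0 : 2 * pi * w != 0.
    by rewrite !mulf_neq0 ?invr_eq0// ?intr_eq0// gt_eqF// pi_gt0.
  rewrite /Rintegral /osc /= (integral_sin_itv w0 ab)/=.
  have -> : 2 * pi * w * b = 2 * pi * w * a + 2 * pi * k%:~R.
    by rewrite /w; field.
  have := expi_2pi_int (R := R) k; rewrite /expi => -[ck sk].
  by rewrite cosD ck sk mulr1 mulr0 subr0 subrr mul0r.
Qed.

Lemma L2_box a b : a < b -> L2 (box a b).
Proof.
move=> ab; apply: (L2_dom (g := \1_(`[a, b[))).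
- exact: cmeasurable_box.
- exact: integrable_indic_itv.
- move=> x; have [xab|xab] := pselect (a <= x < b).
    by rewrite box_in// normc1 expr1n indicE mem_setE in_itv/= xab.
  by rewrite box_out// normc0 expr0n.
Qed.

(** The exponentials of period [b - a] cut off to one period: orthogonal, with squared norm
    [b - a]. *)
Definition box_osc a b k (x : R) : R[i] := box a b x * osc (k%:~R / (b - a)) x.

Lemma L2_box_osc a b k : a < b -> L2 (box_osc a b k).
Proof.
move=> ab; apply: (L2M_bounded (C := 1)); first exact: L2_box.
  exact: cmeasurable_osc.
by move=> x; rewrite normc_osc.
Qed.

Lemma dot_box_osc a b j k : a < b ->
  dot (box_osc a b j) (box_osc a b k) = if j == k then ((b - a)%:C)%C else 0.
Proof.
move=> ab; rewrite -subr_eq0 -(cintegral_box_osc _ ab); congr cintegral.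
apply/funext => x; rewrite /box_osc.
have [xab|xab] := pselect (a <= x < b); last by rewrite box_out// !mul0r.
by rewrite box_in// !mul1r conj_osc -oscDl intrB mulrBl.
Qed.

(** Otherwise some [h] orthogonal to all [box_osc] is not orthogonal to [H]. But [box * conjc h] is
    integrable with zero Fourier coefficients, so [h] vanishes almost everywhere on [[a, b[], where
    [H] lives. *)
Lemma box_osc_dense a b H : a < b -> L2 H -> (forall x, ~ (a <= x < b) -> H x = 0) ->
  closed_span setT (box_osc a b) H.
Proof.
move=> ab lH H0; apply: contrapT => nH.
have lb k : L2 (box_osc a b k) by exact: L2_box_osc.
have [h [lh yh /eqP Hh]] := orthogonal_witness lb lH nH.
apply: Hh; have lbh := L2_mul_conj (L2_box ab) lh.
have : {ae mu, forall x, box a b x * conjc (h x) = 0}.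
  apply: (fourier_uniqueness ab lbh).
    by move=> x /box_out ->; rewrite mul0r.
  move=> k; rewrite -[RHS](yh k)//; congr cintegral; apply/funext => x.
  by rewrite /box_osc mulrAC.
move=> bh0; rewrite -cintegral0; apply: ae_eq_cintegral.
- by apply: cintegrable_measurable; exact: L2_mul_conj.
- exact: cmeasurable_cst.
- apply: ae_imp bh0 => x; have [xab|/H0 ->] := pselect (a <= x < b).
    by rewrite box_in// mul1r => ->; rewrite mulr0.
  by rewrite mul0r.
Qed.

Lemma n2_box_osc_sum a b (r : seq int) (c : int -> R[i]) : a < b -> uniq r ->
  n2 (fun x => \sum_(k <- r) c k * box_osc a b k x) =
  (b - a) * \sum_(k <- r) normc (c k) ^+ 2.
Proof.
move=> ab ur; have lb k : L2 (box_osc a b k) by exact: L2_box_osc.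
set T := fun x => _.
have lc k : L2 (fun x => c k * box_osc a b k x) by exact: L2Z.
have lT : L2 T by exact: L2_sum.
apply: (@complexI R); rewrite -dot_id// [in LHS]/T dot_suml// real_complexM.
rewrite real_complex_sum mulr_sumr; apply: eq_big_seq => k kr.
rewrite dotZl// (dotC lT (lb k)) [in LHS]/T dot_suml//.
rewrite (bigD1_seq k)//= big1 ?addr0; last first.
  by move=> j jk; rewrite dotZl// dot_box_osc// (negbTE jk) mulr0.
rewrite dotZl// dot_box_osc// eqxx conjcM conjc_real mulrA mulcJ mulrC.
by [].
Qed.

Lemma dot_box_osc_sum a b (r : seq int) (c : int -> R[i]) H : a < b -> L2 H ->
  dot (fun x => \sum_(k <- r) c k * box_osc a b k x) H =
  \sum_(k <- r) c k * conjc (dot H (box_osc a b k)).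
Proof.
move=> ab lH; have lb k : L2 (box_osc a b k) by exact: L2_box_osc.
rewrite dot_suml//; last by move=> k; exact: L2Z.
by apply: eq_bigr => k _; rewrite dotZl// -dotC.
Qed.

(** Term by term, [L |c|^2 - 2 Re (c conj d) = - |d|^2 / L + L |c - d / L|^2]. Applied to Fourier
    coefficients, this splits the approximation error into the Bessel defect and a sum of
    squares. *)
Lemma complete_square_sum (r : seq int) (c d : int -> R[i]) (L : R) : L != 0 ->
  L * (\sum_(k <- r) normc (c k) ^+ 2) -
    2 * complex.Re (\sum_(k <- r) c k * conjc (d k)) =
  - (L^-1 * \sum_(k <- r) normc (d k) ^+ 2) +
  \sum_(k <- r) L * normc (c k - ((L^-1)%:C)%C * d k) ^+ 2.
Proof.
move=> L0; elim: r => [|k r IHr]; first by rewrite !big_nil /= !mulr0 subrr oppr0 addr0.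
rewrite !big_cons ReD !mulrDr !opprD [LHS]addrACA IHr [RHS]addrACA; congr (_ + _).
by rewrite !sqr_normcE; case: (c k) => c1 c2; case: (d k) => d1 d2 /=; field.
Qed.

Lemma n2_sub_box_osc_sum a b (r : seq int) (c : int -> R[i]) H : a < b -> uniq r ->
  L2 H ->
  n2 (fun x => \sum_(k <- r) c k * box_osc a b k x - H x) =
  n2 H - (b - a)^-1 * (\sum_(k <- r) normc (dot H (box_osc a b k)) ^+ 2)
  + \sum_(k <- r) (b - a) * normc (c k - (((b - a)^-1)%:C)%C * dot H (box_osc a b k)) ^+ 2.
Proof.
move=> ab ur lH; have ba : b - a != 0 by rewrite subr_eq0 gt_eqF.
have lT : L2 (fun x => \sum_(k <- r) c k * box_osc a b k x).
  by apply: L2_sum => k; apply: L2Z; exact: L2_box_osc.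
rewrite n2B// n2_box_osc_sum// dot_box_osc_sum//.
rewrite addrAC [LHS]addrC -[RHS]addrA; congr (_ + _).
exact: (complete_square_sum _ _ (fun k => dot H (box_osc a b k))).
Qed.

(** Choosing [c k = dot H (box_osc k) / (b - a)] annihilates the squares in [n2_sub_box_osc_sum] and
    gives Bessel's inequality. Conversely, the error of any approximant bounds the Bessel defect,
    and it can be made small by density. *)
Lemma parseval a b H : a < b -> L2 H -> (forall x, ~ (a <= x < b) -> H x = 0) ->
  (\esum_(k in [set: int]) (normc (dot H (box_osc a b k)) ^+ 2)%:E =
   ((b - a) * n2 H)%:E)%E.
Proof.
move=> ab lH H0; have ba : 0 < b - a by rewrite subr_gt0.
have lb k : L2 (box_osc a b k) by exact: L2_box_osc.
apply/eqP; rewrite eq_le; apply/andP; split.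
  apply: ge_ereal_sup => _ [X [finX _] <-].
  rewrite fsbig_finite//= sumEFin lee_fin.
  pose r : seq int := finmap.enum_fset (fset_set X).
  have ur : uniq r by exact: finmap.fset_uniq.
  rewrite -/r.
  have := n2_ge0 (fun x => \sum_(k <- r)
    (((b - a)^-1)%:C)%C * dot H (box_osc a b k) * box_osc a b k x - H x).
  rewrite n2_sub_box_osc_sum//.
  rewrite [X in _ + X]big1 ?addr0; last first.
    by move=> k _; rewrite subrr normc0 expr0n mulr0.
  by rewrite subr_ge0 ler_pdivrMl.
have [_ cl] := (closed_spanP setT H lb).1 (box_osc_dense ab lH H0).
apply/lee_addgt0Pr => e e0.
have [g sg ge] := cl (e / (b - a)) (divr_gt0 e0 ba).
have [r [c [ur _ gE]]] := span_uniq sg.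
move: ge; rewrite n2BC gE n2_sub_box_osc_sum// ltr_pdivlMr// => ge.
have s0 : 0 <= \sum_(k <- r) (b - a) *
    normc (c k - (((b - a)^-1)%:C)%C * dot H (box_osc a b k)) ^+ 2.
  by apply: sumr_ge0 => k _; rewrite mulr_ge0 ?sqr_ge0// ltW.
apply: (@le_trans _ _ ((\sum_(k <- r) normc (dot H (box_osc a b k)) ^+ 2) + e)%:E).
  rewrite lee_fin; set S := \sum_(k <- r) normc _ ^+ 2 in ge *.
  set S' := \sum_(k <- r) _ in ge s0.
  have : (n2 H - (b - a)^-1 * S + S') * (b - a) = (b - a) * n2 H - S + S' * (b - a).
    by field; rewrite gt_eqF.
  move=> E; rewrite E in ge; have := mulr_ge0 s0 (ltW ba); lra.
rewrite EFinD leeD2r//.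
apply: (@esum_ge _ _ setT).
exists [set` r]; first by split => //; exact: finite_seq.
rewrite -sumEFin fsbig_seq//.
Qed.

End fourier_series.

(** * Plancherel up to constants *)

Section plancherel.
Context {R : realType}.
Local Notation mu := (@lebesgue_measure R).
Implicit Types (a b : R) (f g h : R -> R[i]).

Lemma Rintegral_eventually (u : nat -> R -> R) (v g : R -> R) :
  (forall n, measurable_fun setT (u n)) -> measurable_fun setT v ->
  mu.-integrable setT (EFin \o g) -> (forall n x, `|u n x| <= g x) ->
  (forall x, \forall n \near \oo, u n x = v x) ->
  \int[mu]_x u n x @[n --> \oo] --> \int[mu]_x v x.
Proof.
move=> mu_ mv ig ug uv.
have mE n : measurable_fun setT (EFin \o u n) by exact/measurable_EFinP.
have mvE : measurable_fun setT (EFin \o v) by exact/measurable_EFinP.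
have cuv : {ae mu, forall x, setT x -> (EFin \o u n) x @[n --> \oo] --> (EFin \o v) x}.
  apply: aeW => x _; apply: cvg_EFin; first exact: nearW.
  by apply: cvg_near_cst; exact: uv.
have dom : {ae mu, forall x n, setT x -> (`|(EFin \o u n) x| <= (EFin \o g) x)%E}.
  by apply: aeW => x n _; rewrite /= lee_fin.
have [iv _] := @dominated_convergence _ _ _ mu setT measurableT
  (fun n => EFin \o u n) (EFin \o v) (EFin \o g) mE mvE cuv ig dom.
by rewrite -[X in _ --> X](fineK (integrable_fin_num measurableT iv)) => /fine_cvg.
Qed.

Lemma fourier_integralE f y :
  fourier_integral f y = cintegral (fun x => f x * osc (- y) x).
Proof.
by congr cintegral; apply/funext => x; congr (_ * expi _); ring.
Qed.

Lemma cintegrable_osc f w : cintegrable f -> cintegrable (fun x => f x * osc w x).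
Proof.
move=> cf; apply: (cintegrableM_bounded (C := 1)) => //; first exact: cmeasurable_osc.
by move=> x; rewrite normc_osc.
Qed.

(** The transform is even continuous, by continuity under the integral sign with the dominating
    function [normc (f x)]. *)
Lemma cmeasurable_fourier f : cintegrable f -> cmeasurable (fourier_integral f).
Proof.
move=> cf; have inf := cintegrable_normc cf.
have cexp (x : R) : continuous (fun y : R => - (2 * pi * x * y)).
  by move=> y; apply: cvgN; apply: cvgM; [exact: cvg_cst|exact: cvg_id].
have ccos (x : R) : continuous (fun y : R => cos (- (2 * pi * x * y))).
  by move=> y; apply: continuous_comp; [exact: cexp|exact: continuous_cos].
have csin (x : R) : continuous (fun y : R => sin (- (2 * pi * x * y))).
  by move=> y; apply: continuous_comp; [exact: cexp|exact: continuous_sin].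
have ci y : cintegrable (fun x => f x * expi (- (2 * pi * x * y))).
  have := cintegrable_osc (- y) cf; congr cintegrable; apply/funext => x.
  by congr (_ * expi _); ring.
have bnd y x : normc (f x * expi (- (2 * pi * x * y))) <= normc (f x).
  by rewrite normcM normc_expi mulr1.
split; apply: continuous_measurable_fun => y.
- apply: (@continuity_under_integral R _ _ mu
    (fun y x => complex.Re (f x * expi (- (2 * pi * x * y)))) setT measurableT
    (y - 1) (y + 1) _ _ (fun x => normc (f x)) inf).
  + by move=> z _; case: (ci z).
  + apply: aeW => x _ z _; under eq_fun do rewrite ReM.
    by apply: cvgB; apply: cvgM; [exact: cvg_cst|exact: ccos|exact: cvg_cst|exact: csin].
  + by move=> z _; apply: aeW => x _; apply: le_trans (bnd z x); exact: ler_Re_normc.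
  + by rewrite inE/= in_itv/=; apply/andP; split; lra.
- apply: (@continuity_under_integral R _ _ mu
    (fun y x => complex.Im (f x * expi (- (2 * pi * x * y)))) setT measurableT
    (y - 1) (y + 1) _ _ (fun x => normc (f x)) inf).
  + by move=> z _; case: (ci z).
  + apply: aeW => x _ z _; under eq_fun do rewrite ImM.
    by apply: cvgD; apply: cvgM; [exact: cvg_cst|exact: csin|exact: cvg_cst|exact: ccos].
  + by move=> z _; apply: aeW => x _; apply: le_trans (bnd z x); exact: ler_Im_normc.
  + by rewrite inE/= in_itv/=; apply/andP; split; lra.
Qed.

(* The values of the transform along [t + k / (b - a)] are the Fourier coefficients
   on [[a, b[] of the modulated function, so Parseval holds for every [t]. *)
Lemma plancherel_box a b f : a < b -> cintegrable f -> L2 f ->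
  (forall x, ~ (a <= x < b) -> f x = 0) -> sqn (fourier_integral f) = sqn f.
Proof.
move=> ab cf lf f0; have ba : 0 < b - a by rewrite subr_gt0.
have mF := cmeasurable_fourier cf.
rewrite /sqn (@integral_periodization _ (b - a)^-1)//; first last.
- by move=> x; rewrite lee_fin sqr_ge0.
- by apply/measurable_EFinP; exact: measurable_sqr_normc.
- by rewrite invr_gt0.
rewrite -/(sqn f) -n2K//.
(* The periodized integrand does not depend on [t]: it is [(b - a) * n2 f] on an interval of length
   [1 / (b - a)]. *)
transitivity (\int[mu]_(t in `[0%R, ((b - a)^-1)%R[) (cst ((b - a) * n2 f)%R%:E t))%E.
  apply: eq_integral => t _; rewrite [RHS]/(cst _ _).
  pose g x := f x * osc (- t) x.
  have lg : L2 g.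
    apply: (L2M_bounded (C := 1)) => //; first exact: cmeasurable_osc.
    by move=> x; rewrite normc_osc.
  have -> : n2 f = n2 g.
    rewrite /n2 /sqn; congr fine; apply: eq_integral => x _.
    by rewrite /g normcM normc_osc mulr1.
  rewrite -(parseval ab lg); last by move=> x /f0; rewrite /g => ->; rewrite mul0r.
  apply: eq_esum => k _.
  rewrite (_ : fourier_integral f _ = dot g (box_osc a b k))//.
  rewrite fourier_integralE /dot; congr cintegral; apply/funext => x.
  have [xab|xab] := pselect (a <= x < b); last by rewrite /g f0// !mul0r.
  by rewrite /g /box_osc box_in// mul1r conj_osc -mulrA -oscDl opprD.
rewrite integral_cst//= lebesgue_measure_itv/= lte_fin invr_gt0 ba -EFinD subr0 -EFinM.
by rewrite mulrAC divff ?mul1r// gt_eqF.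
Qed.

(** The index [n.+1] keeps the interval nonempty, so that [plancherel_box] applies for every [n]. *)
Definition truncation n f (x : R) : R[i] := box (- n.+1%:R) n.+1%:R x * f x.

Lemma truncation_eventually f x : \forall n \near \oo, truncation n f x = f x.
Proof.
have [M MP] : exists M : nat, `|x| < M%:R.
  by exists (Num.truncn `|x|).+1; exact: truncnS_gt.
exists M => // n /= Mn; rewrite /truncation box_in ?mul1r//.
have Mn' : M%:R <= n.+1%:R :> R by rewrite ler_nat leqW.
have := lt_le_trans MP Mn'; rewrite ltr_norml => /andP[x1 x2].
by rewrite x2 ltW.
Qed.

Lemma normc_truncation_le n f x : normc (truncation n f x) <= normc (f x).
Proof.
by rewrite /truncation normcM ler_piMl ?normc_ge0'// normc_box_le1.
Qed.

Lemma cmeasurable_truncation n f : cmeasurable f -> cmeasurable (truncation n f).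
Proof. by move=> mf; apply: cmeasurableM => //; exact: cmeasurable_box. Qed.

Lemma cintegrable_truncation n f : cintegrable f -> cintegrable (truncation n f).
Proof.
move=> cf; apply: (le_cintegrable (g := fun x => normc (f x))).
- by apply: cmeasurable_truncation; exact: cintegrable_measurable.
- exact: cintegrable_normc.
- by move=> x; exact: normc_truncation_le.
Qed.

Lemma L2_truncation n f : L2 f -> L2 (truncation n f).
Proof.
move=> lf; apply: (L2_dom (g := fun x => normc (f x) ^+ 2)).
- by apply: cmeasurable_truncation; case: lf.
- exact: L2_integrable.
- by move=> x; rewrite ler_pXn2r ?nnegrE ?normc_ge0'// normc_truncation_le.
Qed.

Lemma n2_truncation_cvg f : L2 f ->
  n2 (fun x => f x - truncation n f x) @[n --> \oo] --> 0.
Proof.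
move=> lf.
have : \int[mu]_x (normc (f x - truncation n f x) ^+ 2) @[n --> \oo] --> \int[mu]_x (0 : R).
  apply: (@Rintegral_eventually _ _ (fun x => 4 * normc (f x) ^+ 2)).
  - by move=> n; apply: measurable_sqr_normc; case: (L2B lf (L2_truncation n lf)).
  - exact: measurable_cst.
  - exact/integrableZlR/L2_integrable.
  - move=> n x; rewrite ger0_norm ?sqr_ge0//.
    apply: le_trans (sqr_normcD_le _ _) _; rewrite normcN.
    have : normc (truncation n f x) ^+ 2 <= normc (f x) ^+ 2.
      by rewrite ler_pXn2r ?nnegrE ?normc_ge0'// normc_truncation_le.
    lra.
  - move=> x; apply: filterS (truncation_eventually f x) => n ->.
    by rewrite subrr normc0 expr0n.
by rewrite Rintegral_cst// mul0r.
Qed.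

Lemma fourier_truncation_cvg f y : cintegrable f ->
  complex.Re (fourier_integral (truncation n f) y) @[n --> \oo] -->
    complex.Re (fourier_integral f y) /\
  complex.Im (fourier_integral (truncation n f) y) @[n --> \oo] -->
    complex.Im (fourier_integral f y).
Proof.
move=> cf.
have co g : cintegrable g -> cintegrable (fun x => g x * expi (- (2 * pi * x * y))).
  move=> cg; have := cintegrable_osc (- y) cg; congr cintegrable; apply/funext => x.
  by congr (_ * expi _); ring.
have ct n := cintegrable_truncation n cf.
have bnd n x : normc (truncation n f x * expi (- (2 * pi * x * y))) <= normc (f x).
  by rewrite normcM normc_expi mulr1 normc_truncation_le.
split; rewrite /fourier_integral/=.
- apply: (@Rintegral_eventually _ _ (fun x => normc (f x))).
  + by move=> n; case: (cintegrable_measurable (co _ (ct n))).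
  + by case: (cintegrable_measurable (co _ cf)).
  + exact: cintegrable_normc.
  + by move=> n x; apply: le_trans (bnd n x); exact: ler_Re_normc.
  + by move=> x; apply: filterS (truncation_eventually f x) => n ->.
- apply: (@Rintegral_eventually _ _ (fun x => normc (f x))).
  + by move=> n; case: (cintegrable_measurable (co _ (ct n))).
  + by case: (cintegrable_measurable (co _ cf)).
  + exact: cintegrable_normc.
  + by move=> n x; apply: le_trans (bnd n x); exact: ler_Im_normc.
  + by move=> x; apply: filterS (truncation_eventually f x) => n ->.
Qed.

Lemma plancherel_truncation n f : cintegrable f -> L2 f ->
  sqn (fourier_integral (truncation n f)) = sqn (truncation n f).
Proof.
move=> cf lf; apply: (@plancherel_box (- n.+1%:R) n.+1%:R).
- by rewrite (@lt_trans _ _ 0)// ?oppr_lt0 ltr0n.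
- exact: cintegrable_truncation.
- exact: L2_truncation.
- by move=> x /box_out; rewrite /truncation => ->; rewrite mul0r.
Qed.

(** Plancherel is exact on truncations, whose transforms converge pointwise; Fatou's lemma passes to
    the limit and yields one inequality only. *)
Lemma sqn_fourier_le f : cintegrable f -> L2 f ->
  (sqn (fourier_integral f) <= sqn f)%E.
Proof.
move=> cf lf.
apply: (@sqn_fatou _ (fun n => fourier_integral (truncation n f))).
- by move=> n; apply: cmeasurable_fourier; exact: cintegrable_truncation.
- by move=> y; case: (fourier_truncation_cvg y cf).
- by move=> y; case: (fourier_truncation_cvg y cf).
- move=> n; rewrite plancherel_truncation// -[leRHS]mul1e; apply: le_sqn => //.
  + by case: (L2_truncation n lf).
  + by case: lf.
  + by move=> x; rewrite mul1r ler_pXn2r ?nnegrE ?normc_ge0'// normc_truncation_le.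
Qed.

Lemma L2_fourier f : cintegrable f -> L2 f -> L2 (fourier_integral f).
Proof.
move=> cf lf; split; first exact: cmeasurable_fourier.
by apply: le_lt_trans (sqn_fourier_le cf lf) _; case: lf.
Qed.

Lemma n2_fourier_le f : cintegrable f -> L2 f -> n2 (fourier_integral f) <= n2 f.
Proof.
move=> cf lf; rewrite -lee_fin (n2K lf) (n2K (L2_fourier cf lf)).
exact: sqn_fourier_le.
Qed.

Lemma fourier_integralB f g y : cintegrable f -> cintegrable g ->
  fourier_integral (fun x => f x - g x) y = fourier_integral f y - fourier_integral g y.
Proof.
move=> cf cg; rewrite !fourier_integralE.
have -> : - cintegral (fun x => g x * osc (- y) x) =
    cintegral (fun x => -1 * (g x * osc (- y) x)).
  by rewrite cintegralZ ?mulN1r//; exact: cintegrable_osc.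
rewrite -cintegralD; first last.
- by apply: cintegrableZ; exact: cintegrable_osc.
- exact: cintegrable_osc.
by congr cintegral; apply/funext => x; rewrite mulN1r mulrBl.
Qed.

(** Compare [f] with a truncation at squared distance below [e], use the exact identity there, and
    return. Each comparison costs a factor 2, whence [4]; the errors add up to [2 * e + 4 * e]. *)
Lemma n2_le_fourier f : cintegrable f -> L2 f -> n2 f <= 4 * n2 (fourier_integral f).
Proof.
move=> cf lf; rewrite -subr_le0; apply: (@small_le0 _ _ 6) => e e0.
have /cvgrPdist_lt/(_ e e0)[N _ /(_ N (leqnn N))/=] := n2_truncation_cvg lf.
rewrite sub0r normrN ger0_norm ?n2_ge0// => fN.
have lt := L2_truncation N lf; have ct := cintegrable_truncation N cf.
have lB := L2B lf lt.
have cB : cintegrable (fun x => f x - truncation N f x).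
  apply: cintegrableD => //; under eq_fun do rewrite -mulN1r; exact: cintegrableZ.
have lF := L2_fourier cf lf; have lFt := L2_fourier ct lt.
have h1 : n2 (truncation N f) = n2 (fourier_integral (truncation N f)).
  by rewrite /n2 plancherel_truncation.
have h2 : n2 f <= 2 * n2 (fun x => f x - truncation N f x) + 2 * n2 (truncation N f).
  have := n2D_le lB lt; rewrite (_ : (fun x => _ + _) = f)//.
  by apply/funext => x; rewrite subrK.
have h3 : n2 (fourier_integral (truncation N f)) <=
    2 * n2 (fourier_integral (fun x => f x - truncation N f x)) + 2 * n2 (fourier_integral f).
  have -> : fourier_integral (fun x => f x - truncation N f x) =
      (fun y => fourier_integral f y - fourier_integral (truncation N f) y).
    by apply/funext => y; rewrite fourier_integralB.
  rewrite n2BC; have := n2D_le (L2B lFt lF) lF.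
  rewrite (_ : (fun x => _ + _) = fourier_integral (truncation N f))//.
  by apply/funext => x; rewrite subrK.
have h4 := n2_fourier_le cB lB.
clear cf lf lt ct lB cB lF lFt.
move: (n2 f) (n2 (truncation N f)) (n2 (fun x => f x - truncation N f x))
  (n2 (fourier_integral f)) (n2 (fourier_integral (truncation N f)))
  (n2 (fourier_integral (fun x => f x - truncation N f x))) fN h1 h2 h3 h4 => *.
lra.
Qed.

End plancherel.

(** * Integer translates on the Fourier side *)

Section shift_model.
Context {R : realType}.
Local Notation mu := (@lebesgue_measure R).
Implicit Types (f g u phi : R -> R[i]) (r : seq int) (c : int -> R[i]).

Definition trig r c (t : R) : R[i] := \sum_(k <- r) c k * osc k%:~R t.

Definition shift_sum r c u (x : R) : R[i] := \sum_(k <- r) c k * translate u k x.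

Lemma cmeasurable_trig r c : cmeasurable (trig r c).
Proof.
apply: cmeasurable_sum => k; apply: cmeasurableM; first exact: cmeasurable_cst.
exact: cmeasurable_osc.
Qed.

Lemma trig_bounded r c : exists C, forall t, normc (trig r c t) <= C.
Proof.
exists (\sum_(k <- r) normc (c k)) => t; rewrite /trig.
elim: r => [|k r IHr]; first by rewrite !big_nil normc0.
rewrite !big_cons (le_trans (le_normcD _ _))// lerD//.
by rewrite normcM normc_osc mulr1.
Qed.

Lemma trig_periodic r c t (m : int) : trig r c (t + m%:~R) = trig r c t.
Proof. by apply: eq_bigr => k _; rewrite osc_periodic. Qed.

Lemma cmeasurable_translate u k : cmeasurable u -> cmeasurable (translate u k).
Proof. exact: cmeasurable_shift. Qed.

Lemma L2_translate u k : L2 u -> L2 (translate u k).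
Proof.
move=> [mu_ su]; split; first exact: cmeasurable_translate.
by rewrite /translate sqn_shift.
Qed.

Lemma n2_translate u k : L2 u -> n2 (translate u k) = n2 u.
Proof. by move=> [mu_ _]; rewrite /n2 /translate sqn_shift. Qed.

Lemma cintegrable_translate u k : cintegrable u -> cintegrable (translate u k).
Proof.
move=> /cintegrableP[mu_ su]; apply/cintegrableP; split.
  exact: cmeasurable_translate.
have := @ge0_integral_shift R k%:~R setT (fun x => (normc (u x))%:E) measurableT.
rewrite preimage_setT => <-//.
- by apply/measurable_EFinP; exact: measurable_normc.
- by move=> x _; rewrite lee_fin normc_ge0'.
Qed.

Lemma fourier_translate u k y : cintegrable u ->
  fourier_integral (translate u k) y = osc k%:~R y * fourier_integral u y.
Proof.
move=> cu; rewrite !fourier_integralE -cintegralZ; last exact: cintegrable_osc.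
rewrite -[RHS](cintegral_shift k%:~R); last first.
  by apply: cintegrable_measurable; apply: cintegrableZ; exact: cintegrable_osc.
congr cintegral; apply/funext => x; rewrite /translate oscD mulrCA; congr (_ * _).
rewrite mulrCA -[LHS]mulr1; congr (_ * _).
by rewrite /osc -expiD -[LHS]expi0; congr expi; ring.
Qed.

Lemma cintegrable_shift_sum r c u : cintegrable u -> cintegrable (shift_sum r c u).
Proof.
by move=> cu; apply: cintegrable_sum => k; apply: cintegrableZ; exact: cintegrable_translate.
Qed.

Lemma L2_shift_sum r c u : L2 u -> L2 (shift_sum r c u).
Proof. by move=> lu; apply: L2_sum => k; apply: L2Z; exact: L2_translate. Qed.

Lemma fourier_shift_sum r c u y : cintegrable u ->
  fourier_integral (shift_sum r c u) y = trig r c y * fourier_integral u y.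
Proof.
move=> cu; have ct k := cintegrable_translate k cu.
transitivity (\sum_(k <- r) cintegral (fun x => c k * (translate u k x * osc (- y) x))).
  rewrite fourier_integralE -cintegral_sum; last first.
    by move=> k; apply: cintegrableZ; exact: cintegrable_osc.
  by congr cintegral; apply/funext => x; rewrite mulr_suml; apply: eq_bigr => k _; rewrite mulrA.
rewrite mulr_suml; apply: eq_bigr => k _; rewrite cintegralZ; last exact: cintegrable_osc.
by rewrite -fourier_integralE fourier_translate// mulrA.
Qed.

(** The constant depends on the coefficients but not on [u], so a fixed combination of translates
    passes to L^2 limits in [u]. *)
Lemma n2_shift_sum_bounded r c : exists2 C, 0 <= C &
  forall u, L2 u -> n2 (shift_sum r c u) <= C * n2 u.
Proof.
rewrite /shift_sum; elim: r => [|k r [C C0 CP]].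
  exists 0 => // u lu; rewrite mul0r.
  by under eq_fun do rewrite big_nil; rewrite /n2 /sqn normc0 expr0n integral0.
exists (2 * normc (c k) ^+ 2 + 2 * C).
  by rewrite addr_ge0// mulr_ge0// sqr_ge0.
move=> u lu; under eq_fun do rewrite big_cons.
have lt := L2_translate k lu.
apply: le_trans (n2D_le (L2Z (c k) lt) (L2_shift_sum r c lu)) _.
rewrite n2Z// n2_translate// [leRHS]mulrDl; apply: lerD; first by rewrite mulrA.
by rewrite -[leRHS]mulrA ler_pM2l//; exact: CP.
Qed.

Lemma shift_sumB r c u v x :
  shift_sum r c (fun x => u x - v x) x = shift_sum r c u x - shift_sum r c v x.
Proof.
by rewrite -sumrB; apply: eq_bigr => k _; rewrite /translate mulrBr.
Qed.

Lemma n2M_bounded f g C : L2 f -> cmeasurable g -> (forall x, normc (g x) <= C) ->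
  n2 (fun x => g x * f x) <= C ^+ 2 * n2 f.
Proof.
move=> lf mg gC; have C0 : 0 <= C by rewrite (le_trans (normc_ge0' (g 0))).
have lgf : L2 (fun x => g x * f x).
  by under eq_fun do rewrite mulrC; exact: L2M_bounded gC.
rewrite -lee_fin EFinM (n2K lgf) (n2K lf); apply: le_sqn => //.
- exact: sqr_ge0.
- by case: lgf.
- by case: lf.
- by move=> x; rewrite normcM exprMn ler_wpM2r ?sqr_ge0// ler_pXn2r ?nnegrE ?normc_ge0'.
Qed.

Lemma L2_trigM r c f : L2 f -> L2 (fun x => trig r c x * f x).
Proof.
move=> lf; have [C CP] := trig_bounded r c; under eq_fun do rewrite mulrC.
by apply: (L2M_bounded lf _ CP); exact: cmeasurable_trig.
Qed.

Lemma cLnorm2_cvg0 (v : nat -> R -> R[i]) : (forall n, L2 (v n)) ->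
  cLnorm 2%:E (v n) @[n --> \oo] --> 0%E -> n2 (v n) @[n --> \oo] --> 0.
Proof.
move=> lv /fine_cvg; rewrite (_ : fine \o _ = (fun n => Num.sqrt (n2 (v n)))); last first.
  by apply/funext => n /=; rewrite cLnorm2_sqrt.
move=> sv.
rewrite (_ : (fun n => n2 (v n)) = (fun n => Num.sqrt (n2 (v n)) * Num.sqrt (n2 (v n)))).
  by rewrite -[X in _ --> X](mulr0 (0 : R)); exact: cvgM.
by apply/funext => n /=; rewrite -expr2 sqr_sqrtr// n2_ge0.
Qed.

(* Only the equivalence of the two norms is needed below, hence the crude constants. *)
Lemma n2_shift_sum_fourier phi phihat r c : is_fourier_transform phi phihat ->
  n2 (shift_sum r c phi) <= 16 * n2 (fun y => trig r c y * phihat y) /\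
  n2 (fun y => trig r c y * phihat y) <= 4 * n2 (shift_sum r c phi).
Proof.
move=> [/cLp2E lp /cLp2E lh [u [uL up uh]]].
have cu n : cintegrable (u n) by apply/cLp1E; case: (uL n).
have lu n : L2 (u n) by apply/cLp2E; case: (uL n).
have lF n : L2 (fourier_integral (u n)) by exact: L2_fourier.
have {}up : n2 (fun x => u n x - phi x) @[n --> \oo] --> 0.
  by apply: (cLnorm2_cvg0 (v := fun n x => u n x - phi x)) up => n; exact: L2B.
have {}uh : n2 (fun x => fourier_integral (u n) x - phihat x) @[n --> \oo] --> 0.
  by apply: (cLnorm2_cvg0 (v := fun n x => fourier_integral (u n) x - phihat x)) uh => n;
    exact: L2B.
have [C C0 CP] := n2_shift_sum_bounded r c.
have [D DP] := trig_bounded r c.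
have lA := L2_shift_sum r c lp; have lB := L2_trigM r c lh.
have key (e : R) : 0 < e -> exists n,
    n2 (fun x => shift_sum r c (u n) x - shift_sum r c phi x) <= C * e /\
    n2 (fun y => trig r c y * fourier_integral (u n) y - trig r c y * phihat y)
      <= D ^+ 2 * e.
  move=> e0.
  have /cvgrPdist_lt/(_ e e0)[N _ NP] := up; have /cvgrPdist_lt/(_ e e0)[M _ MP] := uh.
  exists (maxn N M); set n := maxn N M; split.
    have := NP n (leq_maxl _ _); rewrite /= sub0r normrN ger0_norm ?n2_ge0// => /ltW un.
    under eq_fun do rewrite -shift_sumB.
    by apply: le_trans (CP _ (L2B (lu n) lp)) _; rewrite ler_wpM2l.
  have := MP n (leq_maxr _ _); rewrite /= sub0r normrN ger0_norm ?n2_ge0// => /ltW un.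
  under eq_fun do rewrite -mulrBr.
  apply: le_trans (n2M_bounded (L2B (lF n) lh) (cmeasurable_trig r c) DP) _.
  by rewrite ler_wpM2l// sqr_ge0.
have fE n : fourier_integral (shift_sum r c (u n)) =
    (fun y => trig r c y * fourier_integral (u n) y).
  by apply/funext => y; rewrite fourier_shift_sum.
have tri (f g : R -> R[i]) : L2 f -> L2 g -> n2 g <= 2 * n2 (fun x => f x - g x) + 2 * n2 f.
  move=> lf lg; have := n2D_le (L2B lg lf) lf; rewrite n2BC.
  by rewrite (_ : (fun x => _ + _) = g)//; apply/funext => x; rewrite subrK.
split; rewrite -subr_le0.
  (* [16 = 2 * 4 * 2]: a factor 2 for each replacement of [phi] or [phihat] by its approximant, and
     4 from [n2_le_fourier]. *)
  apply: (@small_le0 _ _ (2 * C + 16 * D ^+ 2)) => e e0; have [n [n1 n2e]] := key e e0.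
  have lS := L2_shift_sum r c (lu n); have cS := cintegrable_shift_sum r c (cu n).
  have lBn := L2_trigM r c (lF n).
  have h1 := tri _ _ lS lA.
  have h2 := n2_le_fourier cS lS; rewrite fE in h2.
  have h3 := tri _ _ lB lBn; rewrite n2BC in h3.
  clear - n1 n2e h1 h2 h3.
  move: (n2 (shift_sum r c phi)) (n2 (shift_sum r c (u n)))
    (n2 (fun x => shift_sum r c (u n) x - shift_sum r c phi x))
    (n2 (fun y => trig r c y * phihat y))
    (n2 (fun y => trig r c y * fourier_integral (u n) y))
    (n2 (fun y => trig r c y * fourier_integral (u n) y - trig r c y * phihat y))
    (D ^+ 2) n1 n2e h1 h2 h3 => x1 x2 x3 x4 x5 x6 DD *.
  nra.
(* Here [4 = 2 * 2], since [n2_fourier_le] has constant 1. *)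
apply: (@small_le0 _ _ (4 * C + 2 * D ^+ 2)) => e e0; have [n [n1 n2e]] := key e e0.
have lS := L2_shift_sum r c (lu n); have cS := cintegrable_shift_sum r c (cu n).
have lBn := L2_trigM r c (lF n).
have h1 := tri _ _ lA lS; rewrite n2BC in h1.
have h2 := n2_fourier_le cS lS; rewrite fE in h2.
have h3 := tri _ _ lBn lB.
clear - n1 n2e h1 h2 h3.
move: (n2 (shift_sum r c phi)) (n2 (shift_sum r c (u n)))
  (n2 (fun x => shift_sum r c (u n) x - shift_sum r c phi x))
  (n2 (fun y => trig r c y * phihat y))
  (n2 (fun y => trig r c y * fourier_integral (u n) y))
  (n2 (fun y => trig r c y * fourier_integral (u n) y - trig r c y * phihat y))
  (D ^+ 2) n1 n2e h1 h2 h3 => x1 x2 x3 x4 x5 x6 DD *.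
nra.
Qed.

End shift_model.

(** * The weight [Phi] and its square root on [[0, 1[] *)

Section weight.
Context {R : realType}.
Local Notation mu := (@lebesgue_measure R).
Variable phihat : R -> R[i].
Hypothesis lh : L2 phihat.
Local Notation Phi := (periodization phihat).

Lemma periodization_ge0 t : (0 <= Phi t)%E.
Proof. by apply: esum_ge0 => k _; rewrite lee_fin sqr_ge0. Qed.

Lemma periodizationE : Phi =
  (fun t => \esum_(k in [set: int]) (normc (phihat (t + k%:~R * 1)) ^+ 2)%:E)%E.
Proof. by apply/funext => t; apply: eq_esum => k _; rewrite mulr1. Qed.

Let mh : measurable_fun setT (fun x => (normc (phihat x) ^+ 2)%:E).
Proof. by apply/measurable_EFinP; apply: measurable_sqr_normc; case: lh. Qed.

Lemma measurable_Phi : measurable_fun setT Phi.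
Proof.
rewrite periodizationE.
apply: (@measurable_periodization _ 1 (fun x => (normc (phihat x) ^+ 2)%:E)) => // x.
by rewrite lee_fin sqr_ge0.
Qed.

Lemma periodization_periodic t (m : int) : Phi (t + m%:~R) = Phi t.
Proof.
rewrite /periodization [RHS](reindex_esum setT setT (fun k : int => m + k)).
  by apply: eq_esum => k _; rewrite intrD addrA.
split; [by []|by move=> k l _ _ /addrI|].
by move=> k _; exists (k - m) => //; rewrite addrC subrK.
Qed.

Lemma esumZl (a : int -> \bar R) (x : R) : 0 <= x -> (forall k, (0 <= a k)%E) ->
  (\esum_(k in [set: int]) (x%:E * a k) = x%:E * \esum_(k in [set: int]) a k)%E.
Proof.
move=> x0 a0; rewrite !(reindex_esum _ _ _ _ int_of_nat_bij) -!nneseries_esumT//.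
  by rewrite nneseriesZl.
by move=> n; rewrite mule_ge0.
Qed.

(** A trigonometric polynomial with integer frequencies is 1-periodic and factors out of the
    periodized sum. *)
Lemma sqn_trig_Phi r c : sqn (fun y => trig r c y * phihat y) =
  (\int[mu]_(t in `[0%R, 1%R[) ((normc (trig r c t) ^+ 2)%:E * Phi t))%E.
Proof.
rewrite /sqn (@integral_periodization _ 1)//; first last.
- by move=> x; rewrite lee_fin sqr_ge0.
- apply/measurable_EFinP; apply: measurable_sqr_normc.
  by apply: cmeasurableM; [exact: cmeasurable_trig|case: lh].
apply: eq_integral => t _; rewrite periodizationE -esumZl.
- apply: eq_esum => k _; rewrite mulr1 trig_periodic normcM exprMn EFinM//.
- exact: sqr_ge0.
- by move=> k; rewrite lee_fin sqr_ge0.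
Qed.

Lemma integral_Phi : (\int[mu]_(t in `[0%R, 1%R[) Phi t = sqn phihat)%E.
Proof.
rewrite periodizationE /sqn [RHS](@integral_periodization _ 1)// => x.
by rewrite lee_fin sqr_ge0.
Qed.

Lemma Phi_fin_ae : {ae mu, forall t, 0 <= t < 1 -> Phi t \is a fin_num}.
Proof.
have iPhi : mu.-integrable `[0%R, 1%R[ Phi.
  apply/integrableP; split; first by apply: measurable_funTS; exact: measurable_Phi.
  under eq_integral do rewrite gee0_abs ?periodization_ge0//.
  by rewrite integral_Phi; case: lh.
have := @integrable_ae _ _ _ mu _ (measurable_itv _) _ iPhi; apply: ae_imp => t /= H t01; apply: H.
by rewrite in_itv.
Qed.

(** The square root of [Phi] on one period. [fine] gives 0 where [Phi = +oo], which is a null set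
    because [Phi] is integrable over the period. *)
Definition psi (t : R) : R[i] := box 0 1 t * ((Num.sqrt (fine (Phi t)))%:C)%C.

Lemma measurable_sqrt_Phi : measurable_fun setT (fun t => Num.sqrt (fine (Phi t))).
Proof.
rewrite -[X in measurable_fun _ X]/(Num.sqrt \o (fine \o Phi)).
apply: measurableT_comp.
  by apply: continuous_measurable_fun; exact: sqrt_continuous.
by apply: measurableT_comp; [exact: fine_measurable|exact: measurable_Phi].
Qed.

Lemma cmeasurable_psi : cmeasurable psi.
Proof.
apply: cmeasurableM; first exact: cmeasurable_box.
by apply: cmeasurable_real; exact: measurable_sqrt_Phi.
Qed.

Lemma sqr_normc_psi t : 0 <= t < 1 -> normc (psi t) ^+ 2 = fine (Phi t).
Proof.
move=> t01; rewrite /psi box_in// mul1r normc_real real_normK ?num_real//.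
by rewrite sqr_sqrtr// fine_ge0// periodization_ge0.
Qed.

Lemma psi_out t : ~ (0 <= t < 1) -> psi t = 0.
Proof. by move=> t01; rewrite /psi box_out// mul0r. Qed.

Lemma sqn_itv01 (f : R -> R[i]) : (forall t, ~ (0 <= t < 1) -> f t = 0) ->
  sqn f = (\int[mu]_(t in `[0%R, 1%R[) (normc (f t) ^+ 2)%:E)%E.
Proof.
move=> f0; rewrite [RHS]integral_mkcond; apply: eq_integral => t _.
rewrite patchE mem_setE in_itv/=; case: ifPn => // /negP t01.
by rewrite f0// normc0 expr0n.
Qed.

Lemma sqn_trig_psi r c : sqn (fun t => trig r c t * psi t) =
  sqn (fun y => trig r c y * phihat y).
Proof.
rewrite sqn_trig_Phi sqn_itv01; last by move=> t /psi_out ->; rewrite mulr0.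
have mtp : cmeasurable (fun t => trig r c t * psi t).
  by apply: cmeasurableM; [exact: cmeasurable_trig|exact: cmeasurable_psi].
apply: ae_eq_integral => //.
- by apply: measurable_funTS; apply/measurable_EFinP; exact: measurable_sqr_normc.
- apply: measurable_funTS; apply: emeasurable_funM; last exact: measurable_Phi.
  by apply/measurable_EFinP; apply: measurable_sqr_normc; exact: cmeasurable_trig.
- apply: ae_imp Phi_fin_ae => t H /=; rewrite in_itv/= => t01.
  by rewrite normcM exprMn sqr_normc_psi// EFinM fineK// H.
Qed.

Lemma L2_trig_psi r c : L2 (fun t => trig r c t * psi t).
Proof.
split; first by apply: cmeasurableM; [exact: cmeasurable_trig|exact: cmeasurable_psi].
by rewrite sqn_trig_psi; case: (L2_trigM r c lh).
Qed.

Lemma n2_trig_psi r c : n2 (fun t => trig r c t * psi t) =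
  n2 (fun y => trig r c y * phihat y).
Proof. by rewrite /n2 sqn_trig_psi. Qed.

(** Inversion reverses the order of [[0, +oo]]: for [y > 0] the set where [w^-1 >= y] is the set
    where [w <= y^-1]. *)
Lemma measurable_inve (w : R -> \bar R) : measurable_fun setT w ->
  (forall t, (0 <= w t)%E) -> measurable_fun setT (fun t => (w t)^-1)%E.
Proof.
move=> mw w0; apply: (measurability _ (ErealGenCInfty.measurableE R)) => //.
move=> _ [_ [y ->] <-]; rewrite setTI.
have [y0|y0] := lerP y 0.
  rewrite (_ : _ @^-1` _ = setT)//; apply/seteqP; split => // t _ /=.
  rewrite in_itv/= andbT (@le_trans _ _ 0%E)// ?lee_fin//.
  by rewrite inve_ge0.
rewrite (_ : _ @^-1` _ = setT `&` [set t | (w t <= y^-1%:E)%E]).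
  exact: emeasurable_fun_infty_c.
apply/seteqP; split => t /=; rewrite in_itv/= andbT.
  move=> yw; split => //; rewrite -(inveK (w t)) -[leRHS](_ : y%:E^-1 = _)%E.
    by rewrite lee_pV2// ?inE ?inve_ge0// lee_fin ltW.
  by rewrite inver gt_eqF.
move=> [_ wy]; rewrite -(inveK y%:E) lee_pV2 ?inE ?inve_ge0 ?lee_fin ?(ltW y0)//.
by rewrite inver gt_eqF.
Qed.

Lemma measurable_invPhi : measurable_fun setT (fun t => (Phi t)^-1)%E.
Proof.
by apply: measurable_inve; [exact: measurable_Phi|exact: periodization_ge0].
Qed.

End weight.

(** * Chords of the circle and local bounds for polynomials *)

Section chords.
Context {R : realType}.
Implicit Types (s t x : R) (q : {poly R[i]}).

Lemma sin_MVT x : 0 < x -> exists2 y, 0 < y < x & sin x = cos y * x.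
Proof.
move=> x0.
have ds (z : R) : z \in `]0, x[ -> is_derive z (1 : R) sin (cos z) by move=> _; exact: is_derive_sin.
have cs : {within `[0, x], continuous (@sin R)}.
  by apply: continuous_subspaceT; exact: continuous_sin.
have [y] := MVT x0 ds cs.
by rewrite in_itv/= => y0x; rewrite sin0 !subr0 => E; exists y.
Qed.

Lemma norm_sin_le x : `|sin x| <= `|x|.
Proof.
have key y : 0 < y -> `|sin y| <= y :> R.
  move=> y0; have [z _ ->] := sin_MVT y0.
  by rewrite normrM (gtr0_norm y0) ler_piMl ?(ltW y0)// cos_max.
have [x0|x0|->] := ltgtP x 0; last by rewrite sin0.
  by rewrite (ltr0_norm x0) -normrN -sinN key ?oppr_gt0.
by rewrite (gtr0_norm x0) key.
Qed.

(** [sin y = cos z * y] for some [0 < z < y <= 1], and [cos] decreases there. Only the positivity of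
    [cos 1] matters later. *)
Lemma norm_sin_ge x : `|x| <= 1 -> cos 1 * `|x| <= `|sin x|.
Proof.
have key y : 0 < y -> y <= 1 -> cos 1 * y <= `|sin y| :> R.
  move=> y0 y1; have [z /andP[z0 zy] ->] := sin_MVT y0.
  rewrite normrM (gtr0_norm y0) ler_pM2r// (le_trans _ (ler_norm _))//.
  have pi2 := @pi_ge2 R.
  by apply: cos_le_cos; apply/andP; split; lra.
have [x0|x0|->] := ltgtP x 0; last by rewrite sin0 normr0 mulr0.
  by rewrite (ltr0_norm x0) -[`|sin x|]normrN -sinN => ?; apply: key; rewrite ?oppr_gt0.
by rewrite (gtr0_norm x0) => ?; exact: key.
Qed.

Lemma normc_oscB t x : normc (osc 1 t - osc 1 x) = 2 * `|sin (pi * (t - x))|.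
Proof.
apply/eqP; rewrite -(@eqrXn2 _ 2)// ?normc_ge0' ?mulr_ge0//; apply/eqP.
have -> : osc 1 t - osc 1 x = - (osc 1 x * (1 - osc 1 (t - x))).
  by rewrite mulrBr mulr1 -oscD (addrC x) subrK opprB.
rewrite normcN normcM normc_osc mul1r /osc sqr_normc_1B_expi.
rewrite exprMn real_normK ?num_real//.
have -> : 2 * pi * 1 * (t - x) = (pi * (t - x)) *+ 2 by rewrite mulr1 -mulrA mulr_natl.
rewrite cos_mulr2n cos2sin2 -mulr_natl; ring.
Qed.

Lemma chord_upper t x : normc (osc 1 t - osc 1 x) <= 2 * pi * `|t - x|.
Proof.
rewrite normc_oscB -mulrA ler_pM2l// (le_trans (norm_sin_le _))//.
by rewrite normrM (ger0_norm (pi_ge0 R)).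
Qed.

(** As [pi < 4], the hypothesis gives [pi * |t - x| <= 1], the range of the lower bound for
    [sin]. *)
Lemma chord_lower t x : `|t - x| <= 4^-1 ->
  2 * pi * cos 1 * `|t - x| <= normc (osc 1 t - osc 1 x).
Proof.
move=> tx; have pi0 := @pi_gt0 R; have := @pihalf_lt2 R.
rewrite ltr_pdivrMr// => pi4.
have nE : `|pi * (t - x)| = pi * `|t - x| by rewrite normrM (gtr0_norm pi0).
have := @norm_sin_ge (pi * (t - x)); rewrite nE normc_oscB => H.
have : pi * `|t - x| <= 1.
  rewrite (@le_trans _ _ (pi * 4^-1))//; first by rewrite ler_pM2l.
  by rewrite ler_pdivrMr// mul1r ltW// (lt_le_trans pi4)// -natrM.
by move=> /H; lra.
Qed.

Lemma osc1_eq1 s : osc 1 s = 1 -> exists m : int, s = m%:~R.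
Proof.
move=> s1; exists (Num.floor s); pose d := s - (Num.floor s)%:~R.
have d0 : 0 <= d by rewrite subr_ge0 floor_le_tmp.
have d1 : d < 1 by rewrite ltrBlDr addrC -[X in _ + X]/(1%:~R) -intrD floorD1_gt.
have oscd : osc 1 d = 1.
  rewrite -[RHS]s1 -[in RHS](subrK (Num.floor s)%:~R s) -/d.
  by rewrite -[X in osc X (d + _)]/(1%:~R) osc_periodic.
suff : d = 0 by move/eqP; rewrite subr_eq0 => /eqP.
apply/eqP; apply: contraT => dn0.
have pi0 := @pi_gt0 R.
have dp : 0 < d by rewrite lt_neqAle eq_sym dn0.
have /expi_neq1 : 0 < `|2 * pi * 1 * d| < 2 * pi.
  rewrite mulr1 ger0_norm; last by rewrite !mulr_ge0// ltW.
  by rewrite !mulr_gt0//= -[ltRHS]mulr1 ltr_pM2l// mulr_gt0.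
by rewrite -/(osc 1 d) oscd eqxx.
Qed.

Lemma poly_circle_bounded q : exists2 S, 0 <= S & forall t, normc (q.[osc 1 t]) <= S.
Proof.
exists (\sum_(i < size q) normc q`_i); first by apply: sumr_ge0 => i _; exact: normc_ge0'.
move=> t; rewrite horner_coef.
apply: (big_ind2 (fun z r => normc z <= r)); first by rewrite normc0.
  by move=> z1 r1 z2 r2 h1 h2; rewrite (le_trans (le_normcD _ _))// lerD.
by move=> i _; rewrite normcM normcX normc_osc expr1n mulr1.
Qed.

(** [q - q(z)] is [X - z] times a polynomial bounded by [S] on the circle, so [q] moves by at most
    [(S + 1) * 2 pi |t - x|]. The radius makes this less than half of [|q(z)|]; [S + 1] avoids
    dividing by 0. *)
Lemma poly_circle_lower q x : q.[osc 1 x] != 0 ->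
  exists2 rho, 0 < rho & exists2 c, 0 < c & forall t, `|t - x| < rho ->
    c <= normc (q.[osc 1 t]).
Proof.
set z := osc 1 x => qz0.
have nq0 : 0 < normc q.[z].
  by rewrite lt_neqAle normc_ge0' andbT eq_sym; apply: contra_neq qz0; exact: eq0_normc.
have /factor_theorem[s qE] : root (q - (q.[z])%:P) z.
  by rewrite rootE !hornerE subrr.
have [S S0 SP] := poly_circle_bounded s.
have pi0 := @pi_gt0 R.
have D0 : 0 < 2 * (2 * pi * (S + 1)).
  by rewrite !mulr_gt0// ltr_wpDl.
exists (normc q.[z] / (2 * (2 * pi * (S + 1)))); first by rewrite divr_gt0.
exists (normc q.[z] / 2); first by rewrite divr_gt0.
move=> t; rewrite ltr_pdivlMr// => tx.
have qt : q.[osc 1 t] = q.[z] + s.[osc 1 t] * (osc 1 t - z).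
  have := congr1 (fun p => p.[osc 1 t]) qE; rewrite !hornerE => /eqP.
  by rewrite subr_eq addrC => /eqP.
have : normc q.[z] <= normc q.[osc 1 t] + normc (s.[osc 1 t] * (osc 1 t - z)).
  have -> : q.[z] = q.[osc 1 t] + - (s.[osc 1 t] * (osc 1 t - z)) by rewrite qt addrK.
  by rewrite (le_trans (le_normcD _ _))// normcN.
rewrite normcM.
have : normc s.[osc 1 t] * normc (osc 1 t - z) <= (S + 1) * (2 * pi * `|t - x|).
  rewrite ler_pM ?normc_ge0'// ?chord_upper//.
  by rewrite (le_trans (SP t))// lerDl.
move: tx; move: (normc s.[osc 1 t] * _) (normc q.[z]) (normc q.[osc 1 t]) `|t - x| => *.
nra.
Qed.

End chords.

(** * From local to global integrability *)

Section local_integrability.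
Context {R : realType}.
Local Notation mu := (@lebesgue_measure R).
Variable w : R -> \bar R.
Hypotheses (mw : measurable_fun setT w) (w0 : forall t, (0 <= w t)%E).

Lemma ge0_integrableP (A : set R) : measurable A ->
  mu.-integrable A w <-> (\int[mu]_(t in A) w t < +oo)%E.
Proof.
move=> mA; have E : (\int[mu]_(t in A) `|w t| = \int[mu]_(t in A) w t)%E.
  by apply: eq_integral => t _; rewrite gee0_abs.
split=> [/integrableP[_]|fA]; first by rewrite E.
by apply/integrableP; split; [exact: measurable_funTS|rewrite E].
Qed.

Lemma integral_lty_cover (A B C : set R) : measurable A -> measurable B ->
  measurable C -> A `<=` B `|` C -> (\int[mu]_(t in B) w t < +oo)%E ->
  (\int[mu]_(t in C) w t < +oo)%E -> (\int[mu]_(t in A) w t < +oo)%E.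
Proof.
move=> mA mB mC ABC fB fC.
apply: (@le_lt_trans _ _ (\int[mu]_(t in B) w t + \int[mu]_(t in C) w t)%E); last first.
  exact: lte_add_pinfty.
apply: (@le_trans _ _ (\int[mu]_(t in B `|` (C `\` B)) w t)%E).
  apply: ge0_subset_integral => //.
  - by apply: measurableU => //; exact: measurableD.
  - exact: measurable_funTS.
  - move=> t At; have [Bt|nBt] := pselect (B t); first by left.
    by right; split => //; case: (ABC t At).
rewrite ge0_integral_setU//.
- rewrite leeD2l//; apply: ge0_subset_integral => //.
  + exact: measurableD.
  + exact: measurable_funTS.
- exact: measurableD.
- exact: measurable_funTS.
- by apply/disj_setPS => t [Bt []].
Qed.

(** The interval is covered by finitely many translates of [[0, 1[] by integers. *)
Lemma periodic_integral_lty (a b : R) : (forall t (m : int), w (t + m%:~R) = w t) ->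
  (\int[mu]_(t in `[0%R, 1%R[) w t < +oo)%E ->
  (\int[mu]_(t in `]a, b[) w t < +oo)%E.
Proof.
move=> wper f01.
have unit_itv (m : int) (c d : R) : c = m%:~R -> d = c + 1 ->
    (\int[mu]_(t in `[c, d[) w t < +oo)%E.
  move=> cE dE.
  have mI : measurable (`[c, d[%classic : set R) by exact: measurable_itv.
  have mwI : measurable_fun (`[c, d[%classic : set R) w by exact: measurable_funTS.
  rewrite (ge0_integral_shift m%:~R mI mwI)//.
  under eq_integral do rewrite wper.
  rewrite (_ : _ @^-1` _ = `[0%R, 1%R[%classic)//.
  by apply/seteqP; split => t /=; rewrite !in_itv/= dE cE [t + _]addrC lerDl ltrD2l.
have big (n : nat) : (\int[mu]_(t in `[(- (n%:R : R))%R, n%:R%R[) w t < +oo)%E.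
  elim: n => [|n IHn].
    by rewrite oppr0 set_itvco0 integral_set0 ltry.
  have nS : n.+1%:R = n%:R + 1 :> R by rewrite natr1.
  have f1 : (\int[mu]_(t in `[n%:R%R, (n.+1%:R : R)[) w t < +oo)%E.
    by apply: (unit_itv n%:Z); rewrite ?nS -?pmulrn.
  have f2 : (\int[mu]_(t in `[(- (n.+1%:R : R))%R, (- (n%:R : R))%R[) w t < +oo)%E.
    by apply: (unit_itv (- n.+1%:Z)); rewrite ?intrN -?pmulrn// nS opprD subrK.
  pose B : set R := `[(- (n%:R : R))%R, n%:R%R[%classic `|` `[n%:R%R, (n.+1%:R : R)[%classic.
  have mB : measurable B by apply: measurableU; exact: measurable_itv.
  have fB : (\int[mu]_(t in B) w t < +oo)%E.
    by apply: (integral_lty_cover mB _ _ _ IHn f1) => //; exact: measurable_itv.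
  apply: (integral_lty_cover _ mB _ _ fB f2); try exact: measurable_itv.
  - move=> t /=; rewrite !in_itv/= => /andP[t1 t2].
    have [h1|h1] := lerP (- n%:R) t; last by right; apply/andP; split.
    left; have [h2|h2] := lerP n%:R t; [right|left]; apply/andP; split => //.
have [n nP] : exists n : nat, Num.max `|a| `|b| < n%:R.
  by exists (Num.truncn (Num.max `|a| `|b|)).+1; exact: truncnS_gt.
apply: (@integral_lty_cover _ `[(- (n%:R : R))%R, n%:R%R[%classic
  `[(- (n%:R : R))%R, n%:R%R[%classic) => //.
move: nP; rewrite gt_max !ltr_norml => /andP[/andP[a1 a2] /andP[b1 b2]].
move=> t /=; rewrite !in_itv/= => /andP[at_ tb]; left; apply/andP; split; lra.
Qed.

(** Compactness by a supremum: let [S] be the supremum of the [s] in [[0, 1]] with finite integral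
    over [[0, s[]. The neighbourhood given at [S] extends finiteness beyond [S], unless [1] is
    reached. *)
Lemma compact_integral_lty :
  (forall t, 0 <= t <= 1 -> exists2 r : R, 0 < r &
    (\int[mu]_(u in `](t - r)%R, (t + r)%R[) w u < +oo)%E) ->
  (\int[mu]_(t in `[0%R, 1%R[) w t < +oo)%E.
Proof.
move=> loc.
pose A := [set s : R | 0 <= s <= 1 /\ (\int[mu]_(t in `[0%R, s[) w t < +oo)%E].
have A0 : A 0 by split; [rewrite lexx ler01|rewrite set_itvco0 integral_set0 ltry].
have supA : has_sup A by split; [exists 0|exists 1 => s [/andP[]]].
pose S := sup A.
have S0 : 0 <= S by apply: ub_le_sup => //; case: supA.
have S1 : S <= 1 by apply: ge_sup; [exists 0|move=> s [/andP[]]].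
have [|r r0 fr] := loc S; first by rewrite S0.
have [s [/andP[s0 s1] fs] sS] := sup_adherent r0 supA.
have ext s' : 0 <= s' <= 1 -> s' < S + r -> A s'.
  move=> s'01 s'S; split => //.
  apply: (@integral_lty_cover _ `[0%R, s[%classic `](S - r)%R, (S + r)%R[%classic) => //.
  move=> t /=; rewrite !in_itv/= => /andP[t0 ts'].
  have [h|h] := lerP s t; [right|left]; apply/andP; split => //; rewrite -/S in sS; lra.
suff : A 1 by case.
have [S1'|S1'] := lerP 1 S.
  by apply: ext; [rewrite ler01 lexx|lra].
pose s' := Num.min 1 (S + r / 2).
have s'S : s' < S + r by rewrite gt_min; apply/orP; right; lra.
have s'1 : 0 <= s' <= 1.
  by rewrite le_min ler01 ge_min lexx/= andbT addr_ge0// divr_ge0// ltW.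
have : s' <= S by apply: ub_le_sup; [case: supA|exact: ext].
rewrite leNgt; move=> /negP[]; rewrite lt_min S1'/=; lra.
Qed.

End local_integrability.

(** * Singularities and divisibility *)

Section singularities.
Context {R : realType}.
Local Notation mu := (@lebesgue_measure R).
Variable phihat : R -> R[i].
Hypothesis lh : L2 phihat.
Local Notation Phi := (periodization phihat).
Implicit Types (q : {poly R[i]}) (t x : R).

Lemma horner_osc q t : q.[osc 1 t] = \sum_(i < size q) q`_i * osc (i%:Z)%:~R t.
Proof.
rewrite horner_coef; apply: eq_bigr => i _; rewrite -oscXl mul1r.
by rewrite -pmulrn.
Qed.

Lemma cmeasurable_horner_osc q : cmeasurable (fun t => q.[osc 1 t]).
Proof.
under eq_fun do rewrite horner_osc.
apply: cmeasurable_sum => i; apply: cmeasurableM; first exact: cmeasurable_cst.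
exact: cmeasurable_osc.
Qed.

Definition quot q (t : R) : \bar R :=
  ((normc q.[osc 1 t] ^+ 2)%:E * (Phi t)^-1)%E.

Lemma invPhi_ge0 t : (0 <= (Phi t)^-1)%E.
Proof. by rewrite inve_ge0; exact: periodization_ge0. Qed.

Lemma quot_ge0 q t : (0 <= quot q t)%E.
Proof. by rewrite mule_ge0 ?lee_fin ?sqr_ge0 ?invPhi_ge0. Qed.

Lemma measurable_mul_invPhi (u : R -> R) : measurable_fun setT u ->
  measurable_fun setT (fun t => (u t)%:E * (Phi t)^-1)%E.
Proof.
move=> mu_; apply: emeasurable_funM; first exact/measurable_EFinP.
exact: measurable_invPhi.
Qed.

Lemma measurable_quot q : measurable_fun setT (quot q).
Proof.
by apply: measurable_mul_invPhi; apply: measurable_sqr_normc; exact: cmeasurable_horner_osc.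
Qed.

Lemma quot_periodic q t (m : int) : quot q (t + m%:~R) = quot q t.
Proof.
by rewrite /quot periodization_periodic -[X in osc X (t + _)]/(1%:~R) osc_periodic.
Qed.

Lemma measurable_pow (n : nat) x : measurable_fun setT (fun t : R => (t - x) ^+ n).
Proof.
by apply: measurable_funX; apply: measurable_funB => //; exact: measurable_cst.
Qed.

Lemma weighted_inverse_ge0 m x t : (0 <= weighted_inverse Phi m x t)%E.
Proof.
by rewrite /weighted_inverse mule_ge0 ?invPhi_ge0// lee_fin exprM exprn_ge0 ?sqr_ge0.
Qed.

Lemma measurable_weighted_inverse m x : measurable_fun setT (weighted_inverse Phi m x).
Proof. by apply: measurable_mul_invPhi; exact: measurable_pow. Qed.

(** Two majorants are allowed because the bound used at a singularity has one form near the point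
    and another away from it. *)
Lemma lty_integral_dom (A : set R) (u : R -> R) (C D : R) (g h : R -> R) :
  measurable A -> measurable_fun setT u -> measurable_fun setT g ->
  measurable_fun setT h -> (forall t, 0 <= u t) -> (forall t, 0 <= g t) ->
  (forall t, 0 <= h t) ->
  0 <= C -> 0 <= D -> (forall t, A t -> u t <= C * g t + D * h t) ->
  (\int[mu]_(t in A) ((g t)%:E * (Phi t)^-1) < +oo)%E ->
  (\int[mu]_(t in A) ((h t)%:E * (Phi t)^-1) < +oo)%E ->
  (\int[mu]_(t in A) ((u t)%:E * (Phi t)^-1) < +oo)%E.
Proof.
move=> mA mu_ mg mh u0 g0 h0 C0 D0 ugh fg fh.
have nn (k : R -> R) : (forall t, 0 <= k t) -> forall t, A t -> (0 <= (k t)%:E * (Phi t)^-1)%E.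
  by move=> k0 t _; rewrite mule_ge0 ?lee_fin ?invPhi_ge0.
have mm (k : R -> R) : measurable_fun setT k ->
    measurable_fun A (fun t => (k t)%:E * (Phi t)^-1)%E.
  by move=> mk; apply: measurable_funTS; exact: measurable_mul_invPhi.
apply: (@le_lt_trans _ _ (C%:E * (\int[mu]_(t in A) ((g t)%:E * (Phi t)^-1)) +
    D%:E * (\int[mu]_(t in A) ((h t)%:E * (Phi t)^-1)))%E); last first.
  by apply: lte_add_pinfty; apply: lte_mul_pinfty => //; rewrite ?lee_fin.
rewrite -!ge0_integralZl//; try exact: mm; try exact: nn.
rewrite -ge0_integralD//; first last.
- by apply: emeasurable_funM; [exact: measurable_cst|exact: mm].
- by move=> t At; rewrite mule_ge0 ?lee_fin ?nn.
- by apply: emeasurable_funM; [exact: measurable_cst|exact: mm].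
- by move=> t At; rewrite mule_ge0 ?lee_fin ?nn.
apply: ge0_le_integral => //.
- exact: nn.
- exact: mm.
- by apply: emeasurable_funD; apply: emeasurable_funM; [exact: measurable_cst|exact: mm|
    exact: measurable_cst|exact: mm].
- move=> t At; rewrite !muleA -!EFinM -ge0_muleDl ?lee_fin ?mulr_ge0// -EFinD.
  by rewrite lee_wpmul2r ?invPhi_ge0// lee_fin ugh.
Qed.

(** Suppose the multiplicity [m] of the root is below [k]. Near [x], [|q|] is at least a constant
    times [|t - x|^m], so [|t - x|^(2 (k - 1)) / Phi] is dominated by [|q|^2 / Phi]; away from [x]
    it is dominated by [|t - x|^(2 k) / Phi]. It would then be integrable, against the definition of
    the order. *)
Lemma singularity_dvdp q x (k : nat) : has_singularity Phi k x ->
  (\int[mu]_(t in `[0%R, 1%R[) quot q t < +oo)%E ->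
  ('X - (osc 1 x)%:P) ^+ k %| q.
Proof.
move=> [k0 [r r0 [sing reg]]] fq.
have [->|q0] := eqVneq q 0; first exact: dvdp0.
have [m [p /implyP/(_ q0) rp qE]] := multiplicity_XsubC q (osc 1 x).
have [km|mk] := leqP k m.
  by rewrite qE dvdp_mull// dvdp_exp2l.
exfalso; apply: sing.
have mI : measurable (`](x - r)%R, (x + r)%R[%classic : set R) by exact: measurable_itv.
apply/(ge0_integrableP (measurable_weighted_inverse _ _) (weighted_inverse_ge0 _ _) mI).
have {}reg : (\int[mu]_(t in `](x - r)%R, (x + r)%R[) weighted_inverse Phi k x t < +oo)%E.
  exact/(ge0_integrableP (measurable_weighted_inverse _ _) (weighted_inverse_ge0 _ _) mI).
have {}fq := @periodic_integral_lty _ _ (measurable_quot q) (quot_ge0 q)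
  (x - r) (x + r) (quot_periodic q) fq.
have [rho rho0 [c c0 cP]] := poly_circle_lower rp.
(* [d <= 1/4] makes chords comparable with distances and powers of [|t - x|] decreasing in the
   exponent; [d <= rho] keeps the cofactor [p] away from 0. *)
have [d d0 [d1 drho]] : exists2 d : R, 0 < d & d <= 4^-1 /\ d <= rho.
  exists (Num.min rho 4^-1); first by rewrite lt_min rho0 invr_gt0 ltr0n.
  by rewrite !ge_min !lexx orbT.
have [kap kap0 kapP] : exists2 kap : R, 0 < kap &
    forall t, `|t - x| <= 4^-1 -> kap * `|t - x| <= normc (osc 1 t - osc 1 x).
  exists (2 * pi * cos 1); last by move=> t; exact: chord_lower.
  by rewrite !mulr_gt0 ?pi_gt0 ?cos1_gt0.
have cm0 : 0 < (c * kap ^+ m) ^+ 2 by rewrite exprn_gt0// mulr_gt0// exprn_gt0.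
apply: (@lty_integral_dom _ (fun t => (t - x) ^+ (2 * k.-1))
  ((c * kap ^+ m) ^+ 2)^-1 (d ^+ 2)^-1 (fun t => normc q.[osc 1 t] ^+ 2)
  (fun t => (t - x) ^+ (2 * k))) => //.
- exact: measurable_pow.
- by apply: measurable_sqr_normc; exact: cmeasurable_horner_osc.
- exact: measurable_pow.
- by move=> t; rewrite exprM exprn_ge0 ?sqr_ge0.
- by move=> t; exact: sqr_ge0.
- by move=> t; rewrite exprM exprn_ge0 ?sqr_ge0.
- by rewrite invr_ge0 ltW.
- by rewrite invr_ge0 sqr_ge0.
move=> t _; have even (n : nat) : (t - x) ^+ (2 * n) = `|t - x| ^+ (2 * n).
  by rewrite !exprM real_normK ?num_real.
rewrite !even; set y := `|t - x|.
have y0 : 0 <= y by exact: normr_ge0.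
have [yd|dy] := ltP y d.
- apply: (@le_trans _ _ (((c * kap ^+ m) ^+ 2)^-1 * normc q.[osc 1 t] ^+ 2)); last first.
    by rewrite lerDl mulr_ge0 ?invr_ge0 ?sqr_ge0// exprn_ge0.
  rewrite ler_pdivlMl//.
  have lowq : c * (kap * y) ^+ m <= normc q.[osc 1 t].
    rewrite qE hornerM horner_exp !hornerE normcM normcX.
    apply: ler_pM; [exact: ltW|by rewrite exprn_ge0// mulr_ge0// ltW| |].
      by apply: cP; rewrite -/y (lt_le_trans yd).
    apply: lerXn2r; rewrite ?nnegrE ?normc_ge0'//; first by rewrite mulr_ge0// ltW.
    by apply: kapP; rewrite (le_trans (ltW yd)).
  apply: (@le_trans _ _ ((c * (kap * y) ^+ m) ^+ 2)).
    have -> : (c * (kap * y) ^+ m) ^+ 2 = (c * kap ^+ m) ^+ 2 * (y ^+ m) ^+ 2.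
      by rewrite -exprMn -mulrA -exprMn.
    rewrite ler_pM2l// mulnC exprM; apply: lerXn2r; rewrite ?nnegrE ?exprn_ge0//.
    apply: ler_wiXn2l => //; last by rewrite -ltnS prednK.
    by rewrite (le_trans (ltW yd))// (le_trans d1)// invf_le1// ler1n.
  rewrite ler_pXn2r ?nnegrE ?normc_ge0'//.
  by rewrite mulr_ge0 ?(ltW c0)// exprn_ge0// mulr_ge0// ltW.
- apply: (@le_trans _ _ ((d ^+ 2)^-1 * y ^+ (2 * k))); last first.
    by rewrite lerDr mulr_ge0 ?invr_ge0 ?sqr_ge0// ltW.
  rewrite ler_pdivlMl ?exprn_gt0//.
  rewrite -[in leRHS](prednK k0) mulnS exprD ler_wpM2r ?exprn_ge0//.
  by rewrite ler_pXn2r ?nnegrE// ltW.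
Qed.

End singularities.

(** * The polynomial [W] attached to the singularities *)

Section characteristic_polynomial.
Context {R : realType}.
Local Notation mu := (@lebesgue_measure R).
Variable phihat : R -> R[i].
Hypothesis lh : L2 phihat.
Local Notation Phi := (periodization phihat).
Variables (s : nat) (x : 'I_s -> R) (lambda : 'I_s -> nat).
Hypothesis hsing : singularities_exactly Phi x lambda.
Local Notation L := (\sum_(j < s) lambda j)%N.

Definition charpoly : {poly R[i]} := \prod_(j < s) ('X - (osc 1 (x j))%:P) ^+ lambda j.

Lemma charpoly_monic : charpoly \is monic.
Proof. by apply: monic_prod => j _; apply: monic_exp; exact: monicXsubC. Qed.

Lemma size_charpoly : size charpoly = L.+1.
Proof.
suff : charpoly \is monic /\ size charpoly = L.+1 by case.
apply: (big_ind2 (fun (p : {poly R[i]}) n => p \is monic /\ size p = n.+1)).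
- by rewrite monic1 size_poly1.
- move=> p1 n1 p2 n2 [m1 s1] [m2 s2]; split; first by rewrite monicMl.
  by rewrite size_Mmonic ?monic_neq0// s1 s2 addSn addnS.
- by move=> j _; split; [apply: monic_exp; exact: monicXsubC|rewrite size_exp_XsubC].
Qed.

Lemma osc_node_inj : injective (fun j => osc 1 (x j)).
Proof.
move=> i j /= E; case: hsing => + _ _; apply; apply: osc1_eq1.
by rewrite oscD E -oscD subrr osc0.
Qed.

(** The points being distinct modulo 1, the factors are pairwise coprime. *)
Lemma charpoly_dvdp (q : {poly R[i]}) :
  (forall j, ('X - (osc 1 (x j))%:P) ^+ lambda j %| q) -> charpoly %| q.
Proof.
move=> dq; rewrite /charpoly; move: (index_enum_uniq 'I_s).
elim: (index_enum 'I_s) => [_|j r IHr /andP[jr ur]].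
  by rewrite big_nil dvd1p.
rewrite big_cons Gauss_dvdp ?dq ?IHr//.
rewrite coprimep_sym; move: jr; elim: r {IHr ur} => [_|i r IHr].
  by rewrite big_nil coprime1p.
rewrite inE negb_or => /andP[ij jr]; rewrite big_cons coprimepMl IHr// andbT.
apply: coprimep_expl; apply: coprimep_expr; rewrite coprimep_XsubC2//.
by rewrite subr_eq0; apply: contraNneq ij => /osc_node_inj ->.
Qed.

Lemma charpoly_root t : charpoly.[osc 1 t] = 0 -> exists j, eq_mod1 t (x j).
Proof.
rewrite /charpoly horner_prod => /eqP; rewrite prodf_seq_eq0 => /hasP[j _ /=].
rewrite horner_exp hornerXsubC expf_eq0 subr_eq0 => /andP[_ /eqP E].
by exists j; apply: osc1_eq1; rewrite oscD E -oscD subrr osc0.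
Qed.

Lemma charpoly_upper j : exists2 C, 0 <= C &
  forall t, normc charpoly.[osc 1 t] ^+ 2 <= C * (t - x j) ^+ (2 * lambda j).
Proof.
pose p := \prod_(i < s | i != j) ('X - (osc 1 (x i))%:P) ^+ lambda i : {poly R[i]}.
have [S S0 SP] := poly_circle_bounded p.
have pp : 0 <= 2 * pi :> R by rewrite mulr_ge0// pi_ge0.
exists ((S * (2 * pi) ^+ lambda j) ^+ 2); first exact: sqr_ge0.
move=> t; rewrite /charpoly (bigD1 j)//= -/p hornerM horner_exp !hornerE normcM normcX.
have -> : (t - x j) ^+ (2 * lambda j) = (`|t - x j| ^+ lambda j) ^+ 2.
  by rewrite mulnC exprM [in RHS]exprAC real_normK ?num_real// -exprM mulnC exprM.
rewrite -exprMn; apply: lerXn2r; rewrite ?nnegrE ?mulr_ge0 ?exprn_ge0 ?normc_ge0'//.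
rewrite mulrC -mulrA -exprMn; apply: ler_pM; rewrite ?exprn_ge0 ?normc_ge0'//.
apply: lerXn2r; last exact: chord_upper; rewrite nnegrE ?normc_ge0'//.
by rewrite mulr_ge0.
Qed.

(** Near a point congruent to [x j], [|W|^2] is at most a constant times [(t - x j)^(2 lambda_j)];
    near any other point [1 / Phi] is integrable and [W] is bounded. Compactness of [[0, 1]]
    concludes. *)
Lemma quot_charpoly_lty :
  (\int[mu]_(t in `[0%R, 1%R[) quot phihat charpoly t < +oo)%E.
Proof.
apply: compact_integral_lty; [exact: measurable_quot|exact: quot_ge0|].
move=> t0 _; have [_ sing reg] := hsing.
have mW : measurable_fun setT (fun t : R => normc charpoly.[osc 1 t] ^+ 2).
  by apply: measurable_sqr_normc; exact: cmeasurable_horner_osc.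
have z0 (A : set R) : measurable A ->
    (\int[mu]_(t in A) ((0 : R)%:E * (Phi t)^-1) < +oo)%E.
  by move=> mA; under eq_integral do rewrite mul0e; rewrite integral0 ltry.
have [[j [m tm]]|nx] := pselect (exists j, eq_mod1 t0 (x j)).
  have [_ [r r0 [_ fr]]] := sing j; exists r => //.
  have mI : measurable (`](x j - r)%R, (x j + r)%R[%classic : set R) by exact: measurable_itv.
  have {}fr : (\int[mu]_(t in `](x j - r)%R, (x j + r)%R[)
      weighted_inverse Phi (lambda j) (x j) t < +oo)%E.
    apply/(ge0_integrableP _ _ mI) => //.
      exact: measurable_weighted_inverse.
    exact: weighted_inverse_ge0.
  have mJ : measurable (`](t0 - r)%R, (t0 + r)%R[%classic : set R) by exact: measurable_itv.
  have mq : measurable_fun (`](t0 - r)%R, (t0 + r)%R[%classic : set R) (quot phihat charpoly).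
    by apply: measurable_funTS; exact: measurable_quot.
  (* Periodicity moves the neighbourhood of [t0] to the representative [x j], where the order of the
     singularity is given. *)
  rewrite (ge0_integral_shift m%:~R mJ mq); last by move=> *; exact: quot_ge0.
  under eq_integral do rewrite quot_periodic.
  rewrite (_ : _ @^-1` _ = `](x j - r)%R, (x j + r)%R[%classic); last first.
    have -> : t0 = x j + m%:~R by rewrite -tm addrC subrK.
    by apply/seteqP; split => t /=; rewrite !in_itv/= => /andP[? ?]; apply/andP; split; lra.
  have [C C0 CP] := charpoly_upper j.
  apply: (@lty_integral_dom _ _ lh _ _ C 0
    (fun t => (t - x j) ^+ (2 * lambda j)) (fun _ => 0)) => //.
  - exact: measurable_pow.
  - by move=> t; exact: sqr_ge0.
  - by move=> t; rewrite exprM exprn_ge0 ?sqr_ge0.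
  - by move=> t _; rewrite mul0r addr0.
  - exact: z0.
have [r r0 fr] := reg t0 (fun j e => nx (ex_intro _ j e)); exists r => //.
have mI : measurable (`](t0 - r)%R, (t0 + r)%R[%classic : set R) by exact: measurable_itv.
have {}fr : (\int[mu]_(t in `](t0 - r)%R, (t0 + r)%R[) (Phi t)^-1 < +oo)%E.
  apply/(ge0_integrableP _ _ mI) => //.
    exact: measurable_invPhi.
  exact: invPhi_ge0.
have [S S0 SP] := poly_circle_bounded charpoly.
apply: (@lty_integral_dom _ _ lh _ _ (S ^+ 2) 0 (fun _ => 1) (fun _ => 0)) => //.
- by move=> t; exact: sqr_ge0.
- exact: sqr_ge0.
- move=> t _; rewrite mul0r addr0 mulr1.
  by apply: lerXn2r; rewrite ?nnegrE ?normc_ge0'.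
- by under eq_integral do rewrite mul1e.
- exact: z0.
Qed.

Lemma ae_forall_ord (n : nat) (P : 'I_n -> R -> Prop) :
  (forall j, {ae mu, forall t, P j t}) -> {ae mu, forall t, forall j, P j t}.
Proof.
move=> H.
suff : forall r : seq 'I_n, {ae mu, forall t, forall j, j \in r -> P j t}.
  by move=> /(_ (enum 'I_n)); apply: ae_imp => t Ht j; apply: Ht; rewrite mem_enum.
elim=> [|j r IHr]; first by apply: aeW.
apply: (ae_imp2 _ (H j) IHr) => t Pj Pr i; rewrite inE => /predU1P[->//|]; exact: Pr.
Qed.

Lemma charpoly_neq0_ae : {ae mu, forall t, 0 <= t < 1 -> charpoly.[osc 1 t] != 0}.
Proof.
have := ae_forall_ord (fun j => ae_neq (x j - (Num.floor (x j))%:~R)).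
apply: ae_imp => t tx t01; apply/eqP => /charpoly_root[j [m tm]].
have := tx j; suff -> : Num.floor (x j) = - m.
  by rewrite intrN opprK -tm addrC subrK eqxx.
apply: floor_def; rewrite intrD intrN; move: tm t01 => /eqP; rewrite subr_eq => /eqP ->.
by move=> /andP[h1 h2]; apply/andP; split; lra.
Qed.

(** Where [Phi] vanishes and [W] does not, [|W|^2 / Phi] is [+oo]; being integrable, it is finite
    almost everywhere, and [W] has finitely many zeros in a period. *)
Lemma Phi_gt0_ae : {ae mu, forall t, 0 <= t < 1 ->
  [/\ Phi t \is a fin_num, 0 < fine (Phi t) & charpoly.[osc 1 t] != 0]}.
Proof.
have iq : mu.-integrable `[0%R, 1%R[ (quot phihat charpoly).
  have mI : measurable (`[0%R, 1%R[%classic : set R) by exact: measurable_itv.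
  apply/(ge0_integrableP _ _ mI); [exact: measurable_quot|exact: quot_ge0|].
  exact: quot_charpoly_lty.
have fq := @integrable_ae _ _ _ mu _ (measurable_itv _) _ iq.
have gd : {ae mu, forall t, 0 <= t < 1 -> Phi t \is a fin_num /\ charpoly.[osc 1 t] != 0}.
  by apply: (ae_imp2 _ (Phi_fin_ae lh) charpoly_neq0_ae) => t h1 h2 t01; split; auto.
apply: (ae_imp2 _ fq gd) => t fqt gt t01; have [f1 c0] := gt t01.
split => //; rewrite lt_neqAle fine_ge0 ?periodization_ge0// andbT eq_sym.
apply/eqP => P0; have : quot phihat charpoly t \is a fin_num.
  by apply: fqt; rewrite /= in_itv.
rewrite /quot -(fineK f1) P0 inver eqxx gt0_muley//.
rewrite lte_fin exprn_gt0// lt_neqAle normc_ge0' andbT eq_sym.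
by apply: contra_neq c0; exact: eq0_normc.
Qed.

Lemma charpoly_remainder (m : nat) :
  exists p Q : {poly R[i]}, (size p <= L)%N /\ 'X^m - p = charpoly * Q.
Proof.
exists ('X^m %% charpoly), ('X^m %/ charpoly); split.
  by rewrite -ltnS -size_charpoly ltn_modp monic_neq0// charpoly_monic.
by rewrite {1}(divp_eq 'X^m charpoly) addrK mulrC.
Qed.

(** The roots of [W] have modulus 1, so [X] does not divide it and a Bezout coefficient inverts
    [X^m] modulo [W]; [p] is that coefficient reduced modulo [W]. This is how negative frequencies
    are treated with polynomials. *)
Lemma charpoly_remainder_inv (m : nat) :
  exists p Q : {poly R[i]}, (size p <= L)%N /\ 1 - 'X^m * p = charpoly * Q.
Proof.
have cop : coprimep 'X^m charpoly.
  apply: coprimep_expl; rewrite coprimep_sym coprimepX rootE.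
  rewrite /charpoly horner_prod prodf_seq_neq0; apply/allP => j _ /=.
  rewrite horner_exp expf_neq0// !hornerE oppr_eq0; apply/eqP => z0.
  by have := normc_osc 1 (x j); rewrite z0 normc0 => /esym/eqP; rewrite oner_eq0.
have /Bezout_eq1_coprimepP[[u v] /= uv] := cop.
exists (u %% charpoly), (v + 'X^m * (u %/ charpoly)); split.
  by rewrite -ltnS -size_charpoly ltn_modp monic_neq0// charpoly_monic.
rewrite -uv {1}(divp_eq u charpoly); ring.
Qed.

End characteristic_polynomial.

(** * Closed spans, minimality and biorthogonal systems *)

Section systems.
Context {R : realType} {I : eqType}.
Local Notation mu := (@lebesgue_measure R).
Implicit Types (J : set I) (y : I -> R -> R[i]) (f g h : R -> R[i]).

(** The list and coefficients are chosen before [v], so one combination can be read in two systems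
    and its norms compared. *)
Lemma sumB_merge (r r' : seq I) (c c' : I -> R[i]) :
  exists (s : seq I) (d : I -> R[i]), forall v : I -> R[i],
    \sum_(k <- r) c k * v k - \sum_(k <- r') c' k * v k = \sum_(k <- s) d k * v k.
Proof.
exists (undup (r ++ r')), (fun k => c k *+ count_mem k r - c' k *+ count_mem k r') => v.
rewrite (@sum_count _ _ _ r _ (undup_uniq (r ++ r'))); last first.
  by move=> k kr; rewrite mem_undup mem_cat kr.
rewrite (@sum_count _ _ _ r' _ (undup_uniq (r ++ r'))); last first.
  by move=> k kr; rewrite mem_undup mem_cat kr orbT.
by rewrite -sumrB; apply: eq_bigr => k _; rewrite mulrBl !mulrnAl.
Qed.

(** The error in approximating [y k] is itself a finite combination of the system, so the norm bound
    carries it to the same combination of [y']. *)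
Lemma closed_span_transfer J y y' (K : R) k : 0 < K ->
  (forall k, L2 (y k)) -> (forall k, L2 (y' k)) ->
  (forall r c, n2 (fun x => \sum_(k <- r) c k * y' k x) <=
     K * n2 (fun x => \sum_(k <- r) c k * y k x)) ->
  closed_span J y (y k) -> closed_span J y' (y' k).
Proof.
move=> K0 ly ly' Kn /(closed_spanP _ _ ly)[_ H]; apply/(closed_spanP _ _ ly'); split => // e e0.
have [g [r [c [rJ ->]]] ge] := H (e / K) (divr_gt0 e0 K0).
exists (fun x => \sum_(k <- r) c k * y' k x); first by exists r, c.
have [s [d sd]] := sumB_merge [:: k] r (fun _ => 1) c.
have E z : (fun x => z k x - \sum_(j <- r) c j * z j x) =
    (fun x => \sum_(j <- s) d j * z j x) :> (R -> R[i]).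
  by apply/funext => x; rewrite -(sd (fun k => z k x)) big_seq1 mul1r.
by rewrite E; apply: le_lt_trans (Kn _ _) _; rewrite -E mulrC -ltr_pdivlMr.
Qed.

Lemma closed_span_lin J y (a : R[i]) f g : (forall k, L2 (y k)) ->
  closed_span J y f -> closed_span J y g -> closed_span J y (fun x => a * f x + g x).
Proof.
move=> ly /(closed_spanP _ _ ly)[lf Hf] /(closed_spanP _ _ ly)[lg Hg].
apply/(closed_spanP _ _ ly); split; first exact: (L2D (L2Z a lf) lg).
(* [B] is chosen so that [2 |a|^2 (e / B) + 2 (e / B) = e]. *)
move=> e e0; set B := 2 * normc a ^+ 2 + 2.
have B0 : 0 < B by rewrite /B ltr_wpDl// mulr_ge0// sqr_ge0.
have [f' sf hf] := Hf (e / B) (divr_gt0 e0 B0).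
have [g' sg hg] := Hg (e / B) (divr_gt0 e0 B0).
exists (fun x => a * f' x + g' x); first exact: span_lin.
have lf' := span_L2 ly sf; have lg' := span_L2 ly sg.
rewrite (_ : (fun x => _ - _) = (fun x => a * (f x - f' x) + (g x - g' x))); last first.
  by apply/funext => x; ring.
apply: le_lt_trans (n2D_le (L2Z a (L2B lf lf')) (L2B lg lg')) _.
rewrite n2Z; last exact: L2B.
have -> : e = (2 * normc a ^+ 2) * (e / B) + 2 * (e / B).
  by rewrite -mulrDl -/B mulrC divfK// gt_eqF.
move: hf hg (sqr_ge0 (normc a)); move: (e / B) (normc a ^+ 2) (n2 _) (n2 _) => *; nra.
Qed.

Lemma closed_span_trans J J' y f : (forall k, L2 (y k)) ->
  (forall k, J' k -> closed_span J y (y k)) ->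
  closed_span J' y f -> closed_span J y f.
Proof.
move=> ly H; have sub g : span_of J' y g -> closed_span J y g.
  apply: span_ind => [|k a {}g Jk _ cg].
    apply/(closed_spanP _ _ ly); split; first exact: L20.
    move=> e e0; exists (fun _ => 0); first exact: span0.
    by rewrite /n2 /sqn; under eq_integral do rewrite subr0 normc0 expr0n/=;
       rewrite integral0.
  by apply: closed_span_lin => //; exact: H.
move=> /(closed_spanP _ _ ly)[lf Hf]; apply/(closed_spanP _ _ ly); split => // e e0.
have e4 : 0 < e / 4 by rewrite divr_gt0.
have [g /sub/(closed_spanP _ _ ly)[lg Hg] fg] := Hf _ e4.
have [g' sg gg] := Hg _ e4; exists g' => //.
have lg' := span_L2 ly sg.
have := n2D_le (L2B lf lg) (L2B lg lg').
rewrite (_ : (fun x => _ + _) = (fun x => f x - g' x)); last by apply/funext => x; ring.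
move: fg gg; move: (n2 _) (n2 _) (n2 _) => *; lra.
Qed.

Lemma closed_span_orthogonal J y f h : (forall k, L2 (y k)) -> L2 h ->
  (forall k, J k -> dot (y k) h = 0) -> closed_span J y f -> dot f h = 0.
Proof.
move=> ly lh oh /(closed_spanP _ _ ly)[lf Hf].
apply/eq0_normc/eqP; rewrite -[_ == 0]sqrf_eq0 eq_le sqr_ge0 andbT.
apply: (@small_le0 _ _ (n2 h)) => e e0; have [g sg fg] := Hf e e0.
have lg := span_L2 ly sg.
have g0 : dot g h = 0.
  have [r [c [rJ ->]]] := sg; rewrite dot_suml//; last by move=> k; exact: L2Z.
  by rewrite big_seq big1// => k /rJ Jk; rewrite dotZl// oh// mulr0.
have := cauchy_schwarz (L2B lf lg) lh; rewrite dotBl// g0 subr0 => /le_trans; apply.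
by rewrite mulrC ler_wpM2l ?n2_ge0// ltW.
Qed.

(** Each [k] has a function orthogonal to the other elements but not to [y k]. Since [dot] is
    conjugate-linear on the right, the normalizing factor is the inverse of a conjugate. *)
Lemma minimal_biorthogonal J y : (forall k, L2 (y k)) -> minimal_system J y ->
  exists h : I -> R -> R[i], forall k, J k ->
    L2 (h k) /\ forall j, J j -> dot (y j) (h k) = (j == k)%:R.
Proof.
move=> ly min; have H k : exists h, J k ->
    L2 h /\ forall j, J j -> dot (y j) h = (j == k)%:R.
  have [Jk|nJ] := pselect (J k); last by exists (fun _ => 0).
  have [h [lh oh d0]] := orthogonal_witness ly (ly k) (min k Jk).
  have cd0 : conjc (dot (y k) h) != 0 by rewrite conjc_eq0.
  exists (fun x => (conjc (dot (y k) h))^-1 * h x) => _.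
  have lh' := L2Z (conjc (dot (y k) h))^-1 lh.
  split=> // j Jj; rewrite dotC// dotZl// (dotC (ly j) lh).
  have [->|jk] := eqVneq j k; first by rewrite mulVf// conjc1.
  by rewrite (oh j) ?conjc0 ?mulr0 ?conjc0//; split => // /eqP; exact/negP.
by have [h hP] := choice H; exists h.
Qed.

Lemma dot_bounded_functional (B : set (R -> R[i])) h : (forall f, B f -> L2 f) -> L2 h ->
  bounded_functional B (fun f => dot f h).
Proof.
move=> BL lh; split=> [a f g /BL lf /BL lg|].
  by rewrite dotDl//; [rewrite dotZl|exact: L2Z].
exists (Num.sqrt (n2 h)) => f /BL lf; rewrite cLnorm2_sqrt// -EFinM lee_fin.
rewrite -(ler_pXn2r (n := 2))// ?nnegrE ?normc_ge0' ?mulr_ge0 ?sqrtr_ge0//.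
apply: le_trans (cauchy_schwarz lf lh) _.
have -> : n2 f * n2 h = (Num.sqrt (n2 h) * Num.sqrt (n2 f)) ^+ 2; last by [].
by rewrite exprMn !sqr_sqrtr ?n2_ge0// mulrC.
Qed.

End systems.

(** * Completeness in the model *)

Section model_system.
Context {R : realType}.
Local Notation mu := (@lebesgue_measure R).
Variable phihat : R -> R[i].
Hypothesis lh : L2 phihat.
Local Notation Phi := (periodization phihat).
Variables (s : nat) (x : 'I_s -> R) (lambda : 'I_s -> nat).
Hypothesis hsing : singularities_exactly Phi x lambda.
Local Notation L := (\sum_(j < s) lambda j)%N.
Local Notation W := (charpoly x lambda).

(* On the Fourier side [translate phi k] becomes [osc k * phihat], and only the
   periodization of [|phihat|^2] matters for norms: hence this model. *)
Definition model (k : int) (t : R) : R[i] := osc k%:~R t * psi phihat t.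

Lemma sum_model r c :
  (fun t => \sum_(k <- r) c k * model k t) = (fun t => trig r c t * psi phihat t).
Proof.
by apply/funext => t; rewrite /trig mulr_suml; apply: eq_bigr => k _; rewrite mulrA.
Qed.

Lemma L2_sum_model r c : L2 (fun t => \sum_(k <- r) c k * model k t).
Proof. by rewrite sum_model; exact: L2_trig_psi. Qed.

Lemma L2_model k : L2 (model k).
Proof.
have := L2_sum_model [:: k] (fun _ => 1).
by rewrite (_ : (fun t => _) = model k)//; apply/funext => t; rewrite big_seq1 mul1r.
Qed.

Definition window (n : int) (m : nat) : seq int := [seq n + i%:Z | i <- iota 0 m].

Lemma mem_window n m k : (k \in window n m) = (n <= k < n + m%:Z).
Proof.
apply/mapP/andP => [[i +]|[nk km]].
  by rewrite mem_iota add0n => /andP[_ im] ->; rewrite lerDl ltrD2l ltz_nat.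
have k0 : 0 <= k - n by rewrite subr_ge0.
exists `|k - n|%N; last by rewrite gez0_abs// subrKC.
by rewrite mem_iota add0n -ltz_nat gez0_abs// ltrBlDl.
Qed.

Lemma window_uniq n m : uniq (window n m).
Proof. by rewrite map_inj_uniq ?iota_uniq// => i j /addrI []. Qed.

Lemma trig_window n m (q : {poly R[i]}) (c : int -> R[i]) t : (size q <= m)%N ->
  (forall i, (i < m)%N -> c (n + i%:Z) = q`_i) ->
  trig (window n m) c t = osc n%:~R t * q.[osc 1 t].
Proof.
move=> sq cq; rewrite /trig big_map (horner_coef_wide _ sq) mulr_sumr.
rewrite -(big_mkord xpredT (fun i => osc n%:~R t * (q`_i * osc 1 t ^+ i))).
rewrite /index_iota subn0 big_seq [RHS]big_seq; apply: eq_bigr => i.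
rewrite mem_iota add0n => /andP[_ im].
by rewrite cq// [RHS]mulrCA -(oscXl 1) mul1r intrD oscDl.
Qed.

Lemma sum_delta (r : seq int) (a : int -> R[i]) k : uniq r ->
  \sum_(l <- r) a l * (k == l)%:R = if k \in r then a k else 0.
Proof.
move=> ur; case: ifPn => kr; last first.
  rewrite big_seq big1// => l lr; rewrite (_ : k == l = false) ?mulr0//.
  by apply/negbTE; apply: contraNneq kr => ->.
rewrite (bigD1_seq k)//= eqxx mulr1 big1 ?addr0// => l lk.
by rewrite eq_sym (negbTE lk) mulr0.
Qed.

Lemma cintegrable_box_osc (k : int) : cintegrable (fun t : R => box 0 1 t * osc k%:~R t).
Proof.
have lb := @L2_box R 0 1 ltr01.
have := L2_mul_conj lb lb; under eq_fun => t.
  rewrite (_ : _ * _ = box 0 1 t); first over.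
  have [t01|t01] := pselect (0 <= t < 1); first by rewrite box_in// conjc1 mulr1.
  by rewrite box_out// mul0r.
move=> cb; apply: (cintegrableM_bounded (C := 1)) cb _ _; first exact: cmeasurable_osc.
by move=> t; rewrite normc_osc.
Qed.

Lemma conj_trig r c (t : R) : conjc (trig r c t) = \sum_(k <- r) conjc (c k) * osc (- k)%:~R t.
Proof.
rewrite /trig; elim: r => [|k r IHr]; first by rewrite !big_nil conjc0.
by rewrite !big_cons raddfD/= IHr conjcM conj_osc intrN.
Qed.

Lemma box_conj_trigE r c (k : int) (t : R) :
  box 0 1 t * (conjc (trig r c t) * osc k%:~R t) =
  \sum_(l <- r) conjc (c l) * (box 0 1 t * osc (k - l)%:~R t).
Proof.
rewrite conj_trig mulr_suml mulr_sumr; apply: eq_bigr => l _.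
by rewrite addrC intrD oscDl; ring.
Qed.

Lemma cintegrable_box_conj_trig r c (k : int) :
  cintegrable (fun t : R => box 0 1 t * (conjc (trig r c t) * osc k%:~R t)).
Proof.
under eq_fun do rewrite box_conj_trigE; apply: cintegrable_sum => l.
by apply: cintegrableZ; exact: cintegrable_box_osc.
Qed.

Lemma cintegral_box_conj_trig r c (k : int) :
  cintegral (fun t : R => box 0 1 t * (conjc (trig r c t) * osc k%:~R t)) =
  \sum_(l <- r) conjc (c l) * (k == l)%:R.
Proof.
under eq_fun do rewrite box_conj_trigE.
rewrite cintegral_sum; last by move=> l; apply: cintegrableZ; exact: cintegrable_box_osc.
apply: eq_bigr => l _; rewrite cintegralZ; last exact: cintegrable_box_osc.
have := @cintegral_box_osc R 0 1 (k - l) ltr01; rewrite subr0 divr1 => ->.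
by rewrite subr_eq0; case: eqP.
Qed.

(* If [h] is orthogonal to [model j] outside the window, then [psi * conjc h] is a
   trigonometric polynomial [q] with spectrum in the window and [|h|^2 = |q|^2 / Phi];
   integrability forces [W] to divide [q], which is impossible by degree. *)
Lemma model_complete (n : int) k :
  closed_span (~` [set j | n <= j < n + L%:Z]) model (model k).
Proof.
apply: contrapT => /(orthogonal_witness L2_model (L2_model k))[h [lh' oh d0]].
pose a j := dot (model j) h.
have a0 j : j \notin window n L -> a j = 0.
  by move=> jw; apply: oh => /= jn; move: jw; rewrite mem_window jn.
(* Integrating against [osc j] picks out the frequency [- j]. To have the same integrals [a j] as
   [G], the function [P] must therefore be the conjugate of a sum over the window, with coefficients
   [conjc (a j)]. *)
pose b j := conjc (a j).
pose q := \poly_(i < L) b (n + i%:Z).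
have tq t : trig (window n L) b t = osc n%:~R t * q.[osc 1 t].
  by apply: trig_window => [|i iL]; [exact: size_poly|rewrite coef_poly iL].
pose G t := psi phihat t * conjc (h t).
pose P t := box 0 1 t * conjc (trig (window n L) b t).
have lpsi : L2 (psi phihat).
  by have := L2_model 0; rewrite /model; under eq_fun do rewrite osc0l mul1r.
have cG : cintegrable G by exact: L2_mul_conj.
have cP : cintegrable P.
  have := cintegrable_box_conj_trig (window n L) b 0.
  by under eq_fun do rewrite osc0l mulr1.
have aE (j : int) : cintegral (fun t => P t * osc j%:~R t) = a j.
  rewrite /P; under eq_fun do rewrite -mulrA.
  rewrite cintegral_box_conj_trig /b; under eq_bigr do rewrite conjcK.
  by rewrite sum_delta ?window_uniq//; case: ifPn => // /a0.
have GP : {ae mu, forall t, G t + (-1) * P t = 0}.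
  apply: (@fourier_uniqueness R 0 1) => //.
  - by apply: cintegrableD => //; exact: cintegrableZ.
  - by move=> t t01; rewrite /G /P psi_out// box_out// !mul0r mulr0 addr0.
  move=> j; rewrite subr0 divr1.
  have mo : cmeasurable (osc j%:~R : R -> R[i]) := cmeasurable_osc _.
  have no t : normc (osc j%:~R t : R[i]) <= 1 by rewrite normc_osc.
  have cGo := cintegrableM_bounded cG mo no; have cPo := cintegrableM_bounded cP mo no.
  have := cintegralD cGo (cintegrableZ (-1) cPo); rewrite (cintegralZ _ cPo) aE.
  have -> : cintegral (fun t => G t * osc j%:~R t) = a j.
    by congr cintegral; apply/funext => t; rewrite /G /model; ring.
  rewrite mulN1r subrr => <-; congr cintegral; apply/funext => t; ring.
have qfin : (\int[mu]_(t in `[0%R, 1%R[) quot phihat q t < +oo)%E.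
  apply: (@le_lt_trans _ _ (\int[mu]_(t in `[0%R, 1%R[) (normc (h t) ^+ 2)%:E)%E); last first.
    have [mh sh] := lh'; apply: le_lt_trans sh; apply: ge0_subset_integral => //.
      by apply/measurable_EFinP; exact: measurable_sqr_normc.
    by move=> t _; rewrite lee_fin sqr_ge0.
  apply: ae_ge0_le_integral => //.
  - by move=> t _; exact: quot_ge0.
  - by apply: measurable_funTS; exact: measurable_quot.
  - by move=> t _; rewrite lee_fin sqr_ge0.
  - apply: measurable_funTS; apply/measurable_EFinP; apply: measurable_sqr_normc.
    by case: lh'.
  apply: (ae_imp2 _ GP (Phi_gt0_ae lh hsing)) => t GPt Pt; rewrite /= in_itv/= => t01.
  have [fP P0 _] := Pt t01.
  have E : normc q.[osc 1 t] = normc (psi phihat t) * normc (h t).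
    have -> : normc q.[osc 1 t] = normc (P t).
      by rewrite /P box_in// mul1r normc_conjc tq normcM normc_osc mul1r.
    rewrite -[normc (h t)]normc_conjc -normcM -/(G t); congr normc.
    by move: GPt => /eqP; rewrite mulN1r subr_eq0 => /eqP.
  rewrite /quot E exprMn sqr_normc_psi// -{2}(fineK fP) inver gt_eqF// -EFinM lee_fin.
  by rewrite mulrAC divff ?mul1r// gt_eqF.
have q0 : q = 0.
  apply/eqP; apply/negPn/negP => q0.
  have : W %| q by apply: (charpoly_dvdp hsing) => j; apply: singularity_dvdp qfin => //; case: hsing.
  move=> /(dvdp_leq q0); rewrite size_charpoly => /leq_trans/(_ (size_poly _ _)).
  by rewrite ltnn.
(* All [a j] vanish: outside the window by orthogonality, inside because their conjugates are the
   coefficients of [q = 0]. This contradicts [dot (model k) h != 0]. *)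
have [kw|/a0 ak] := boolP (k \in window n L); last by move: d0; rewrite -/(a k) ak eqxx.
move: kw d0 => /mapP[i +]; rewrite mem_iota add0n => /andP[_ iL] ->.
have : q`_i = 0 by rewrite q0 coef0.
by rewrite coef_poly iL /b -/(a _) => /eqP; rewrite conjc_eq0 => ->.
Qed.

End model_system.

(** * Dual functions and minimality in the model *)

Section dual_functions.
Context {R : realType}.
Local Notation mu := (@lebesgue_measure R).
Variable phihat : R -> R[i].
Hypothesis lh : L2 phihat.
Local Notation Phi := (periodization phihat).
Variables (s : nat) (x : 'I_s -> R) (lambda : 'I_s -> nat).
Hypothesis hsing : singularities_exactly Phi x lambda.
Local Notation L := (\sum_(j < s) lambda j)%N.
Local Notation W := (charpoly x lambda).
Local Notation model := (model phihat).

(* [fine +oo = 0], so this vanishes where [Phi] is [0]. *)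
Definition inv_psi (t : R) : R[i] := box 0 1 t * ((Num.sqrt (fine ((Phi t)^-1)%E))%:C)%C.

Lemma cmeasurable_inv_psi : cmeasurable inv_psi.
Proof.
apply: cmeasurableM; first exact: cmeasurable_box.
apply: cmeasurable_real; apply: measurableT_comp.
  by apply: continuous_measurable_fun; exact: sqrt_continuous.
apply: measurableT_comp; first exact: fine_measurable.
exact: measurable_invPhi.
Qed.

Lemma inv_psi_out t : ~ (0 <= t < 1) -> inv_psi t = 0.
Proof. by move=> t01; rewrite /inv_psi box_out// mul0r. Qed.

(** [|D|^2 / Phi] is at most [C^2 |W|^2 / Phi], which is integrable. Where [Phi] is 0 the convention
    in [inv_psi] only lowers the left side. *)
Lemma L2_dual D C : cmeasurable D -> 0 <= C ->
  (forall t, normc (D t) <= C * normc W.[osc 1 t]) -> L2 (fun t => D t * inv_psi t).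
Proof.
move=> mD C0 DW; split; first by apply: cmeasurableM => //; exact: cmeasurable_inv_psi.
rewrite sqn_itv01; last by move=> t /inv_psi_out ->; rewrite mulr0.
have mI : measurable (`[0%R, 1%R[%classic : set R) by exact: measurable_itv.
have mq : measurable_fun (`[0%R, 1%R[%classic : set R) (quot phihat W).
  by apply: measurable_funTS; exact: measurable_quot.
apply: (@le_lt_trans _ _ (\int[mu]_(t in `[0%R, 1%R[) ((C ^+ 2)%:E * quot phihat W t))%E).
  apply: ge0_le_integral => //.
  - by move=> t _; rewrite lee_fin sqr_ge0.
  - apply: measurable_funTS; apply/measurable_EFinP; apply: measurable_sqr_normc.
    by apply: cmeasurableM => //; exact: cmeasurable_inv_psi.
  - exact: measurable_funeM.
  move=> t; rewrite /= in_itv/= => t01; rewrite /quot muleA -EFinM -exprMn.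
  apply: (@le_trans _ _ ((((C * normc W.[osc 1 t]) ^+ 2) * fine ((Phi t)^-1)%E)%:E)).
    rewrite lee_fin /inv_psi box_in// mul1r normcM exprMn normc_real.
    rewrite real_normK ?num_real// sqr_sqrtr ?fine_ge0 ?invPhi_ge0//.
    rewrite ler_wpM2r ?fine_ge0 ?invPhi_ge0//.
    by rewrite lerXn2r ?nnegrE ?mulr_ge0 ?normc_ge0'.
  rewrite EFinM lee_pmul ?lee_fin ?sqr_ge0 ?fine_ge0 ?invPhi_ge0//.
  by have := invPhi_ge0 phihat t; case: (_^-1)%E.
rewrite ge0_integralZl//; last 2 first.
- by move=> t _; exact: quot_ge0.
- by rewrite lee_fin sqr_ge0.
by rewrite lte_mul_pinfty ?lee_fin ?sqr_ge0//; exact: quot_charpoly_lty.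
Qed.

Lemma psi_inv_psi_ae : {ae mu, forall t, psi phihat t * conjc (inv_psi t) = box 0 1 t}.
Proof.
apply: ae_imp (Phi_gt0_ae lh hsing) => t Pt.
have [t01|t01] := pselect (0 <= t < 1); last by rewrite psi_out// box_out// mul0r.
have [fP P0 _] := Pt t01; rewrite /psi /inv_psi box_in// !mul1r -(fineK fP).
rewrite inver gt_eqF// (_ : conjc _ = ((Num.sqrt (fine (Phi t))^-1)%:C)%C); last first.
  by apply: complex_ext; rewrite ?Re_conjc ?Im_conjc //= oppr0.
by rewrite -real_complexM -sqrtrM ?ltW// divff ?sqrtr1// gt_eqF.
Qed.

(** [Phi] cancels almost everywhere, so the pairing reads off the conjugated coefficient of
    frequency [k]. *)
Lemma dot_model_dual r c k :
  L2 (fun t => trig r c t * inv_psi t) ->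
  dot (model k) (fun t => trig r c t * inv_psi t) = \sum_(l <- r) conjc (c l) * (k == l)%:R.
Proof.
move=> lD; rewrite -cintegral_box_conj_trig; apply: ae_eq_cintegral.
- by apply: cintegrable_measurable; apply: L2_mul_conj => //; exact: L2_model.
- by apply: cintegrable_measurable; exact: cintegrable_box_conj_trig.
apply: ae_imp psi_inv_psi_ae => t <-; rewrite /model conjcM; ring.
Qed.

(* Reduction modulo [W] (or modulo [W] and a power of ['X], which is prime to [W])
   corrects [osc k] by frequencies of the window into a multiple of [W]. *)
Lemma window_elimination (n k : int) : ~~ (n <= k < n + L%:Z) ->
  exists c C, [/\ 0 <= C, c k = 1 &
    forall t : R, normc (trig (k :: window n L) c t) <= C * normc W.[osc 1 t]].
Proof.
move=> kn; suff [p [Q [w [sp pQ]]]] : exists (p Q : {poly R[i]}) (w : int),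
    (size p <= L)%N /\ forall t : R,
      osc k%:~R t - osc n%:~R t * p.[osc 1 t] = osc w%:~R t * (W * Q).[osc 1 t].
  (* As [k] is outside the window, the value 1 at [k] does not disturb the coefficients of [- p],
     placed from [n] to [n + L - 1]. *)
  pose c l := if l == k then 1 else - p`_(absz (l - n)).
  have [S S0 SP] := poly_circle_bounded Q.
  exists c, S; split => //; first by rewrite /c eqxx.
  move=> t; rewrite /trig big_cons {1}/c eqxx mul1r -/(trig (window n L) c t).
  rewrite (@trig_window _ _ _ (- p)); first last.
  - move=> i iL; rewrite /c (_ : n + i%:Z - n = i%:Z) ?absz_nat ?coefN ?ifF//; last by rewrite addrC addKr.
    by apply: contraNF kn => /eqP <-; rewrite lerDl ltrD2l ltz_nat.
  - by rewrite size_polyN.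
  rewrite hornerN mulrN pQ hornerM !normcM normc_osc mul1r mulrC.
  by rewrite ler_wpM2r ?normc_ge0'.
(* The lower frequency is factored out, leaving polynomials in [osc 1]: [X^(k - n) - p] when
   [n <= k], and [1 - X^(n - k) p] otherwise. *)
have [nk|nk] := lerP n k.
  have [p [Q [sp pQ]]] := charpoly_remainder x lambda `|k - n|%N.
  exists p, Q, n; split=> // t; rewrite -pQ hornerD hornerN hornerXn -(oscXl 1) mul1r mulrBr.
  congr (_ - _); rewrite -oscDl -[_%:R]/((_%:Z)%:~R) gez0_abs ?subr_ge0//.
  by rewrite -intrD subrKC.
have [p [Q [sp pQ]]] := charpoly_remainder_inv x lambda `|n - k|%N.
exists p, Q, k; split=> // t; rewrite -pQ hornerD hornerN hornerM hornerXn hornerC.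
rewrite -(oscXl 1) mul1r mulrBr mulr1 mulrA; congr (_ - _ * _).
rewrite -oscDl -[_%:R]/((_%:Z)%:~R) gez0_abs ?subr_ge0 ?ltW//.
by rewrite -intrD subrKC.
Qed.

Lemma model_minimal (n : int) : minimal_system (~` [set j | n <= j < n + L%:Z]) model.
Proof.
move=> k /= /negP kn cs; have [c [C [C0 ck DW]]] := window_elimination kn.
have lD := L2_dual (cmeasurable_trig _ _) C0 DW.
have d j : ~ (n <= j < n + L%:Z) ->
    dot (model j) (fun t => trig (k :: window n L) c t * inv_psi t) = (j == k)%:R.
  move=> /negP jn; rewrite dot_model_dual// big_cons ck conjc1 mul1r.
  by rewrite sum_delta ?window_uniq// mem_window (negbTE jn) addr0.
have := closed_span_orthogonal (L2_model lh) lD _ cs.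
rewrite d; last exact/negP.
rewrite eqxx => H.
suff : 1 = 0 :> R[i] by move=> /eqP; rewrite oner_eq0.
by apply: H => j [/= jn jk]; rewrite d//; case: eqP.
Qed.

End dual_functions.

(** * Totality in the model *)

Section totality.
Context {R : realType}.
Local Notation mu := (@lebesgue_measure R).
Variable phihat : R -> R[i].
Hypothesis lh : L2 phihat.
Local Notation Phi := (periodization phihat).
Variables (s : nat) (x : 'I_s -> R) (lambda : 'I_s -> nat).
Hypothesis hsing : singularities_exactly Phi x lambda.
Local Notation L := (\sum_(j < s) lambda j)%N.
Local Notation W := (charpoly x lambda).
Local Notation model := (model phihat).

Definition vanishing (u : nat -> R) : Prop :=
  forall e : R, 0 < e -> exists N, forall n, (N <= n)%N -> u n < e.

Lemma vanishing_sum (r : seq int) (z : int -> R[i]) (d : nat -> int -> R[i]) :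
  (forall l, vanishing (fun n => normc (d n l) ^+ 2)) ->
  vanishing (fun n => normc (\sum_(l <- r) z l * d n l) ^+ 2).
Proof.
move=> vd; elim: r => [|l r IHr] e e0.
  by exists 0%N => n _; rewrite big_nil normc0 expr0n.
have z0 : 0 < normc (z l) ^+ 2 + 1 by rewrite ltr_wpDl// sqr_ge0.
have e1 : 0 < e / 4 / (normc (z l) ^+ 2 + 1) by rewrite !divr_gt0.
have [N NP] := vd l _ e1; have [M MP] := IHr (e / 4) (divr_gt0 e0 (ltr0n _ 4)).
exists (maxn N M) => n; rewrite geq_max => /andP[/NP h1 /MP h2].
rewrite big_cons; apply: le_lt_trans (sqr_normcD_le _ _) _.
have h3 : normc (z l * d n l) ^+ 2 < e / 4.
  rewrite normcM exprMn; move: h1; rewrite ltr_pdivlMr// => h1.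
  have := sqr_ge0 (normc (d n l)).
  by move: h1; move: (normc (d n l) ^+ 2) (normc (z l) ^+ 2) (e / 4) => *; nra.
by move: h2 h3; move: (normc _ ^+ 2) (normc _ ^+ 2) => *; lra.
Qed.

Lemma trig_charpoly (m : int) t :
  trig (window m L.+1) (fun l => W`_(absz (l - m))) t = osc m%:~R t * W.[osc 1 t].
Proof.
apply: trig_window => [|i iL]; first by rewrite size_charpoly.
by rewrite (_ : m + i%:Z - m = i%:Z) ?absz_nat// addrC addKr.
Qed.

Lemma L2_dual_charpoly (m : int) :
  L2 (fun t => osc m%:~R t * W.[osc 1 t] * inv_psi phihat t).
Proof.
under eq_fun do rewrite -trig_charpoly.
apply: (@L2_dual _ _ lh _ _ _ hsing _ 1) => // [|t]; first exact: cmeasurable_trig.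
by rewrite trig_charpoly normcM normc_osc.
Qed.

Lemma orthogonal_dual_ae F : L2 F ->
  (forall m : int, dot F (fun t => osc m%:~R t * W.[osc 1 t] * inv_psi phihat t) = 0) ->
  {ae mu, forall t, 0 <= t < 1 -> F t = 0}.
Proof.
move=> lF oF.
have : {ae mu, forall t, F t * conjc (osc 0%:~R t * W.[osc 1 t] * inv_psi phihat t) = 0}.
  apply: (@fourier_uniqueness R 0 1) => //.
  - by apply: L2_mul_conj => //; exact: L2_dual_charpoly.
  - by move=> t t01; rewrite inv_psi_out// mulr0 conjc0 mulr0.
  move=> k; rewrite subr0 divr1 -[RHS](oF (- k)); congr cintegral; apply/funext => t.
  by rewrite !conjcM !conj_osc -!intrN opprK oppr0 osc0l; ring.
move=> H; have E := ae_imp2 (fun _ p q => conj p q) (psi_inv_psi_ae lh hsing) (Phi_gt0_ae lh hsing).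
(* Almost everywhere on [[0, 1[] neither factor multiplying [F] vanishes: [W] is nonzero there, and
   [psi * conjc inv_psi = 1]. *)
apply: (ae_imp2 _ H E) => t /eqP + [pE Pt] t01; have [_ _ W0] := Pt t01.
rewrite osc0l mul1r mulf_eq0 conjc_eq0 mulf_eq0 (negbTE W0)/= => /orP[/eqP//|/eqP i0].
by move: pE; rewrite i0 conjc0 mulr0 box_in// => /esym/eqP; rewrite oner_eq0.
Qed.

(* The limit of [F n] is orthogonal to every [osc m * W * inv_psi], because each such
   pairing only involves finitely many of the vanishing coefficients. *)
Lemma model_total (r : nat -> seq int) (c : nat -> int -> R[i]) :
  let F n t := \sum_(k <- r n) c n k * model k t in
  (forall e : R, 0 < e -> exists N, forall n m, (N <= n)%N -> (N <= m)%N ->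
     n2 (fun t => F n t - F m t) < e) ->
  (forall l, vanishing (fun n => normc (\sum_(k <- r n) c n k * (k == l)%:R) ^+ 2)) ->
  vanishing (fun n => n2 (F n)).
Proof.
move=> F cauchy coef; have lF n : L2 (F n) by exact: L2_sum_model.
have [G lG FG] := riesz_fischer lF cauchy.
have G0 : {ae mu, forall t, 0 <= t < 1 -> G t = 0}.
  apply: orthogonal_dual_ae => // m; set g := (fun t => _).
  have lg : L2 g := L2_dual_charpoly m.
  have Fg n : dot (F n) g = \sum_(l <- window m L.+1)
      conjc W`_(absz (l - m)) * (\sum_(k <- r n) c n k * (k == l)%:R).
    have gE : g = (fun t => trig (window m L.+1) (fun l => W`_(absz (l - m))) t * inv_psi phihat t).
      by apply/funext => t; rewrite trig_charpoly.
    rewrite /F dot_suml//; last by move=> k; apply: L2Z; exact: L2_model.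
    under [RHS]eq_bigr do rewrite mulr_sumr.
    rewrite exchange_big/=; apply: eq_bigr => k _; rewrite dotZl//; last exact: L2_model.
    rewrite gE (dot_model_dual lh hsing); last by rewrite -gE.
    by rewrite mulr_sumr; apply: eq_bigr => l _; rewrite mulrCA.
  apply/eq0_normc/eqP; rewrite -[_ == 0]sqrf_eq0 eq_le sqr_ge0 andbT.
  (* [dot G g] is split as [dot (G - F n) g + dot (F n) g]: Cauchy-Schwarz bounds the square of the
     first by [e * n2 g], and the square of the second is below [e]. *)
  apply: (@small_le0 _ _ (2 * n2 g + 2)) => e e0.
  have [N NP] := FG e e0.
  have [M MP] := vanishing_sum (window m L.+1) (fun l => conjc W`_(absz (l - m))) coef e0.
  pose n := maxn N M; have h1 := NP n (leq_maxl _ _); have h2 := MP n (leq_maxr _ _).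
  rewrite -Fg in h2.
  have := cauchy_schwarz (L2B lG (lF n)) lg; rewrite dotBl// n2BC.
  have := sqr_normcD_le (dot G g - dot (F n) g) (dot (F n) g); rewrite subrK.
  move: h1 h2 (n2_ge0 g).
  move: (n2 g) (n2 _) (normc _ ^+ 2) (normc _ ^+ 2) (normc _ ^+ 2) => *; nra.
move=> e e0; have [N NP] := FG e e0; exists N => n /NP; apply: le_lt_trans.
have lFG := L2B (lF n) lG.
(* [G] is known to vanish only on [[0, 1[], while [F n] vanishes outside it; so [F n] agrees almost
   everywhere with [F n - G] cut off to [[0, 1[]. *)
rewrite (@ae_eq_n2 _ _ (fun t => box 0 1 t * (F n t - G t))).
- rewrite -[leRHS]mul1r -[X in X * _](expr1n _ 2); apply: n2M_bounded => //.
    exact: cmeasurable_box.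
  exact: normc_box_le1.
- by case: (lF n).
- by apply: cmeasurableM; [exact: cmeasurable_box|case: lFG].
apply: ae_imp G0 => t Gt; have [t01|t01] := pselect (0 <= t < 1).
  by rewrite Gt// subr0 box_in// mul1r.
rewrite box_out// mul0r /F big1// => k _; by rewrite /model psi_out// !mulr0.
Qed.

End totality.

(** * Back to the translates of [phi] *)

Section transfer.
Context {R : realType}.
Local Notation mu := (@lebesgue_measure R).
Variables phi phihat : R -> R[i].
Hypothesis ft : is_fourier_transform phi phihat.

Let lp : L2 phi. Proof. by case: ft => /cLp2E. Qed.
Let lh : L2 phihat. Proof. by case: ft => _ /cLp2E. Qed.

Lemma n2_translate_model r c :
  n2 (fun x => \sum_(k <- r) c k * translate phi k x) <=
  16 * n2 (fun t => \sum_(k <- r) c k * model phihat k t).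
Proof. by rewrite sum_model n2_trig_psi//; case: (n2_shift_sum_fourier r c ft). Qed.

Lemma n2_model_translate r c :
  n2 (fun t => \sum_(k <- r) c k * model phihat k t) <=
  4 * n2 (fun x => \sum_(k <- r) c k * translate phi k x).
Proof. by rewrite sum_model n2_trig_psi//; case: (n2_shift_sum_fourier r c ft). Qed.

Variables (s : nat) (x : 'I_s -> R) (lambda : 'I_s -> nat).
Hypothesis hsing : singularities_exactly (periodization phihat) x lambda.
Variable n : int.
Local Notation Omegac := (~` [set j : int | n <= j < n + (\sum_(j < s) lambda j)%N%:Z]).

Let ly k : L2 (translate phi k). Proof. exact: L2_translate. Qed.

Lemma shift_space_sub : shift_space phi `<=` closed_span Omegac (translate phi).
Proof.
move=> f; apply: closed_span_trans => // k _.
apply: (@closed_span_transfer _ _ _ (model phihat) _ 16) => //.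
- exact: L2_model.
- exact: n2_translate_model.
- exact: (model_complete lh hsing).
Qed.

Lemma translate_minimal : minimal_system Omegac (translate phi).
Proof.
move=> k kn cs; apply: (model_minimal lh hsing kn).
apply: (@closed_span_transfer _ _ _ (translate phi) _ 4) cs => //.
- exact: L2_model.
- exact: n2_model_translate.
Qed.

(** Finite sums [T i] converge to [f], and their coefficients, equal to [dot (T i) (h l)], tend to
    [dot f (h l) = 0]. The same combinations [F i] in the model are Cauchy, so [model_total] makes
    them tend to 0; the norm comparison then brings [T i] to 0, and [f] with it. *)
Lemma translate_total (h : int -> R -> R[i]) f :
  (forall k, Omegac k -> L2 (h k) /\
     forall j, Omegac j -> dot (translate phi j) (h k) = (j == k)%:R) ->
  shift_space phi f -> (forall k, Omegac k -> dot f (h k) = 0) ->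
  {ae mu, forall t, f t = 0}.
Proof.
move=> hP /shift_space_sub/(closed_spanP _ _ ly)[lf Hf] fh.
pose eps (i : nat) : R := i.+1%:R^-1.
have eps0 i : 0 < eps i by rewrite invr_gt0.
have epsv (e : R) : 0 < e -> exists N, forall i, (N <= i)%N -> eps i < e.
  move=> e0; exists (Num.truncn e^-1) => i Ni.
  rewrite invf_plt ?posrE//; apply: lt_le_trans (truncnS_gt _) _.
  by rewrite ler_nat.
have H i : exists rc : seq int * (int -> R[i]), (forall k, k \in rc.1 -> Omegac k) /\
    n2 (fun t => f t - \sum_(k <- rc.1) rc.2 k * translate phi k t) < eps i.
  by have [g [r [c [rJ ->]]] ge] := Hf _ (eps0 i); exists (r, c).
have [rc rcP] := choice H.
pose T i t := \sum_(k <- (rc i).1) (rc i).2 k * translate phi k t.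
pose F i t := \sum_(k <- (rc i).1) (rc i).2 k * model phihat k t.
have lT i : L2 (T i) by apply: L2_sum => k; exact: L2Z.
have fT i : n2 (fun t => f t - T i t) < eps i by case: (rcP i).
have FT i j : n2 (fun t => F i t - F j t) <= 4 * n2 (fun t => T i t - T j t).
  have [r [c rE]] := sumB_merge (rc i).1 (rc j).1 (rc i).2 (rc j).2.
  rewrite /F /T; under eq_fun do rewrite (rE (fun k => model phihat k _)).
  under [in leRHS]eq_fun do rewrite (rE (fun k => translate phi k _)).
  exact: n2_model_translate.
have TT i j : n2 (fun t => T i t - T j t) <= 2 * eps i + 2 * eps j.
  have := n2D_le (L2B (lT i) lf) (L2B lf (lT j)).
  rewrite (_ : (fun t => _ + _) = (fun t => T i t - T j t)); last by apply/funext => t; ring.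
  rewrite n2BC; move: (fT i) (fT j); move: (n2 _) (n2 _) (n2 _) (eps i) (eps j) => *; lra.
have Fv : vanishing (fun i => n2 (F i)).
  apply: (model_total lh hsing) => [e e0|l e e0].
    (* The bounds [FT] and [TT] combine to [4 * (2 * eps i + 2 * eps j)], which is below [e] once
       both terms are below [e / 16]. *)
    have [N NP] := epsv (e / 16) (divr_gt0 e0 (ltr0n _ 16)).
    exists N => i j /NP hi /NP hj; move: hi hj (FT i j) (TT i j).
    move: (n2 _) (n2 _) (eps i) (eps j) => *; lra.
  (* The sums only use indices outside the window, so coefficients inside it are 0 from the
     start. *)
  have [Jl|nJl] := pselect (Omegac l); last first.
    exists 0%N => i _; rewrite big_seq big1 ?normc0 ?expr0n// => k /(rcP i).1 Jk.
    by case: eqP => [kl|]; rewrite ?mulr0//; case: nJl; rewrite -kl.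
  have [lhl hl] := hP l Jl.
  have [N NP] := epsv (e / (n2 (h l) + 1)) (divr_gt0 e0 (ltr_wpDl (n2_ge0 _) ltr01)).
  exists N => i /NP hi.
  have Th : dot (T i) (h l) = \sum_(k <- (rc i).1) (rc i).2 k * (k == l)%:R.
    rewrite /T dot_suml//; last by move=> k; exact: L2Z.
    by rewrite big_seq [RHS]big_seq; apply: eq_bigr => k /(rcP i).1 Jk; rewrite dotZl// hl.
  rewrite -Th; have := cauchy_schwarz (L2B (lT i) lf) lhl.
  rewrite dotBl// (fh l Jl) subr0 n2BC => /le_lt_trans; apply.
  move: hi (fT i) (n2_ge0 (h l)) (n2_ge0 (fun t => f t - T i t)).
  rewrite ltr_pdivlMr; last by rewrite ltr_wpDl ?n2_ge0.
  by move: (n2 (h l)) (n2 _) (eps i) => *; nra.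
apply: n2_eq0 => //; apply/eqP; rewrite eq_le n2_ge0 andbT.
(* [34 = 2 + 2 * 16], from [n2 f <= 2 * n2 (f - T i) + 2 * n2 (T i)] and the constant 16 of the
   comparison with the model. *)
apply: (@small_le0 _ _ 34) => e e0.
have [N NP] := epsv e e0; have [M MP] := Fv e e0; pose i := maxn N M.
have h1 := NP i (leq_maxl _ _); have h2 := MP i (leq_maxr _ _).
have h3 : n2 (T i) <= 16 * n2 (F i) by exact: n2_translate_model.
have := n2D_le (L2B lf (lT i)) (lT i).
rewrite (_ : (fun t => _ + _) = f); last by apply/funext => t; rewrite subrK.
move: h1 h2 h3 (fT i); move: (n2 _) (n2 _) (n2 _) (n2 _) (eps i) => *; lra.
Qed.

End transfer.

Theorem proposition3 (R : realType) (phi phihat : R -> R[i])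
    (hphi : cLp 2%:E phi)
    (hphihat : is_fourier_transform phi phihat)
    (s : nat) (x : 'I_s -> R) (lambda : 'I_s -> nat)
    (hsing : singularities_exactly (periodization phihat) x lambda)
    (hLambda : (1 <= \sum_(j < s) lambda j)%N)
    (Omega : set int)
    (hOmega : consecutive_integers Omega (\sum_(j < s) lambda j)%N) :
  M_basis (~` Omega) (translate phi) (shift_space phi).
Proof.
have [n ->] := hOmega; have ly k : L2 (translate phi k) by apply: L2_translate; exact/cLp2E.
have min := translate_minimal hphihat hsing (n := n).
split => //.
  split; last exact: shift_space_sub hphihat _ _ _ hsing n.
  move=> k _; apply/(closed_spanP _ _ ly); split => // e e0.
  exists (translate phi k); first exact: span_gen.
  by rewrite /n2 /sqn; under eq_integral do rewrite subrr normc0 expr0n/=; rewrite integral0.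
(* The dual functionals are the inner products with a biorthogonal family in L^2(R), which
   minimality alone provides. *)
have [h hP] := minimal_biorthogonal ly min.
exists (fun k f => dot f (h k)).
  split=> [k /hP[lhk _]|j k Jj Jk]; last by have [_ ->] := hP k Jk.
  by apply: dot_bounded_functional lhk => f /(closed_spanP _ _ ly)[].
by move=> f Bf; exact: translate_total hphihat _ _ _ hsing n h f hP Bf.
Qed.
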